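(* Consider the family of piecewise polynomial holomorphic systems $$\dot z = -i(z-1)+\varepsilon h^{\sigma}(z),\qquad z\in\Sigma_\sigma^E,\quad \sigma\in\{+,c,-\},$$ where $\Sigma_+^E=\{|z|<1\}$, $\Sigma_c^E=\{|z|>1,\ |z-2|>1\}$, $\Sigma_-^E=\{|z-2|<1\}$, and $$h^{\sigma}(z)=\sum_{j=0}^{4}(a_j^{\sigma}+ib_j^{\sigma})z^j,\qquad a_j^\sigma,b_j^\sigma\in\mathbb R .$$ Then, for $\varepsilon$ sufficiently small, a lower bound for the (maximum) number of limit cycles bifurcating from the periodic solutions of the unperturbed center $\dot z=-i(z-1)$ is $5$. That is, the coefficients $a_j^\sigma,b_j^\sigma$ can be chosen so that for all sufficiently small $\varepsilon\neq 0$ the system has at least $5$ limit cycles bifurcating from periodic orbits of $\dot z=-i(z-1)$.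
   Context: The system is a planar piecewise-smooth system ($z=x+iy\in\mathbb C\cong\mathbb R^2$) with three zones separated by the externally tangent circles $\{|z|=1\}$ and $\{|z-2|=1\}$; the dynamics on the circles follows Filippov's convention (where both adjacent vector fields cross the curve transversally in the same direction, trajectories are obtained by concatenation). A limit cycle is an isolated periodic orbit. A limit cycle $\gamma_\varepsilon$ bifurcates from a periodic orbit $L$ of the unperturbed ($\varepsilon=0$) system if $\gamma_\varepsilon\to L$ as $\varepsilon\to0$. *)

(* Defs.v *)
From HB Require Import structures.
From mathcomp Require Import all_boot all_order all_algebra.
From mathcomp Require Import complex.
From mathcomp Require Import all_classical all_reals all_analysis.

Set Implicit Arguments.
Unset Strict Implicit.
Unset Printing Implicit Defensive.

Import Order.TTheory GRing.Theory Num.Theory.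
Import numFieldNormedType.Exports.

Local Open Scope classical_set_scope.
Local Open Scope ring_scope.
Local Open Scope complex_scope.

Inductive zone := Zplus | Zc | Zminus.

Definition zone_code (s : zone) : 'I_3 :=
  match s with Zplus => inord 0 | Zc => inord 1 | Zminus => inord 2 end.

Definition zone_decode (i : 'I_3) : zone :=
  match val i with 0%N => Zplus | 1%N => Zc | _ => Zminus end.

Lemma zone_codeK : cancel zone_code zone_decode.
Proof. by case; rewrite /zone_decode /= inordK. Qed.

HB.instance Definition _ := Finite.copy zone (can_type zone_codeK).

Section Defs.
Context {R : realType}.
Implicit Types (a b : zone -> 'I_5 -> R) (X : zone -> R[i] -> R[i]).
Implicit Types (z v : R -> R[i]) (g : set R[i]).

(* The norm of R[i] is R[i]-valued; < on R[i] only compares numbers with the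
   same imaginary part, which is harmless as all norms are real. *)
Definition Sigma (s : zone) : set R[i] :=
  match s with
  | Zplus  => [set w | `|w| < 1]
  | Zc     => [set w | 1 < `|w| /\ 1 < `|w - 2%:R|]
  | Zminus => [set w | `|w - 2%:R| < 1]
  end.

Definition h a b (s : zone) (w : R[i]) : R[i] :=
  \sum_(j < 5) (a s j +i* b s j) * w ^+ j.

Definition field a b (eps : R) (s : zone) (w : R[i]) : R[i] :=
  - 'i%C * (w - 1) + eps%:C * h a b s w.

(* Filippov's set-valued extension of the field equal to X s on Sigma s: the
   convex hull of the limits of that field at w along points off the switching
   circles.  As each X s is meant to be continuous on the whole plane, these
   limits are the X s w for the zones s adherent to w; inside a zone the hull
   is a singleton.  The type R[i]^o is R[i] with the topology of its norm. *)
Definition filippov X (w : R[i]) : set R[i] :=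
  [set u | exists lam : zone -> R,
    [/\ forall s, 0 <= lam s,
        \sum_s lam s = 1,
        forall s, lam s != 0 -> closure (Sigma s : set (R[i])^o) w
      & u = \sum_s (lam s)%:C * X s w]].

(* Absolutely continuous solutions, on the whole line, of the differential
   inclusion z' \in filippov X z a.e.; absolute continuity is expressed by z
   being an indefinite Lebesgue integral of its a.e. derivative v. *)
Definition solution X z : Prop :=
  exists v,
    [/\ locally_integrable setT (fun t => complex.Re (v t)),
        locally_integrable setT (fun t => complex.Im (v t)),
        {ae lebesgue_measure, forall t : R, filippov X (z t) (v t)}
      & forall s t : R, s <= t ->
          complex.Re (z t) - complex.Re (z s) =
            \int[lebesgue_measure]_(x in `[s, t]) complex.Re (v x) /\
          complex.Im (z t) - complex.Im (z s) =
            \int[lebesgue_measure]_(x in `[s, t]) complex.Im (v x)].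

Definition periodic_orbit X g : Prop :=
  exists z (T : R),
    [/\ solution X z, 0 < T, forall t, z (t + T) = z t,
        exists t, z t != z 0
      & g = range z].

Definition tube (d : R) g : set R[i] :=
  [set w | exists2 u, g u & `|w - u| < d%:C].

Definition limit_cycle X g : Prop :=
  periodic_orbit X g /\
  exists2 d : R, 0 < d &
    forall g', periodic_orbit X g' -> g' `<=` tube d g -> g' = g.

(* Convergence of gam eps to L, as eps tends to 0, in Hausdorff distance. *)
Definition hausdorff_cvg (gam : R -> set R[i]) (L : set R[i]) : Prop :=
  forall d : R, 0 < d -> \forall eps \near 0^',
    gam eps `<=` tube d L /\ L `<=` tube d (gam eps).

End Defs.

(* Main.v *)
(* Put w = z - 1 and take a linear perturbation a w outside the disc |w + 1| < 1 and
   a w + c0 + c2 w^2 + c3 w^3 + c4 w^4 inside it, with real coefficients; then only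
   the circle |w + 1| = 1 is a true switching line.  Coordinates (x, s) of the annulus
   0 < |w| < 2, with |w| = 2 cos x and with the inside of the disc given by sin s > 0,
   straighten this circle and turn the discontinuous planar system into one continuous
   scalar equation x' = e f(e, x, s), 2 pi-periodic in s.  By averaging, each simple
   zero of the Melnikov function m(x), the integral of f(0, x, s) over a period, yields
   for small e <> 0 a periodic solution which is the only one near the zero, among the
   solutions of period any multiple of 2 pi.  The coefficients are chosen so that
   m has five simple zeros.  Conversely, a Filippov solution near the annulus is
   classical off the circle and crosses it at once, because there the unperturbed field
   is transversal to the circle; forward uniqueness then makes it the image of a
   solution of the scalar equation.  Hence the closed curves obtained are isolated. *)
Require Import Defs.
From mathcomp Require Import all_boot all_order all_algebra.
From mathcomp Require Import complex ring lra.
From mathcomp Require Import all_classical all_reals all_analysis measurable_realfun.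
Set Implicit Arguments.
Unset Strict Implicit.
Unset Printing Implicit Defensive.
Import Order.TTheory GRing.Theory Num.Theory.
Import numFieldNormedType.Exports.
Local Open Scope classical_set_scope.
Local Open Scope ring_scope.
Local Open Scope complex_scope.

(** The obstacle is the jump of the field at the circle, because of which the planar system cannot
    be averaged as it stands. The polar angle along each arc of [|w| = 2 cos x] is affine in
    [cos s], so dt/ds vanishes at every crossing and absorbs the jump: the scalar field is
    continuous in [s] and differentiable in [x]. The price is that [s] is only a continuous function
    of time at a crossing. Differentiable dependence on initial data is avoided as well: strict
    differentiability, uniform in [s], bounds the difference of two displacements directly, and this
    single estimate yields existence, uniqueness and the exclusion of longer periods. The linear
    coefficient [a] is the same on both sides because the two arcs then contribute [2 a x] and
    [2 a (pi - x)], with constant sum; so [m] contains no bare [x], and its zeros on (0, pi/2) are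
    those of a polynomial in [tan x]. As [m] is linear in the five numbers [a], [c0], [c2], [c3],
    [c4], linear algebra alone prescribes only four zeros; the fifth comes from a particular choice
    of them. *)

(** * Derivatives, increments and primitives on the real line *)

Section Calculus.
Context {R : realType}.
Implicit Types (f g df dg : R -> R) (x a b K : R).

Lemma deriveD1 f g x a b : is_derive x 1 f a -> is_derive x 1 g b ->
  is_derive x 1 (fun t => f t + g t) (a + b).
Proof. by move=> fa gb; exact: is_deriveD. Qed.

Lemma deriveB1 f g x a b : is_derive x 1 f a -> is_derive x 1 g b ->
  is_derive x 1 (fun t => f t - g t) (a - b).
Proof. by move=> fa gb; exact: is_deriveB. Qed.

Lemma deriveN1 f x a : is_derive x 1 f a -> is_derive x 1 (fun t => - f t) (- a).
Proof. by move=> fa; exact: is_deriveN. Qed.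

Lemma deriveM1 f g x a b : is_derive x 1 f a -> is_derive x 1 g b ->
  is_derive x 1 (fun t => f t * g t) (a * g x + f x * b).
Proof.
move=> fa gb; apply: (is_derive_eq (is_deriveM fa gb)).
by rewrite addrC /GRing.scale /= (mulrC (g x)).
Qed.

Lemma derive_comp1 f g x a b : is_derive (g x) 1 f a -> is_derive x 1 g b ->
  is_derive x 1 (fun t => f (g t)) (a * b).
Proof. by move=> fa gb; exact: (@is_derive1_comp _ f g). Qed.

Lemma deriveV1 f x a : f x != 0 -> is_derive x 1 f a ->
  is_derive x 1 (fun t => (f t)^-1) (- a / f x ^+ 2).
Proof.
move=> f0 fa; apply: (is_derive_eq (is_deriveV f0 fa)).
by rewrite /GRing.scale /= mulNr mulrC mulNr.
Qed.

Lemma derive_continuous f x a : is_derive x 1 f a -> {for x, continuous f}.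
Proof.
by move=> [fx _]; apply/differentiable_continuous/derivable1_diffP.
Qed.

Lemma continuous_dist_lt f x (e : R) : {for x, continuous f} -> 0 < e ->
  \forall t \near x, `|f x - f t| < e.
Proof. by move=> /cvgrPdist_lt; apply. Qed.

Lemma derive_continuous_within f (df : R -> R) (A : set R) :
  (forall x, is_derive x 1 f (df x)) -> {within A, continuous f}.
Proof.
by move=> fdf; apply: continuous_subspaceT => x; exact: derive_continuous.
Qed.

Lemma derivable_eq_near f g x a : (\forall t \near x, f t = g t) ->
  is_derive x 1 f a -> is_derive x 1 g a.
Proof. by move=> fg fa; exact: (near_eq_is_derive fg fa). Qed.

(** Produces a derivative from increment bounds, which is all that is known of an integral of an
    a.e. velocity or of a strictly differentiable function. *)
Lemma is_derive_eps f x a :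
  (forall e : R, 0 < e -> exists2 d : R, 0 < d & forall h : R, `|h| < d ->
    `|f (x + h) - f x - a * h| <= e * `|h|) -> is_derive x 1 f a.
Proof.
move=> H.
have cv : h^-1 *: (f (h *: (1 : R) + x) - f x) @[h --> 0^'] --> a.
  apply/cvgrPdist_le => e e0.
  have [d d0 Hd] := H _ e0.
  near=> h.
  have h0 : h != 0 by near: h; exact: nbhs_dnbhs_neq.
  have hd : `|h| < d by near: h; exact: dnbhs0_lt.
  have := Hd _ hd.
  rewrite {1}[h *: 1]/GRing.scale /= mulr1 (addrC h x) => Hh.
  rewrite -(@ler_pM2r _ `|h|) ?normr_gt0// -normrM.
  rewrite -normrN (_ : - ((_ - _) * h) = f (x + h) - f x - a * h)//.
  by rewrite -mulNr opprB mulrBl /GRing.scale /= mulrAC mulVf// mul1r.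
split; first by apply/cvg_ex; exists a.
exact: cvg_lim.
Unshelve. all: by end_near. Qed.

(** The mean value theorem for [g - f]; comparing increments in this way replaces integral
    inequalities in the estimates for differential equations. *)
Lemma ler_increment f g df dg a b : a <= b ->
  {within `[a, b], continuous f} -> {within `[a, b], continuous g} ->
  (forall x, a < x < b -> is_derive x 1 f (df x)) ->
  (forall x, a < x < b -> is_derive x 1 g (dg x)) ->
  (forall x, a < x < b -> df x <= dg x) ->
  f b - f a <= g b - g a.
Proof.
move=> ab cf cg fdf gdg dfg; move: ab; rewrite le_eqVlt => /predU1P[->|ab].
  by rewrite !subrr.
have [||c cab E] := @MVT _ (fun x => g x - f x) (fun x => dg x - df x) a b ab.
- by move=> x; rewrite in_itv/= => xab; apply: deriveB1; [exact: gdg|exact: fdf].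
- by move=> x; apply: cvgB; [exact: cg|exact: cf].
have : 0 <= (dg c - df c) * (b - a).
  by rewrite mulr_ge0 ?subr_ge0 ?(ltW ab)// dfg.
by rewrite -E; lra.
Qed.

Lemma eq_increment f g df dg a b : a <= b ->
  (forall x, is_derive x 1 f (df x)) -> (forall x, is_derive x 1 g (dg x)) ->
  (forall x, a < x < b -> df x = dg x) -> f b - f a = g b - g a.
Proof.
move=> ab fdf gdg dfg.
have cf := derive_continuous_within fdf; have cg := derive_continuous_within gdg.
have eq_le1 (u v : R) : u = v -> u <= v by move=> ->.
apply/eqP; rewrite eq_le; apply/andP; split.
  exact: (ler_increment ab (cf _) (cg _) (fun x _ => fdf x) (fun x _ => gdg x)
    (fun x xab => eq_le1 _ _ (dfg x xab))).
exact: (ler_increment ab (cg _) (cf _) (fun x _ => gdg x) (fun x _ => fdf x)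
  (fun x xab => eq_le1 _ _ (esym (dfg x xab)))).
Qed.

Lemma norm_increment f g df dg a b : a <= b ->
  {within `[a, b], continuous f} -> {within `[a, b], continuous g} ->
  (forall x, a < x < b -> is_derive x 1 f (df x)) ->
  (forall x, a < x < b -> is_derive x 1 g (dg x)) ->
  (forall x, a < x < b -> `|df x| <= dg x) ->
  `|f b - f a| <= g b - g a.
Proof.
move=> ab cf cg fdf gdg dfg; rewrite ler_norml; apply/andP; split.
  have := @ler_increment (fun x => - f x) g (fun x => - df x) dg a b ab.
  rewrite lerNl => H; apply: le_trans (H _ _ _ _ _) => //; first lra.
  - by move=> x; apply: cvgN; exact: cf.
  - by move=> x /fdf ?; exact: deriveN1.
  - by move=> x /dfg; rewrite ler_norml => /andP[]; lra.
apply: (@ler_increment f g df dg a b ab) => // x /dfg.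
by rewrite ler_norml => /andP[].
Qed.

Lemma mean_value f df u v w r : (forall x, is_derive x 1 f (df x)) ->
  `|u - w| <= r -> `|v - w| <= r ->
  exists2 z, `|z - w| <= r & f u - f v = df z * (u - v).
Proof.
move=> fdf; wlog vu : u v / v <= u.
  move=> H ur vr; have [vu|/ltW uv] := leP v u; first exact: H.
  have [z zr E] := H _ _ uv vr ur; exists z => //.
  by rewrite -opprB E -mulrN opprB.
move=> ur vr; have [z] := MVT_segment vu (fun x _ => fdf x)
  (derive_continuous_within fdf).
rewrite in_itv/= => /andP[vz zu] E; exists z => //.
move: ur vr; rewrite !ler_norml => /andP[? ?] /andP[? ?]; apply/andP; split; lra.
Qed.

Lemma lipschitz_increment f df K a b :
  (forall x, is_derive x 1 f (df x)) -> (forall x, `|df x| <= K) ->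
  `|f b - f a| <= K * `|b - a|.
Proof.
move=> fdf dfK; wlog ab : a b / a <= b.
  move=> H; have [/H//|/ltW/H] := leP a b.
  by rewrite distrC (distrC a).
rewrite (ger0_norm (_ : 0 <= b - a)) ?subr_ge0//.
have dK x : is_derive x 1 (fun t => K * t) K.
  apply: (is_derive_eq (deriveM1 (is_derive_cst K x 1) (is_derive_id x 1))).
  by rewrite mul0r mulr1 add0r.
have := @norm_increment f (fun t => K * t) df (fun=> K) a b ab.
rewrite -mulrBr; apply => //.
- exact: derive_continuous_within fdf.
- exact: (@derive_continuous_within _ (fun=> K)).
Qed.

Lemma primitive_exists f (c : R) : continuous f ->
  exists2 F : R -> R, F c = 0 & forall x, is_derive x 1 F (f x).
Proof.
move=> cf.
have [I dI] : exists I : R -> R -> R, forall a x, a < x -> is_derive x 1 (I a) (f x).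
  pose mu := @lebesgue_measure R.
  pose I a x := (\int[mu]_(t in `[a, x]) f t); exists I.
  have fint a b : mu.-integrable `[a, b] (EFin \o f).
    apply: continuous_compact_integrable; first exact: segment_compact.
    exact: continuous_subspaceT.
  move=> a x ax.
  have [|||D E] := @continuous_FTC1 _ f (BLeft a) x (x + 1) _ (fint a (x + 1)).
  - by rewrite ltrDl.
  - exact: ax.
  - exact: cf.
  by split; [exact: D|rewrite -derive1E; exact: E].
(* Two such integrals differ by a constant, so their increments can be patched
   together into a primitive on the whole line. *)
have incr a a' u v : a < u -> a' < u -> u <= v -> I a v - I a u = I a' v - I a' u.
  move=> au a'u uv.
  have cI s : s < u -> {within `[u, v], continuous (I s)}.
    move=> su; apply: continuous_in_subspaceT => y.
    rewrite inE/= in_itv/= => /andP[uy _].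
    exact: derive_continuous (dI _ _ (lt_le_trans su uy)).
  have D s (su : s < u) y : u < y < v -> is_derive y 1 (I s) (f y).
    by move=> /andP[uy _]; apply: dI; exact: lt_trans uy.
  apply/eqP; rewrite eq_le; apply/andP; split.
    exact: (ler_increment uv (cI _ au) (cI _ a'u) (D _ au) (D _ a'u)).
  exact: (ler_increment uv (cI _ a'u) (cI _ au) (D _ a'u) (D _ au)).
have incr' a a' u v : a < u -> a' < u -> a < v -> a' < v ->
    I a v - I a u = I a' v - I a' u.
  move=> au a'u av a'v; have [uv|/ltW vu] := leP u v; first exact: incr.
  by rewrite -opprB (incr a a' v u av a'v vu) opprB.
(* The derivative of [I a] is known only strictly to the right of [a], so the base point has to lie
   to the left of both [x] and [c]. *)
pose lo x := Num.min x c - 1.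
have lox x : lo x < x by rewrite /lo ltrBlDr (@le_lt_trans _ _ x) ?ge_min ?lexx// ltrDl.
have loc x : lo x < c.
  by rewrite /lo ltrBlDr (@le_lt_trans _ _ c) ?ge_min ?lexx ?orbT// ltrDl.
exists (fun x => I (lo x) x - I (lo x) c); first by rewrite subrr.
move=> x.
pose a := lo x - 1.
apply: (@derivable_eq_near (fun y => I a y - I a c)); last first.
  have ax : a < x by rewrite /a (lt_trans _ (lox x))// ltrBlDr ltrDl.
  apply: (is_derive_eq (deriveB1 (dI _ _ ax) (is_derive_cst (I a c) x 1))).
  by rewrite subr0.
near=> y.
have ay : a < y by near: y; apply: lt_nbhsr; rewrite /a (lt_trans _ (lox x))// ltrBlDr ltrDl.
apply: incr'=> //.
by rewrite /a (lt_trans _ (loc x))// ltrBlDr ltrDl.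
Unshelve. all: by end_near. Qed.

End Calculus.

(** * Gronwall inequalities *)

Section Gronwall.
Context {R : realType}.
Implicit Types (f g : R -> R) (a b k x : R).

Lemma derive_expRM k a x :
  is_derive x 1 (fun t => expR (k * (t - a))) (expR (k * (x - a)) * k).
Proof.
apply: (@derive_comp1 R expR (fun x => k * (x - a))).
apply: (is_derive_eq (deriveM1 (is_derive_cst k x 1)
  (deriveB1 (is_derive_id x 1) (is_derive_cst a x 1)))).
by rewrite mul0r subr0 mulr1 add0r.
Qed.

(** The product of [V] with [expR (- k * (x - a))] has a nonpositive derivative. *)
Lemma gronwall_within (V dV : R -> R) k a b : a <= b ->
  {within `[a, b], continuous V} ->
  (forall x, a < x < b -> is_derive x 1 V (dV x)) ->
  (forall x, a < x < b -> dV x <= k * V x) ->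
  V b <= V a * expR (k * (b - a)).
Proof.
move=> ab cV VdV dVk.
pose E x : R := expR (- k * (x - a)).
have EE x : is_derive x 1 E (E x * (- k)) by exact: derive_expRM.
have cE : {within `[a, b], continuous E} by exact: derive_continuous_within EE.
have := @ler_increment R (fun x => V x * E x) (fun=> 0)
  (fun x => dV x * E x + V x * (E x * - k)) (fun=> 0) a b ab.
rewrite subrr subr_le0 [V a * E a](_ : _ = V a); last first.
  by rewrite /E subrr mulr0 expR0 mulr1.
move=> H; rewrite -[V b]mulr1 -(expRxMexpNx_1 (k * (b - a))).
rewrite [_ * expR (- _)]mulrC mulrA ler_wpM2r ?expR_ge0// -mulNr; apply: H.
- by move=> x; apply: cvgM; [exact: cV|exact: cE].
- by apply: continuous_subspaceT => x; exact: cvg_cst.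
- by move=> x xab; exact: (deriveM1 (VdV x xab) (EE x)).
- move=> x xab.
  rewrite (_ : dV x * E x + _ = E x * (dV x - k * V x)); last by ring.
  by rewrite mulr_ge0_le0 ?expR_ge0// subr_le0 dVk.
Qed.

(** The square of [D] is differentiable, unlike its absolute value, and satisfies the inequality
    with rate [2 b]; times before [s0] are handled by reflection. *)
Lemma gronwall (D dD : R -> R) b s0 s : 0 <= b ->
  (forall x, is_derive x 1 D (dD x)) -> (forall x, `|dD x| <= b * `|D x|) ->
  `|D s| <= `|D s0| * expR (b * `|s - s0|).
Proof.
wlog s0s : D dD s0 s / s0 <= s.
  move=> H b0 dDD dDb; have [s0s|/ltW ss0] := leP s0 s; first exact: (H D dD).
  have := H (fun x => D (- x)) (fun x => dD (- x) * (- 1)) (- s0) (- s).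
  rewrite lerN2 !opprK addrC distrC; apply => // x.
  by rewrite mulrN1 normrN.
move=> b0 dDD dDb.
have := @gronwall_within (fun x => D x * D x) (fun x => dD x * D x + D x * dD x)
  (b + b) s0 s s0s.
have -> : `|s - s0| = s - s0 by rewrite ger0_norm// subr_ge0.
move=> H; rewrite -ler_sqr ?nnegrE ?mulr_ge0 ?expR_ge0//.
rewrite exprMn !real_normK ?num_real// !expr2 -expRD -mulrDl; apply: H.
- exact: (derive_continuous_within (fun x => deriveM1 (dDD x) (dDD x))).
- by move=> x _; exact: (deriveM1 (dDD x) (dDD x)).
- move=> x _; rewrite [dD x * _]mulrC mulrDl.
  have /(le_trans (ler_norm _)) : `|D x * dD x| <= b * (D x * D x).
    rewrite normrM (_ : D x * D x = `|D x| * `|D x|); last first.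
      by rewrite -normrM ger0_norm// -expr2 sqr_ge0.
    by rewrite mulrCA ler_wpM2l.
  by move=> H; rewrite lerD.
Qed.

(** The factor [expR _ - 1] is of order [b]: over a bounded time the difference of two solutions
    changes only by a small fraction of itself. *)
Lemma gronwall_increment (D dD : R -> R) b s0 s : 0 <= b ->
  (forall x, is_derive x 1 D (dD x)) -> (forall x, `|dD x| <= b * `|D x|) ->
  `|D s - D s0| <= `|D s0| * (expR (b * `|s - s0|) - 1).
Proof.
wlog s0s : D dD s0 s / s0 <= s.
  move=> H b0 dDD dDb; have [s0s|/ltW ss0] := leP s0 s; first exact: (H D dD).
  have := H (fun x => D (- x)) (fun x => dD (- x) * (- 1)) (- s0) (- s).
  rewrite lerN2 !opprK (addrC (- s)) (distrC s s0); apply => // x.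
  by rewrite mulrN1 normrN.
move=> b0 dDD dDb.
pose g x := `|D s0| * expR (b * (x - s0)).
have dg x : is_derive x 1 g (`|D s0| * (expR (b * (x - s0)) * b)).
  apply: (is_derive_eq (deriveM1 (is_derive_cst `|D s0| x 1) (derive_expRM b s0 x))).
  by rewrite mul0r add0r.
have := norm_increment s0s (derive_continuous_within dDD)
  (derive_continuous_within dg) (fun x _ => dDD x) (fun x _ => dg x).
have -> : `|s - s0| = s - s0 by rewrite ger0_norm// subr_ge0.
rewrite /g subrr mulr0 expR0 -mulrBr; apply => x /andP[s0x _].
apply: le_trans (dDb x) _; rewrite mulrA [leRHS]mulrC ler_wpM2l//.
have := gronwall s0 x b0 dDD dDb.
by rewrite [`|x - s0|]ger0_norm// subr_ge0 ltW.
Qed.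

End Gronwall.

(** * Global existence by Picard iteration *)

Section Picard.
Context {R : realType}.
Implicit Types (f g X : R -> R) (a b k s x : R).

Lemma exp2_gt0 n : 0 < 2^-1 ^+ n :> R.
Proof. by rewrite exprn_gt0. Qed.

Lemma le_geometric a b (C : R) :
  (forall n, a <= b + C * 2^-1 ^+ n) -> a <= b.
Proof.
move=> H; rewrite leNgt; apply/negP => ba.
have [C0|C0] := leP C 0.
  have := H 0; rewrite expr0 mulr1; lra.
have := archi_boundP (divr_ge0 (ltW C0) (ltW (_ : 0 < a - b))).
rewrite subr_gt0 ba => /(_ isT); set n := Num.bound _ => Cn.
have := H n; rewrite exprVn leNgt => /negP; apply.
rewrite -ltrBrDl ltr_pdivrMr ?exprn_gt0// mulrC -ltr_pdivrMr ?subr_gt0//.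
by rewrite (lt_trans Cn)// -natrX ltr_nat ltn_expl.
Qed.

(** The intervals of radius [2 C / 2^n] around [u n] are nested; the limit is the supremum of their
    left ends. *)
Lemma geometric_limit (u : nat -> R) (C : R) :
  (forall n, `|u n.+1 - u n| <= C * 2^-1 ^+ n) ->
  exists l, forall n, `|u n - l| <= 2 * C * 2^-1 ^+ n.
Proof.
move=> uC.
pose v n := u n - 2 * C * 2^-1 ^+ n; pose w n := u n + 2 * C * 2^-1 ^+ n.
have C0 : 0 <= C by have := uC 0; rewrite expr0 mulr1; apply: le_trans.
have vS n : v n <= v n.+1.
  rewrite /v exprS; have := uC n; rewrite ler_norml => /andP[+ _].
  by set q := 2^-1 ^+ n; lra.
have wS n : w n.+1 <= w n.
  rewrite /w exprS; have := uC n; rewrite ler_norml => /andP[_].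
  by set q := 2^-1 ^+ n; lra.
have vw n : v n <= w n.
  by rewrite /v /w; have := mulr_ge0 C0 (ltW (exp2_gt0 n)); lra.
have vm m n : v m <= w n.
  have vmono : {homo v : i j / (i <= j)%N >-> i <= j}.
    by apply: homo_leq => // i j k; exact: le_trans.
  have wmono : {homo w : i j / (i <= j)%N >-> j <= i}.
    by apply: homo_leq => // i j k /[swap]; exact: le_trans.
  rewrite (le_trans (vmono _ _ (leq_maxl m n)))// (le_trans (vw _))//.
  exact: wmono (leq_maxr m n).
exists (sup (range v)) => n.
have vl : v n <= sup (range v).
  apply: ub_le_sup; last by exists n.
  by exists (w 0) => _ [m _ <-].
have wl : sup (range v) <= w n.
  by apply: ge_sup; [exists (v 0); exists 0|move=> _ [m _ <-]].
by rewrite ler_norml; move: vl wl; rewrite /v /w => vl wl; apply/andP; split; lra.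
Qed.

Variables (G : R -> R -> R) (b : R).
Hypothesis b_le : 0 <= b <= 2^-1.
Hypothesis G_le : forall x s, `|G x s| <= b.
Hypothesis G_lip : forall x y s, `|G x s - G y s| <= b * `|x - y|.
Hypothesis G_cont : forall x, continuous (G x).

Lemma field_comp_continuous X : continuous X -> continuous (fun s => G (X s) s).
Proof.
move=> cX s; apply/cvgrPdist_lt => e e0.
have e2 : 0 < e / 2 by rewrite divr_gt0.
have b0 : 0 <= b by case/andP: b_le.
near=> t.
have H1 : `|G (X s) s - G (X s) t| < e / 2.
  by near: t; apply: (continuous_dist_lt (@G_cont (X s) s) e2).
have H2 : `|X s - X t| < e / 2 by near: t; apply: (continuous_dist_lt (cX s) e2).
have -> : G (X s) s - G (X t) t =
  (G (X s) s - G (X s) t) + (G (X s) t - G (X t) t) by ring.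
apply: le_lt_trans (ler_normD _ _) _.
rewrite (splitr e) ltr_leD// (le_trans (G_lip _ _ _))//.
rewrite (le_trans _ (ltW H2))// ler_piMl//.
by case/andP: b_le => _ /le_trans; apply; lra.
Unshelve. all: by end_near. Qed.

(** The weight [expR |x - s0|] bounds its own integral from [s0]. In the norm with this weight a
    Lipschitz constant at most 1/2 makes the Picard operator contract on the whole line at once. *)
Lemma weighted_increment (F dF : R -> R) k s0 s : 0 <= k -> F s0 = 0 ->
  (forall x, is_derive x 1 F (dF x)) ->
  (forall x, `|dF x| <= k * expR `|x - s0|) -> `|F s| <= k * expR `|s - s0|.
Proof.
wlog s0s : F dF s0 s / s0 <= s.
  move=> H k0 F0 dFF dFk; have [s0s|/ltW ss0] := leP s0 s; first exact: (H F dF).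
  have := H (fun x => F (- x)) (fun x => dF (- x) * (- 1)) (- s0) (- s).
  rewrite lerN2 !opprK (addrC (- s)) (distrC s s0); apply => // x.
  by rewrite mulrN1 normrN (le_trans (dFk _))// -normrN opprD !opprK.
move=> k0 F0 dFF dFk.
pose g x := k * expR (1 * (x - s0)).
have dg x : is_derive x 1 g (k * (expR (1 * (x - s0)) * 1)).
  apply: (is_derive_eq (deriveM1 (is_derive_cst k x 1) (derive_expRM 1 s0 x))).
  by rewrite mul0r add0r.
have := norm_increment s0s (derive_continuous_within dFF)
  (derive_continuous_within dg) (fun x _ => dFF x) (fun x _ => dg x).
have -> : `|s - s0| = s - s0 by rewrite ger0_norm// subr_ge0.
rewrite /g subrr mulr0 expR0 F0 subr0 mul1r mulr1 => H.
apply: le_trans (H _) _; last by lra.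
move=> x /andP[s0x _]; rewrite mul1r mulr1 (le_trans (dFk x))//.
by rewrite [`|x - s0|]ger0_norm// subr_ge0 ltW.
Qed.

Theorem picard s0 x0 :
  exists2 X : R -> R, X s0 = x0 & forall s, is_derive s 1 X (G (X s) s).
Proof.
have b0 : 0 <= b by case/andP: b_le.
have b1 : b <= 2^-1 by case/andP: b_le.
(* The Picard operator [T] is chosen from this relation, which constrains it at continuous arguments
   only. *)
pose P (X Y : R -> R) : Prop := continuous X ->
  Y s0 = x0 /\ forall s, is_derive s 1 Y (G (X s) s).
have /choice[T TP] : forall X, exists Y, P X Y.
  move=> X.
  have [cX|ncX] := pselect (continuous X); last by exists X.
  have [F F0 dF] := primitive_exists s0 (field_comp_continuous cX).
  exists (fun s => x0 + F s) => _; split; first by rewrite F0 addr0.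
  move=> s; apply: (is_derive_eq (deriveD1 (is_derive_cst x0 s 1) (dF s))).
  by rewrite add0r.
pose X n := iter n T (cst x0).
have cX n : continuous (X n).
  elim: n => [|n IH] s; first exact: cvg_cst.
  exact: derive_continuous ((TP _ IH).2 s).
have X0 n : X n s0 = x0 by case: n => [//|n]; exact: (TP _ (cX n)).1.
have dX n s : is_derive s 1 (X n.+1) (G (X n s) s) by exact: (TP _ (cX n)).2.
have XS n s : `|X n.+1 s - X n s| <= expR `|s - s0| * 2^-1 ^+ n.
  elim: n s => [|n IH] s; rewrite mulrC.
    apply: (@weighted_increment (fun s => X 1%N s - X 0 s) (fun s => G (X 0 s) s - 0)).
    - by rewrite expr0.
    - by rewrite !X0 subrr.
    - move=> t; rewrite subr0 mul1r (le_trans (G_le _ _))// (le_trans b1)//.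
      by rewrite (@le_trans _ _ 1) ?invf_le1 ?ler1n// -expR0 ler_expR.
  apply: (@weighted_increment (fun s => X n.+2 s - X n.+1 s)
    (fun s => G (X n.+1 s) s - G (X n s) s)).
  - exact: ltW (exp2_gt0 _).
  - by rewrite !X0 subrr.
  - move=> t; rewrite (le_trans (G_lip _ _ _))// exprS -mulrA [2^-1 ^+ n * _]mulrC.
    by rewrite ler_pM.
have /choice[Xl XlP] : forall s, exists l : R, forall n,
    `|X n s - l| <= 2 * expR `|s - s0| * 2^-1 ^+ n.
  by move=> s; exact: geometric_limit.
(* The iterates share the Lipschitz constant 1, which passes to the limit. *)
have cXl : continuous Xl.
  have lip s t : `|Xl s - Xl t| <= `|s - t|.
    apply: (@le_geometric _ _ (2 * expR `|s - s0| * 2^-1 + 2 * expR `|t - s0| * 2^-1)).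
    move=> n; rewrite mulrDl -!mulrA -exprS !mulrA.
    have H1 := XlP s n.+1; have H2 := XlP t n.+1.
    have H3 : `|X n.+1 s - X n.+1 t| <= `|s - t|.
      apply: le_trans (lipschitz_increment t s (dX n) (fun x => G_le _ x)) _.
      by rewrite ler_piMl// (le_trans b1)// invf_le1 ?ler1n.
    have -> : Xl s - Xl t = (X n.+1 s - X n.+1 t) + (X n.+1 t - Xl t) -
      (X n.+1 s - Xl s) by ring.
    rewrite (le_trans (ler_normB _ _))//.
    have := ler_normD (X n.+1 s - X n.+1 t) (X n.+1 t - Xl t); lra.
  move=> s; apply/cvgrPdist_lt => e e0; near=> t.
  rewrite (le_lt_trans (lip _ _))//.
have [Y0 dY] := TP _ cXl; set Y := T Xl in Y0 dY.
(* [Y] is the Picard image of the limit and differentiable by construction; a fixed point is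
   therefore a solution. *)
suff XY : Xl = Y by exists Y => // s; move: (dY s); rewrite XY.
apply/funext => s; apply/eqP; rewrite -subr_eq0 -normr_le0.
apply: (@le_geometric _ _ (2 * expR `|s - s0| + 2 * expR `|s - s0|)) => n.
rewrite add0r (_ : Xl s - Y s = (X n.+1 s - Y s) - (X n.+1 s - Xl s)); last by ring.
rewrite (le_trans (ler_normB _ _))// mulrDl lerD//; last first.
  rewrite (le_trans (XlP _ _))// ler_wpM2l ?mulr_ge0 ?expR_ge0// exprS.
  by rewrite ler_piMl ?exprn_ge0 ?invf_le1 ?ler1n.
rewrite -mulrA [expR _ * _]mulrC mulrA.
apply: (@weighted_increment (fun s => X n.+1 s - Y s)
  (fun s => G (X n s) s - G (Xl s) s)).
- by rewrite mulr_ge0// ltW// exp2_gt0.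
- by rewrite X0 Y0 subrr.
- move=> t; rewrite (le_trans (G_lip _ _ _))// -mulrA [2^-1 ^+ n * _]mulrC mulrA.
  rewrite -[leRHS]mul1r ler_pM//; first by rewrite (le_trans b1)// invf_le1 ?ler1n.
Unshelve. all: by end_near. Qed.

End Picard.

(** * Calculus of uniform strict differentiability *)

Section StrictDerivative.
Context {R : realType}.
Implicit Types (p : R) (h k : R -> R -> R -> R) (e x y s : R).

(* Strict differentiability in x at the point e = 0, x = p, uniformly in s. *)
Definition strict_diff p h : Prop :=
  exists (n : R -> R) (K : R),
    [/\ 0 < K, forall s, `|h 0 p s| <= K, forall s, `|n s| <= K &
      forall c : R, 0 < c -> exists2 d : R, 0 < d & forall e x y s,
        `|e| < d -> `|x - p| < d -> `|y - p| < d ->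
        `|h e x s - h 0 p s| <= c /\
        `|h e x s - h e y s - n s * (x - y)| <= c * `|x - y|].

Lemma strict_diff_cst p (k : R -> R) (K : R) : (forall s, `|k s| <= K) ->
  strict_diff p (fun _ _ s => k s).
Proof.
move=> kK; have K0 : 0 <= K by apply: le_trans (kK 0).
exists (fun=> 0), (K + 1); split; first lra.
- by move=> s; rewrite (le_trans (kK s))// lerDl.
- by move=> s; rewrite normr0; lra.
move=> c c0; exists 1 => // e x y s _ _ _.
by rewrite !subrr mul0r subrr normr0 ltW// mulr_ge0// ltW.
Qed.

Lemma strict_diff_param p : strict_diff p (fun e _ _ => e).
Proof.
exists (fun=> 0), 1; split => //.
- by move=> s; rewrite normr0.
- by move=> s; rewrite normr0.
move=> c c0; exists c => // e x y s ec _ _.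
by rewrite subr0 subrr mul0r subrr normr0 (ltW ec) mulr_ge0// ltW.
Qed.

Lemma strict_diff_id p : strict_diff p (fun _ x _ => x).
Proof.
exists (fun=> 1), (`|p| + 1); split => //.
- by move=> s; rewrite lerDl.
- by move=> s; rewrite normr1 lerDr.
move=> c c0; exists c => // e x y s _ xc _.
by rewrite mul1r subrr normr0 (ltW xc) mulr_ge0// ltW.
Qed.

Lemma strict_diffD p h k : strict_diff p h -> strict_diff p k ->
  strict_diff p (fun e x s => h e x s + k e x s).
Proof.
move=> [n [K [K0 hK nK H]]] [n' [K' [K'0 kK n'K H']]].
exists (fun s => n s + n' s), (K + K'); split.
- exact: addr_gt0.
- by move=> s; rewrite (le_trans (ler_normD _ _))// lerD.
- by move=> s; rewrite (le_trans (ler_normD _ _))// lerD.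
move=> c c0; have c2 : 0 < c / 2 by rewrite divr_gt0.
have [d d0 Hd] := H _ c2; have [d' d'0 Hd'] := H' _ c2.
exists (Num.min d d'); first by rewrite lt_min d0.
move=> e x y s; rewrite !lt_min => /andP[ed ed'] /andP[xd xd'] /andP[yd yd'].
have [A B] := Hd e x y s ed xd yd; have [A' B'] := Hd' e x y s ed' xd' yd'.
split.
  rewrite opprD addrACA (le_trans (ler_normD _ _))//; lra.
rewrite (_ : _ - _ - _ = (h e x s - h e y s - n s * (x - y)) +
  (k e x s - k e y s - n' s * (x - y))); last by ring.
rewrite (le_trans (ler_normD _ _))//; lra.
Qed.

Lemma strict_diffM p h k : strict_diff p h -> strict_diff p k ->
  strict_diff p (fun e x s => h e x s * k e x s).
Proof.
move=> [n [K [K0 hK nK H]]] [n' [K' [K'0 kK n'K H']]].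
pose B := K + K' + 1.
have B0 : 0 < B by rewrite /B; lra.
have KB : K <= B by rewrite /B; lra.
have K'B : K' <= B by rewrite /B; lra.
have mulB (u v a b : R) : `|u| <= a -> `|v| <= b -> `|u * v| <= a * b.
  by move=> ua vb; rewrite normrM ler_pM.
exists (fun s => n s * k 0 p s + h 0 p s * n' s), (B * B + B * B); split.
- by rewrite addr_gt0 ?mulr_gt0.
- move=> s; apply: (@le_trans _ _ (B * B)); last by rewrite lerDl mulr_ge0 ?ltW.
  by apply: mulB; [exact: le_trans (hK s) _|exact: le_trans (kK s) _].
- move=> s; rewrite (le_trans (ler_normD _ _))// lerD//; apply: mulB.
  + exact: le_trans (nK s) _.
  + exact: le_trans (kK s) _.
  + exact: le_trans (hK s) _.
  + exact: le_trans (n'K s) _.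
move=> c c0.
(* In the second estimate four error terms, each at most [q * B * |x - y|], must fit into
   [c * |x - y|]. *)
pose q : R := Num.min 1 (c / (6 * B)).
have q0 : 0 < q by rewrite lt_min ltr01 divr_gt0// mulr_gt0.
have q1 : q <= 1 by rewrite ge_min lexx.
have qB : 6 * (q * B) <= c.
  have : q <= c / (6 * B) by rewrite ge_min lexx orbT.
  by rewrite ler_pdivlMr ?mulr_gt0// mulrCA.
have [d d0 Hd] := H _ q0; have [d' d'0 Hd'] := H' _ q0.
exists (Num.min d d'); first by rewrite lt_min d0.
move=> e x y s; rewrite !lt_min => /andP[ed ed'] /andP[xd xd'] /andP[yd yd'].
have [A1 A2] := Hd e x y s ed xd yd; have [C1 C2] := Hd' e x y s ed' xd' yd'.
have [_ _] := Hd e x y s ed xd yd; have [C3 _] := Hd' e y x s ed' yd' xd'.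
have kyB : `|k e y s| <= B.
  rewrite (_ : k e y s = (k e y s - k 0 p s) + k 0 p s); last by ring.
  by rewrite (le_trans (ler_normD _ _))// /B; move: (kK s) C3 q1 K0 K'0; clear; lra.
have hxB : `|h e x s| <= B.
  rewrite (_ : h e x s = (h e x s - h 0 p s) + h 0 p s); last by ring.
  by rewrite (le_trans (ler_normD _ _))// /B; move: (hK s) A1 q1 K0 K'0; clear; lra.
have kxB : `|k e x s| <= B.
  rewrite (_ : k e x s = (k e x s - k 0 p s) + k 0 p s); last by ring.
  by rewrite (le_trans (ler_normD _ _))// /B; move: (kK s) C1 q1 K0 K'0; clear; lra.
have qB0 : 0 <= q * B by rewrite mulr_ge0// ltW.
split.
  rewrite (_ : _ - _ = (h e x s - h 0 p s) * k e x s +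
    h 0 p s * (k e x s - k 0 p s)); last by ring.
  rewrite (le_trans (ler_normD _ _))//.
  have := mulB _ _ _ _ A1 kxB; have := mulB _ _ _ _ (le_trans (hK s) KB) C1.
  by rewrite (mulrC B q); move: qB qB0; clear; lra.
have D0 : 0 <= `|x - y| by [].
(* Product rule with remainder: the remainders of the two factors, and two terms from moving a
   factor to its value at the base point. *)
rewrite (_ : _ - _ - _ =
  (h e x s - h e y s - n s * (x - y)) * k e y s
  + h e x s * (k e x s - k e y s - n' s * (x - y))
  + n s * (k e y s - k 0 p s) * (x - y)
  + (h e x s - h 0 p s) * n' s * (x - y)); last by ring.
have t1 := mulB _ _ _ _ A2 kyB.
have t2 := mulB _ _ _ _ hxB C2.
have t3 : `|n s * (k e y s - k 0 p s) * (x - y)| <= B * q * `|x - y|.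
  by apply: (mulB _ _ _ _ _ (lexx _)); apply: mulB C3; exact: le_trans (nK s) _.
have t4 : `|(h e x s - h 0 p s) * n' s * (x - y)| <= q * B * `|x - y|.
  by apply: (mulB _ _ _ _ _ (lexx _)); apply: mulB A1 _; exact: le_trans (n'K s) _.
have t5 : 6 * (q * B) * `|x - y| <= c * `|x - y| by rewrite ler_wpM2r.
have t6 : 0 <= q * B * `|x - y| by rewrite mulr_ge0.
rewrite (le_trans (ler_normD _ _))// (le_trans (lerD (ler_normD _ _) t4))//.
rewrite -addrA (le_trans (lerD (ler_normD _ _) (lexx _)))//.
rewrite (le_trans (lerD (lerD t1 t2) (lerD t3 (lexx _))))//.
by move: t5 t6; set Z := `|x - y|; clear; lra.
Qed.

Lemma strict_diffN p h : strict_diff p h -> strict_diff p (fun e x s => - h e x s).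
Proof.
move=> hp; have -> : (fun e x s => - h e x s) = (fun e x s => (fun _ _ _ => -1) e x s * h e x s).
  by apply/funext => e; apply/funext => x; apply/funext => s; rewrite mulN1r.
apply: strict_diffM hp; apply: (@strict_diff_cst p (fun=> -1) 1) => s.
by rewrite normrN1.
Qed.

Lemma strict_diff_comp p h (g dg : R -> R) (L : R) : strict_diff p h -> 0 < L ->
  (forall x, is_derive x 1 g (dg x)) -> (forall x, `|dg x| <= L) ->
  (forall x y, `|dg x - dg y| <= L * `|x - y|) -> (forall x, `|g x| <= L) ->
  strict_diff p (fun e x s => g (h e x s)).
Proof.
move=> [n [K [K0 hK nK H]]] L0 gdg dgL dgLip gL.
exists (fun s => dg (h 0 p s) * n s), (L + L * K); split.
- by rewrite addr_gt0// mulr_gt0.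
- by move=> s; rewrite (le_trans (gL _))// lerDl mulr_ge0// ltW.
- move=> s; rewrite normrM (@le_trans _ _ (L * K))//; first by rewrite ler_pM.
  by rewrite lerDr ltW.
move=> c c0.
pose q : R := Num.min 1 (c / (L * (K + 2))).
have K2 : 0 < L * (K + 2) by rewrite mulr_gt0//; lra.
have q0 : 0 < q by rewrite lt_min ltr01 divr_gt0.
have q1 : q <= 1 by rewrite ge_min lexx.
have qc : q * (L * (K + 2)) <= c.
  by rewrite -ler_pdivlMr// ge_min lexx orbT.
have LqK : L * q * K >= 0 by rewrite !mulr_ge0// ltW.
have Lq : 0 <= L * q by rewrite mulr_ge0// ltW.
have [d d0 Hd] := H _ q0; exists d => // e x y s ed xd yd.
have [A1 A2] := Hd e x y s ed xd yd; have [B1 _] := Hd e y x s ed yd xd.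
set u := h e x s in A1 A2 *; set v := h e y s in A2 B1 *.
set w := h 0 p s in A1 B1 *.
split.
  rewrite (le_trans (lipschitz_increment w u gdg dgL))//.
  rewrite (@le_trans _ _ (L * q))//; last by lra.
  by rewrite ler_wpM2l// ltW.
(* The intermediate point is [q]-close to the base value [w], so [dg z] may be replaced by [dg w] at
   the cost [L * q]. *)
have [z zw ->] := mean_value gdg A1 B1.
rewrite (_ : _ - _ = (dg z - dg w) * (u - v) + dg w * (u - v - n s * (x - y))); last by ring.
rewrite (le_trans (ler_normD _ _))// !normrM.
have uvK : `|u - v| <= (K + 1) * `|x - y|.
  rewrite (_ : u - v = (u - v - n s * (x - y)) + n s * (x - y)); last by ring.
  rewrite (le_trans (ler_normD _ _))// normrM.
  have : `|n s| * `|x - y| <= K * `|x - y| by rewrite ler_wpM2r.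
  have : q * `|x - y| <= `|x - y| by rewrite ler_piMl.
  by move: A2; set Z := `|x - y|; lra.
have t1 : `|dg z - dg w| * `|u - v| <= L * q * ((K + 1) * `|x - y|).
  by rewrite ler_pM// (le_trans (dgLip _ _))// ler_wpM2l// ltW.
have t2 : `|dg w| * `|u - v - n s * (x - y)| <= L * (q * `|x - y|).
  by rewrite ler_pM.
have t3 : q * (L * (K + 2)) * `|x - y| <= c * `|x - y| by rewrite ler_wpM2r.
by move: t1 t2 t3; set Z := `|x - y|; set U := `|u - v - _|; set V := `|u - v|; lra.
Qed.

Lemma strict_diffV p h (k : R) : strict_diff p h -> 0 < k ->
  (forall s, k <= `|h 0 p s|) -> strict_diff p (fun e x s => (h e x s)^-1).
Proof.
move=> [n [K [K0 hK nK H]]] k0 kh.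
have h0 s : h 0 p s != 0 by rewrite -normr_gt0 (lt_le_trans k0).
have hV s : `|(h 0 p s)^-1| <= k^-1.
  by rewrite normfV lef_pV2// posrE normr_gt0.
exists (fun s => - n s * ((h 0 p s)^-1 * (h 0 p s)^-1)), (k^-1 + K * (k^-1 * k^-1)); split.
- by rewrite addr_gt0 ?mulr_gt0 ?invr_gt0.
- move=> s; rewrite (le_trans (hV s))// lerDl !mulr_ge0 ?invr_ge0 ?ltW//.
- move=> s; rewrite (@le_trans _ _ (K * (k^-1 * k^-1)))//.
    by rewrite !normrM normrN ler_pM// ler_pM.
  by rewrite lerDr invr_ge0 ltW.
move=> c c0.
pose A := k^-1 * k^-1.
have A0 : 0 < A by rewrite mulr_gt0 ?invr_gt0.
pose Q := 2 * A + 4 * A + 6 * K * (A * k^-1).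
have Q0 : 0 < Q by rewrite /Q !addr_gt0 ?mulr_gt0 ?invr_gt0.
(* The bound [k / 2] keeps the perturbed denominators at distance at least [k / 2] from 0. *)
pose q : R := Num.min (k / 2) (c / Q).
have q0 : 0 < q by rewrite lt_min !divr_gt0.
have qk : q <= k / 2 by rewrite ge_min lexx.
have qc : q * Q <= c by rewrite -ler_pdivlMr// ge_min lexx orbT.
have [d d0 Hd] := H _ q0; exists d => // e x y s ed xd yd.
have [A1 A2] := Hd e x y s ed xd yd; have [B1 _] := Hd e y x s ed yd xd.
set u := h e x s in A1 A2 *; set v := h e y s in A2 B1 *.
set w := h 0 p s in A1 B1 *.
have k2 z : `|z - w| <= q -> k / 2 <= `|z|.
  move=> zw; have := ler_normB z (z - w).
  rewrite (_ : z - (z - w) = w); last by ring.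
  by have := kh s; rewrite -/w; lra.
have inv2 z : `|z - w| <= q -> z != 0 /\ `|z^-1| <= 2 * k^-1.
  move=> /k2 kz; have z0 : 0 < `|z| by rewrite (lt_le_trans _ kz)// divr_gt0.
  split; first by rewrite -normr_gt0.
  by rewrite normfV -[2 * _]invrK lef_pV2 ?posrE ?invr_gt0 ?mulr_gt0 ?invr_gt0//
    invfM invrK mulrC.
have [u0 uV] := inv2 _ A1; have [v0 vV] := inv2 _ B1; have w0 := h0 s.
rewrite -/w in w0.
have wV := hV s; rewrite -/w in wV.
have kV0 : 0 <= k^-1 by rewrite invr_ge0 ltW.
have diffV (a b : R) : a != 0 -> b != 0 -> a^-1 - b^-1 = - (a - b) * (a^-1 * b^-1).
  by move=> a0 b0; field; rewrite a0 b0.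
have uw : `|u^-1 - w^-1| <= q * (2 * A).
  rewrite diffV// normrM normrN ler_pM// normrM.
  by rewrite (_ : 2 * A = 2 * k^-1 * k^-1) ?ler_pM// /A; ring.
have vw : `|v^-1 - w^-1| <= q * (2 * A).
  rewrite diffV// normrM normrN ler_pM// normrM.
  by rewrite (_ : 2 * A = 2 * k^-1 * k^-1) ?ler_pM// /A; ring.
have qA0 : 0 <= q * A by rewrite mulr_ge0// ltW.
have qAK : 0 <= q * (K * (A * k^-1)) by rewrite !mulr_ge0// ltW.
split; first by rewrite (le_trans uw)//; move: qc qA0 qAK; rewrite /Q; clear; lra.
rewrite diffV// (_ : _ - _ = - (u - v - n s * (x - y)) * (u^-1 * v^-1)
  - n s * (x - y) * ((u^-1 - w^-1) * v^-1 + w^-1 * (v^-1 - w^-1))); last by ring.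
rewrite (le_trans (ler_normB _ _))//.
have t1 : `|- (u - v - n s * (x - y)) * (u^-1 * v^-1)| <= q * `|x - y| * (2 * k^-1 * (2 * k^-1)).
  by rewrite normrM normrN ler_pM// normrM ler_pM.
have t2 : `|(u^-1 - w^-1) * v^-1 + w^-1 * (v^-1 - w^-1)| <= q * (2 * A) * (2 * k^-1) + k^-1 * (q * (2 * A)).
  by rewrite (le_trans (ler_normD _ _))// !normrM lerD// ler_pM.
have t3 : `|n s * (x - y) * ((u^-1 - w^-1) * v^-1 + w^-1 * (v^-1 - w^-1))| <=
    K * `|x - y| * (q * (2 * A) * (2 * k^-1) + k^-1 * (q * (2 * A))).
  by rewrite normrM ler_pM// normrM ler_pM.
rewrite (le_trans (lerD t1 t3))//.
have := ler_wpM2r (normr_ge0 (x - y)) qc.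
have : 0 <= q * A * `|x - y| by rewrite mulr_ge0.
by rewrite /Q /A; set Z := `|x - y|; set t := k^-1; clear; lra.
Qed.
End StrictDerivative.

(** * The clamped scalar flow and its elementary bounds *)

Section Averaging.
Context {R : realType}.
Implicit Types (p d e x y s : R) (F : R -> R -> R -> R) (X Y : R -> R).

Lemma expR_sub1_le x : 0 <= x <= 2^-1 -> expR x - 1 <= 2 * x.
Proof.
move=> /andP[x0 x1]; have := expR_ge1Dx (- x) => H.
have e0 := expR_gt0 x.
have : (1 - x) * expR x <= 1.
  by rewrite -[leRHS](expRxMexpNx_1 x) mulrC ler_wpM2l// ltW.
have : 0 <= (2^-1 - x) * (expR x - 1).
  by rewrite mulr_ge0 ?subr_ge0// -expR0 ler_expR.
nra.
Qed.

Definition clamp p d x := Num.max (p - d) (Num.min (p + d) x).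

Lemma clamp_id p d x : `|x - p| <= d -> clamp p d x = x.
Proof.
rewrite ler_norml => /andP[h1 h2]; rewrite /clamp.
rewrite min_r; last lra.
by rewrite max_r//; lra.
Qed.

Lemma clampP p d x : 0 <= d ->
  [\/ clamp p d x = p + d /\ p + d <= x, clamp p d x = p - d /\ x <= p - d |
    clamp p d x = x /\ p - d <= x <= p + d].
Proof.
move=> d0; have [xpd|pdx] := leP x (p - d).
  apply: Or32; split => //; rewrite /clamp min_r; last lra.
  by rewrite max_l.
have [pdx'|xpd] := leP (p + d) x.
  by apply: Or31; split => //; rewrite /clamp min_l// max_r//; lra.
apply: Or33; split; last by lra.
by apply: clamp_id; rewrite ler_norml; lra.
Qed.

Lemma clamp_le p d x : 0 <= d -> `|clamp p d x - p| <= d.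
Proof.
by move=> d0; rewrite ler_norml; case: (clampP p x d0) => -[-> ?]; lra.
Qed.

Lemma clamp_lip p d x y : 0 <= d -> `|clamp p d x - clamp p d y| <= `|x - y|.
Proof.
move=> d0; wlog xy : x y / y <= x.
  move=> H; have [xy|/ltW xy] := leP y x; first exact: H.
  by rewrite distrC (distrC x); apply: H.
rewrite (ger0_norm (_ : 0 <= x - y)) ?subr_ge0// ler_norml.
by case: (clampP p x d0) => -[-> ?]; case: (clampP p y d0) => -[-> ?]; lra.
Qed.

(* Clamping x to [p - d, p + d] makes the flow globally defined. *)
Definition flow F p d e X := forall s, is_derive s 1 X (e * F e (clamp p d (X s)) s).

Lemma flow_continuous F p d e X : flow F p d e X -> continuous X.
Proof. by move=> XF s; exact: derive_continuous (XF s). Qed.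

Lemma flow_shift F p d e X t :
  (forall e x s, F e x (s + t) = F e x s) -> flow F p d e X ->
  flow F p d e (fun s => X (s + t)).
Proof.
move=> Ft XF s.
have ds : is_derive s 1 (fun s => s + t) 1.
  apply: (is_derive_eq (deriveD1 (is_derive_id s 1) (is_derive_cst t s 1))).
  by rewrite addr0.
apply: (is_derive_eq (@derive_comp1 R X (fun s => s + t) s _ _ (XF (s + t)) ds)).
by rewrite mulr1 Ft.
Qed.

Section Bounds.
Variables (F : R -> R -> R -> R) (p d e B : R).
Hypotheses (d_gt0 : 0 < d) (B_ge0 : 0 <= B) (eB : 16 * (`|e| * B) <= d)
  (eB1 : 16 * (`|e| * B) <= 1).
Hypothesis F_le : forall x s, `|x - p| <= d -> `|F e x s| <= B.
Hypothesis F_lip : forall x y s, `|x - p| <= d -> `|y - p| <= d ->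
  `|F e x s - F e y s| <= B * `|x - y|.
Hypothesis F_cont : forall x, `|x - p| <= d -> continuous (F e x).

Let b : R := `|e| * B.
Let b16 : 16 * b <= 1. Proof. exact: eB1. Qed.
Let bd : 16 * b <= d. Proof. exact: eB. Qed.
Let b_ge0 : 0 <= b. Proof. by rewrite mulr_ge0. Qed.
Let G x s : R := e * F e (clamp p d x) s.
Let G_le x s : `|G x s| <= b.
Proof. by rewrite normrM ler_wpM2l// F_le// clamp_le// ltW. Qed.
Let G_lip x y s : `|G x s - G y s| <= b * `|x - y|.
Proof.
rewrite -mulrBr normrM -mulrA ler_wpM2l//.
rewrite (le_trans (F_lip _ _ _)) ?clamp_le ?(ltW d_gt0)//.
by rewrite ler_wpM2l// clamp_lip// ltW.
Qed.

Lemma flow_exists s0 x0 : exists2 X, X s0 = x0 & flow F p d e X.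
Proof.
apply: (@picard R G b) => //.
- by apply/andP; split=> //; move: b16; lra.
- move=> x s; rewrite /G; apply: cvgM; first exact: cvg_cst.
  by apply: F_cont; rewrite clamp_le// ltW.
Qed.

Lemma flow_gronwall X Y s0 s : flow F p d e X -> flow F p d e Y ->
  `|X s - Y s| <= `|X s0 - Y s0| * expR (b * `|s - s0|).
Proof.
move=> XF YF; apply: (@gronwall R (fun s => X s - Y s) (fun s => G (X s) s - G (Y s) s)) => //.
by move=> t; exact: (deriveB1 (XF t) (YF t)).
Qed.

Lemma flow_unique X Y s0 : flow F p d e X -> flow F p d e Y ->
  X s0 = Y s0 -> X = Y.
Proof.
move=> XF YF XY; apply/funext => s; apply/eqP.
rewrite -subr_eq0 -normr_le0 (le_trans (flow_gronwall s0 s XF YF))//.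
by rewrite XY subrr normr0 mul0r.
Qed.

(** The time 8 exceeds the period [2 pi]. A flow that starts within [d / 2] of [p] is thus not
    clamped during one period. *)
Lemma flow_drift X s : flow F p d e X -> 0 <= s <= 8 -> `|X s - X 0| <= d / 2.
Proof.
move=> XF /andP[s0 s8].
have := lipschitz_increment 0 s XF (fun s => G_le (X s) s).
rewrite subr0 (ger0_norm s0) => /le_trans; apply.
have : b * s <= b * 8 by rewrite ler_wpM2l.
by move: bd; lra.
Qed.

Lemma flow_increment X Y s : flow F p d e X -> flow F p d e Y -> 0 <= s <= 8 ->
  `|(X s - Y s) - (X 0 - Y 0)| <= `|X 0 - Y 0| * (16 * b).
Proof.
move=> XF YF /andP[s0 s8].
have := @gronwall_increment R (fun s => X s - Y s)
  (fun s => G (X s) s - G (Y s) s) b 0 s b_ge0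
  (fun t => deriveB1 (XF t) (YF t)) (fun s => G_lip (X s) (Y s) s).
rewrite subr0 (ger0_norm s0) => /le_trans; apply; rewrite ler_wpM2l//.
have b8 : b * s <= b * 8 by rewrite ler_wpM2l.
have bs0 : 0 <= b * s by rewrite mulr_ge0.
apply: (le_trans (expR_sub1_le _)); last lra.
by rewrite bs0 /=; move: b16; lra.
Qed.

End Bounds.

End Averaging.

(** * The averaging theorem at a simple zero of the mean *)

Section AveragingTheorem.
Context {R : realType}.
Variables (p : R) (F : R -> R -> R -> R) (m : R -> R) (m' : R).
Implicit Types (d e x y s : R) (X Y : R -> R).
Hypotheses (F_diff : strict_diff p F) (m_diff : strict_diff p (fun _ x _ => m x)).
Hypotheses (m_p : m p = 0) (dm : is_derive p 1 m m') (m'_neq0 : m' != 0).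
Hypothesis F_periodic : forall e x s, F e x (s + pi *+ 2) = F e x s.
Variable dF : R.
Hypotheses (dF_gt0 : 0 < dF) (F_cont : forall e x, `|e| < dF -> `|x - p| < dF ->
  continuous (F e x)).
Hypothesis F_mean : exists2 d : R, 0 < d & forall x, `|x - p| < d ->
  forall Q : R -> R, (forall s, is_derive s 1 Q (F 0 x s)) ->
  Q (pi *+ 2) - Q 0 = m x.

Let T : R := pi *+ 2.
Let T_ge0 : 0 <= T. Proof. by rewrite mulrn_wge0// pi_ge0. Qed.
Let T_le8 : T <= 8.
Proof.
have := @pihalf_lt2 R; rewrite ltr_pdivrMr// /T mulr2n => h; lra.
Qed.

Ltac clear_context :=
  clear - m'_neq0 F_diff m_diff m_p dm F_periodic dF_gt0 F_cont F_mean T_ge0 T_le8.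

(** The slope provided by strict differentiability is a derivative at [p], hence it is [m']. *)
Lemma strict_diff_mean : strict_diff p (fun _ x _ => m x) ->
  forall c, 0 < c -> exists2 d, 0 < d & forall x y, `|x - p| < d -> `|y - p| < d ->
    `|m x - m y - m' * (x - y)| <= c * `|x - y|.
Proof.
move=> [n [K [_ _ _ H]]].
suff nm : n 0 = m'.
  move=> c c0; have [d d0 Hd] := H _ c0; exists d => // x y xd yd.
  by have := Hd 0 x y 0; rewrite normr0 nm => /(_ d0 xd yd)[].
have [_ <-] := dm.
have [_ <-] // : is_derive p 1 m (n 0).
apply: is_derive_eps => c c0; have [d d0 Hd] := H _ c0.
exists d => // h hd; have := Hd 0 (p + h) p 0.
rewrite subrr !normr0 (_ : p + h - p = h); last by ring.
by move=> /(_ d0 hd d0)[_].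
Qed.

(* The displacement X (2 pi) - X 0 is e * m (X 0) up to an error whose
   Lipschitz constant in X 0 is a small multiple of |e|. *)
Lemma averaging_setup : exists d e0 B : R, [/\ 0 < d < dF, 0 < e0 <= dF, 0 <= B &
  forall e, `|e| < e0 ->
  [/\ 16 * (`|e| * B) <= d, 16 * (`|e| * B) <= 1,
    forall x s, `|x - p| <= d -> `|F e x s| <= B,
    forall x y s, `|x - p| <= d -> `|y - p| <= d ->
      `|F e x s - F e y s| <= B * `|x - y| &
    forall x, `|x - p| <= d -> continuous (F e x)] /\
  `|e * m'| <= 2^-1 /\
  forall X Y, flow F p d e X -> flow F p d e Y ->
    `|X 0 - p| <= d / 2 -> `|Y 0 - p| <= d / 2 ->
    `|(X T - Y T) - (X 0 - Y 0) - e * m' * (X 0 - Y 0)| <=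
      `|e * m'| / 2 * `|X 0 - Y 0| ].
Proof.
have [n [K [K0 FK nK FP]]] := F_diff.
have M0 : 0 < `|m'| by rewrite normr_gt0.
(* The error of the displacement estimate is [8 |e| k (3 + K)] from the flow and [|e| k] from [m],
   times the distance; [k * N <= |m'|] makes the sum at most [|e m'| / 2]. *)
pose N := 2 * (25 + 8 * K).
have N0 : 0 < N by rewrite /N; lra.
pose k : R := Num.min 1 (`|m'| / N).
have k0 : 0 < k by rewrite lt_min ltr01 divr_gt0.
have k1 : k <= 1 by rewrite ge_min lexx.
have kN : k * N <= `|m'| by rewrite -ler_pdivlMr// ge_min lexx orbT.
have [d1 d1_gt0 Hd1] := FP _ ltr01.
have [d2 d2_gt0 Hd2] := FP _ k0.
have [d3 d3_gt0 Hd3] := strict_diff_mean m_diff k0.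
pose d4 := dF; have d4_gt0 : 0 < d4 by []; pose Hd4 := F_cont.
have [d5 d5_gt0 Hd5] := F_mean.
pose D := Num.min d1 (Num.min d2 (Num.min d3 (Num.min d4 d5))).
have D0 : 0 < D by rewrite !lt_min d1_gt0 d2_gt0 d3_gt0 d4_gt0.
have [D1 D2 D3 D4 D5] : [/\ D <= d1, D <= d2, D <= d3, D <= d4 & D <= d5].
  by split; rewrite /D !ge_min ?lexx ?orbT.
pose d := D / 2.
have d_gt0 : 0 < d by rewrite divr_gt0.
have dD : d < D by rewrite /d ltr_pdivrMr// ltr_pMr// ltr1n.
pose B := K + 1.
have B0 : 0 < B by rewrite addr_gt0.
(* The bounds serve, in order: the range of strict differentiability, the relative change [k] of a
   difference over a period, the drift bound, and [|e m'| <= 1/2]. *)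
pose e0 := Num.min d (Num.min (k / (16 * B)) (Num.min (d / (16 * B)) (2 * `|m'|)^-1)).
exists d, e0, B; split => //.
- by rewrite d_gt0 (lt_le_trans dD).
- rewrite !lt_min d_gt0 !divr_gt0 ?mulr_gt0// invr_gt0 mulr_gt0//=.
  by rewrite ge_min (le_trans (ltW dD)).
- exact: ltW.
move=> e; rewrite !lt_min => /and4P[ed ek eBd em].
have e1 : `|e| * (16 * B) <= k by rewrite -ler_pdivlMr ?mulr_gt0// ltW.
have e2 : `|e| * (16 * B) <= d by rewrite -ler_pdivlMr ?mulr_gt0// ltW.
have Fle x s : `|x - p| <= d -> `|F e x s| <= B.
  move=> xd; have := (Hd1 e x x s _ _ _).1.
  rewrite (le_lt_trans xd) ?(lt_le_trans dD)// (lt_le_trans (lt_trans ed dD))//.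
  move=> /(_ isT isT isT) H; have := ler_normD (F e x s - F 0 p s) (F 0 p s).
  rewrite subrK => /le_trans; apply.
  by rewrite /B addrC lerD.
have Flip x y s : `|x - p| <= d -> `|y - p| <= d ->
    `|F e x s - F e y s| <= B * `|x - y|.
  move=> xd yd; have := (Hd1 e x y s _ _ _).2.
  rewrite (le_lt_trans xd) ?(le_lt_trans yd) ?(lt_le_trans dD)//.
  rewrite (lt_le_trans (lt_trans ed dD))// => /(_ isT isT isT) H.
  have := ler_normD (F e x s - F e y s - n s * (x - y)) (n s * (x - y)).
  rewrite subrK => /le_trans; apply.
  by rewrite /B mulrDl addrC lerD// normrM ler_wpM2r.
have Fct x : `|x - p| <= d -> continuous (F e x).
  move=> xd; apply: Hd4; last by rewrite (le_lt_trans xd)// (lt_le_trans dD).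
  by rewrite (lt_le_trans (lt_trans ed dD)).
have b1 : 16 * (`|e| * B) <= k by rewrite mulrCA.
have b2 : 16 * (`|e| * B) <= d by rewrite mulrCA.
have b3 : 16 * (`|e| * B) <= 1 by rewrite (le_trans b1).
have emM : `|e * m'| <= 2^-1.
  rewrite normrM -ler_pdivlMr// (le_trans (ltW em))// invfM.
  by rewrite mulrC.
do 2!split => //.
move=> X Y XF YF Xd Yd; set x := X 0 in Xd *; set y := Y 0 in Yd *.
have close Z s : flow F p d e Z -> `|Z 0 - p| <= d / 2 -> 0 <= s <= 8 -> `|Z s - p| <= d.
  move=> ZF Zd s8.
  have := flow_drift d_gt0 (ltW B0) b2 Fle ZF s8.
  have := ler_normD (Z s - Z 0) (Z 0 - p).
  rewrite addrA subrK => h1 h2.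
  by apply: (le_trans h1); rewrite [leRHS]splitr lerD.
have xD : `|x - p| < D by rewrite (le_lt_trans Xd)// (lt_trans _ dD)// ltr_pdivrMr// ltr_pMr// ltr1n.
have yD : `|y - p| < D by rewrite (le_lt_trans Yd)// (lt_trans _ dD)// ltr_pdivrMr// ltr_pMr// ltr1n.
have cF z : `|z - p| < D -> continuous (F 0 z).
  by move=> zD; apply: Hd4; rewrite ?normr0// (lt_le_trans zD).
have [Qx _ dQx] := primitive_exists 0 (cF _ xD).
have [Qy _ dQy] := primitive_exists 0 (cF _ yD).
have Mx := Hd5 _ (lt_le_trans xD D5) _ dQx; have My := Hd5 _ (lt_le_trans yD D5) _ dQy.
pose phi s := (X s - Y s) - e * (Qx s - Qy s).
pose dphi s := (e * F e (clamp p d (X s)) s - e * F e (clamp p d (Y s)) s) -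
   e * (F 0 x s - F 0 y s).
have dphiP s : is_derive s 1 phi (dphi s).
  apply: (is_derive_eq (deriveB1 (deriveB1 (XF s) (YF s))
    (deriveM1 (is_derive_cst e s 1) (deriveB1 (dQx s) (dQy s))))).
  by rewrite mul0r add0r.
pose C := `|e| * (k * (3 + K) * `|x - y|).
have dphi_le s : 0 < s < T -> `|dphi s| <= C.
  move=> /andP[s0 sT].
  have s8 : 0 <= s <= 8 by rewrite (ltW s0) (le_trans (ltW sT)).
  have Xs := close _ _ XF Xd s8; have Ys := close _ _ YF Yd s8.
  rewrite /dphi !clamp_id// -!mulrBr normrM ler_wpM2l//.
  have := flow_increment d_gt0 (ltW B0) b3 Flip XF YF s8.
  rewrite -/x -/y => I.
  have XD : `|X s - p| < d2 by rewrite (le_lt_trans Xs)// (lt_le_trans dD).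
  have YD : `|Y s - p| < d2 by rewrite (le_lt_trans Ys)// (lt_le_trans dD).
  have eD : `|e| < d2 by rewrite (lt_le_trans (lt_trans ed dD)).
  have [_ H1] := Hd2 e (X s) (Y s) s eD XD YD.
  have := Hd2 0 x y s.
  rewrite normr0 => /(_ d2_gt0 (lt_le_trans xD D2) (lt_le_trans yD D2))[_ H2].
  have t1 : `|n s * (X s - Y s - (x - y))| <= K * (`|x - y| * k).
    by rewrite normrM ler_pM// (le_trans I)// ler_wpM2l.
  have t2 : `|X s - Y s| <= 2 * `|x - y|.
    have := ler_normD (X s - Y s - (x - y)) (x - y); rewrite subrK => /le_trans; apply.
    rewrite mulr_natl mulr2n lerD// (le_trans I)// ler_piMr//.
  have t3 : k * `|X s - Y s| <= k * (2 * `|x - y|) by rewrite ler_wpM2l// ltW.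
  rewrite (_ : _ - _ = (F e (X s) s - F e (Y s) s - n s * (X s - Y s)) +
    n s * (X s - Y s - (x - y)) - (F 0 x s - F 0 y s - n s * (x - y))); last by ring.
  rewrite (le_trans (ler_normB _ _))// (le_trans (lerD (ler_normD _ _) (lexx _)))//.
  rewrite (le_trans (lerD (lerD (le_trans H1 t3) t1) H2))//.
  by rewrite le_eqVlt; apply/orP; left; apply/eqP; ring.
have dC s : is_derive s 1 (fun s => C * s) C.
  apply: (is_derive_eq (deriveM1 (is_derive_cst C s 1) (is_derive_id s 1))).
  by rewrite mul0r add0r mulr1.
have := norm_increment T_ge0 (derive_continuous_within dphiP)
  (derive_continuous_within dC) (fun s _ => dphiP s) (fun s _ => dC s) dphi_le.
rewrite /phi mulr0 subr0 -/x -/y.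
rewrite (_ : _ - _ - _ = (X T - Y T) - (x - y) - e * (m x - m y)); last first.
  by rewrite -Mx -My /T; ring.
move=> H.
have C0 : 0 <= C by rewrite !mulr_ge0// ?ltW// addr_gt0.
have {}H := le_trans H (ler_wpM2l C0 T_le8).
have H3 := Hd3 _ _ (lt_le_trans xD D3) (lt_le_trans yD D3).
rewrite (_ : _ - _ - _ = (X T - Y T - (x - y) - e * (m x - m y)) +
  e * (m x - m y - m' * (x - y))); last by ring.
rewrite (le_trans (ler_normD _ _))//.
have H4 : `|e * (m x - m y - m' * (x - y))| <= `|e| * (k * `|x - y|).
  by rewrite normrM ler_wpM2l.
rewrite (le_trans (lerD H H4))// normrM.
have : `|e| * `|x - y| * (k * N) <= `|e| * `|x - y| * `|m'|.
  by rewrite ler_wpM2l// mulr_ge0.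
move=> H5; rewrite (_ : _ + _ = `|e| * `|x - y| * (k * N) / 2); last first.
  by rewrite /C /N; field.
rewrite (_ : `|e| * `|m'| / 2 * _ = `|e| * `|x - y| * `|m'| / 2); last by ring.
by rewrite ler_pM2r ?invr_gt0.
Qed.

(** A flow and its translate by [T] agree at 0, so uniqueness turns a fixed point of the return map
    into a periodic solution. *)
Lemma flow_mul_period d e X n : flow F p d e X ->
  (forall Y Z, flow F p d e Y -> flow F p d e Z -> Y 0 = Z 0 -> Y = Z) ->
  X T = X 0 -> (forall s, X (s + T *+ n) = X s) /\ forall s, X (s - T *+ n) = X s.
Proof.
move=> XF uniq XT.
have XsT s : X (s + T) = X s.
  have := uniq _ _ (flow_shift F_periodic XF) XF.
  by rewrite add0r => /(_ XT) /(congr1 (fun f => f s)).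
have XsTn s : X (s + T *+ n) = X s.
  by elim: n s => [s|n IH s]; rewrite ?mulr0n ?addr0// mulrS addrA IH.
by split=> // s; rewrite -[in RHS](subrK (T *+ n) s) XsTn.
Qed.

Lemma period_reduce s : exists n, exists2 t : R, 0 <= t <= 8 &
  s = t + T *+ n \/ s = t - T *+ n.
Proof.
have T0 : 0 < T by rewrite mulrn_wgt0// pi_gt0.
have H u : 0 <= u -> exists n, exists2 t : R, 0 <= t <= T & u = t + T *+ n.
  move=> u0; have uT : 0 <= u / T by rewrite divr_ge0// ltW.
  have /truncn_itv := uT; set n := Num.truncn _ => /andP[h1 h2].
  exists n, (u - T *+ n); last by rewrite subrK.
  rewrite subr_ge0 lerBlDr -mulr_natl -[T in T + _]mul1r -mulrDl.
  rewrite -ler_pdivlMr// h1 /= -ler_pdivrMr//.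
  by rewrite addrC natr1 ltW.
have [s0|s0] := leP 0 s.
  have [n [t /andP[t0 tT] E]] := H _ s0; exists n, t; last by left.
  by rewrite t0 (le_trans tT).
have [|n [t /andP[t0 tT] E]] := H (- s); first by rewrite oppr_ge0 ltW.
exists n.+1, (T - t); first by rewrite subr_ge0 tT (le_trans _ T_le8)// gerBl.
by right; rewrite mulrS -[s]opprK E; ring.
Qed.

Theorem averaging : exists (d e0 : R) (Xs : R -> R -> R),
  [/\ 0 < d < dF /\ 0 < e0 <= dF,
    forall e s0 x0, `|e| < e0 -> exists2 X, X s0 = x0 & flow F p d e X,
    forall e X Y s0, `|e| < e0 -> flow F p d e X -> flow F p d e Y ->
      X s0 = Y s0 -> X = Y,
    forall e, 0 < `|e| < e0 -> [/\ flow F p d e (Xs e), Xs e T = Xs e 0 &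
      forall Y n, (0 < n)%N -> flow F p d e Y -> (forall s, `|Y s - p| <= d / 2) ->
        Y (T *+ n) = Y 0 -> Y = Xs e] &
    forall c : R, 0 < c -> exists2 e1 : R, 0 < e1 & forall e s, 0 < `|e| < e1 ->
      `|Xs e s - p| <= c].
Proof.
have [d [e0 [B [d_itv e0_itv B0 H]]]] := averaging_setup.
have /andP[d0 d_lt] := d_itv; have /andP[e0_gt0 e0_le] := e0_itv.
have ex e s0 x0 : `|e| < e0 -> exists2 X, X s0 = x0 & flow F p d e X.
  by move=> /H[[h1 h2 h3 h4 h5] _]; exact: (flow_exists d0 B0 h2 h3 h4 h5).
have uniq e X Y s0 : `|e| < e0 -> flow F p d e X -> flow F p d e Y ->
    X s0 = Y s0 -> X = Y.
  by move=> /H[[h1 h2 h3 h4 h5] _]; exact: (flow_unique d0 B0 h4).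
have M0 : 0 < `|m'| by rewrite normr_gt0.
(* The first-order term [e * m p] vanishes, so the displacement of [p] is of smaller order than
   [e]. *)
have disp_p c : 0 < c -> exists2 e1 : R, 0 < e1 <= e0 & forall e X, `|e| < e1 ->
    flow F p d e X -> X 0 = p -> `|X T - p| <= `|e| * c.
  move=> c0; have [n [K [K0 FK nK FP]]] := F_diff.
  have [|d1 d1_gt0 Hd1] := FP (c / 8); first by rewrite divr_gt0.
  pose A := 16 * (B + 1).
  have A0 : 0 < A by rewrite mulr_gt0// ltr_wpDl.
  pose e1 := Num.min e0 (Num.min d1 (d1 / A)).
  have e1_gt0 : 0 < e1 by rewrite !lt_min e0_gt0 d1_gt0 divr_gt0.
  exists e1; first by rewrite e1_gt0 ge_min lexx.
  move=> e X; rewrite !lt_min => /and3P[ee0 ed1 edA] XF X0.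
  have [[h1 h2 h3 h4 h5] _] := H e ee0.
  have Xs s : 0 <= s <= 8 -> `|X s - p| < d1.
    move=> /andP[s0 s8].
    have := lipschitz_increment 0 s XF
      (fun s => _ : `|e * F e (clamp p d (X s)) s| <= `|e| * B).
    rewrite X0 => /(_ _)/le_lt_trans; apply.
      by move=> t; rewrite normrM ler_wpM2l// h3// clamp_le// ltW.
    rewrite subr0 (ger0_norm s0).
    have : `|e| * A < d1 by rewrite -ltr_pdivlMr.
    have : `|e| * B * s <= `|e| * B * 8 by rewrite ler_wpM2l// mulr_ge0.
    have : 0 <= `|e| by [].
    have : 0 <= `|e| * B by rewrite mulr_ge0.
    rewrite /A; move: (`|e|) (`|e| * B * s) => u v; clear_context; nra.
  have [d5 d5_gt0 Hd5] := F_mean.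
  have cFp : continuous (F 0 p) by apply: F_cont; rewrite ?subrr normr0.
  have [Q _ dQ] := primitive_exists 0 cFp.
  have Mp : Q T - Q 0 = 0 by rewrite (Hd5 p _ _ dQ) ?subrr ?normr0.
  pose phi s := X s - e * Q s.
  have dphi s : is_derive s 1 phi (e * F e (clamp p d (X s)) s - e * F 0 p s).
    apply: (is_derive_eq (deriveB1 (XF s) (deriveM1 (is_derive_cst e s 1) (dQ s)))).
    by rewrite mul0r add0r.
  pose C := `|e| * (c / 8).
  have dC s : is_derive s 1 (fun s => C * s) C.
    apply: (is_derive_eq (deriveM1 (is_derive_cst C s 1) (is_derive_id s 1))).
    by rewrite mul0r add0r mulr1.
  have := norm_increment T_ge0 (derive_continuous_within dphi)
    (derive_continuous_within dC) (fun s _ => dphi s) (fun s _ => dC s).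
  rewrite /phi mulr0 subr0 X0 (_ : _ - _ - _ = X T - p - e * (Q T - Q 0)); last by ring.
  rewrite Mp mulr0 subr0 => HX; apply: le_trans (HX _) _.
    move=> s /andP[s0 sT]; rewrite -mulrBr normrM ler_wpM2l//.
    have s8 : 0 <= s <= 8 by rewrite (ltW s0) (le_trans (ltW sT)).
    rewrite clamp_id; last by have := flow_drift d0 B0 h1 h3 XF s8; rewrite X0; lra.
    by apply: (Hd1 e (X s) p s ed1 (Xs s s8) _).1; rewrite subrr normr0.
  have C0 : 0 <= C by rewrite mulr_ge0// divr_ge0// ltW.
  by rewrite (le_trans (ler_wpM2l C0 T_le8))// /C -mulrA divfK.
(* The displacement is at most [|e m'| c / 4] at [p], and from [p] to [p + c] or [p - c] it changes
   by at least [|e m'| c / 2], in opposite directions; the intermediate value theorem gives a zero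
   between. *)
have fix_exists c : 0 < c <= d / 4 -> exists2 e1 : R, 0 < e1 <= e0 & forall e,
    `|e| < e1 -> exists X, [/\ flow F p d e X, X T = X 0 & `|X 0 - p| <= c].
  move=> /andP[c0 cd].
  have [|e1 /andP[e1_gt0 e10] He1] := disp_p (`|m'| * c / 4).
    by rewrite divr_gt0// mulr_gt0.
  exists e1; first by rewrite e1_gt0.
  move=> e ee1; have ee0 := lt_le_trans ee1 e10.
  have [_ [_ KE]] := H e ee0.
  have /choice[S HS] : forall x, exists X : R -> R, X 0 = x /\ flow F p d e X.
    by move=> x; have [X X0 XF] := ex e 0 x ee0; exists X.
  have S0 x := (HS x).1; have SF x := (HS x).2.
  pose g x := S x T - x.
  have KEg x y : `|x - p| <= d / 2 -> `|y - p| <= d / 2 ->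
      `|g x - g y - e * m' * (x - y)| <= `|e * m'| / 2 * `|x - y|.
    move=> xd yd; have := KE _ _ (SF x) (SF y); rewrite !S0 => /(_ xd yd).
    by rewrite (_ : S x T - S y T - (x - y) = g x - g y)// /g; ring.
  have gp : `|g p| <= `|e * m'| / 4 * c.
    have := He1 e (S p) ee1 (SF p) (S0 p).
    by rewrite normrM (_ : `|e| * _ = `|e| * `|m'| / 4 * c)//; ring.
  have cg : {within `[p - c, p + c], continuous g}.
    apply: continuous_in_subspaceT => x; rewrite inE/= in_itv/= => /andP[x1 x2].
    have xd : `|x - p| <= d / 4 by rewrite ler_norml; move: x1 x2 cd; clear_context; lra.
    apply/cvgrPdist_lt => t t0; near=> y.
    have yd : `|x - y| < d / 4.
      by near: y; apply: (@continuous_dist_lt R id x (d / 4) (@cvg_id _ _)); rewrite divr_gt0.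
    have yp : `|y - p| <= d / 2.
      rewrite (_ : y - p = (x - p) - (x - y)); last by ring.
      by rewrite (le_trans (ler_normB _ _))//; move: xd yd; clear_context; lra.
    have xp : `|x - p| <= d / 2 by rewrite (le_trans xd)//; move: c0 cd; clear_context; lra.
    have K1 := KEg _ _ xp yp.
    have xyt : `|x - y| < t / (2 * (`|e * m'| + 1)).
      near: y; apply: (@continuous_dist_lt R id x _ (@cvg_id _ _)).
      by rewrite divr_gt0// mulr_gt0// ltr_wpDl.
    rewrite ltr_pdivlMr ?mulr_gt0 ?ltr_wpDl// in xyt.
    have := ler_normD (g x - g y - e * m' * (x - y)) (e * m' * (x - y)).
    rewrite subrK => /le_lt_trans; apply; rewrite [X in _ + X]normrM.
    have : 0 <= `|e * m'| * `|x - y| by rewrite mulr_ge0.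
    have : 0 <= `|x - y| by [].
    move: K1 xyt; move: (`|x - y|) (`|e * m'|) (`|_|) => u v w; clear_context; nra.
  have cd2 : c <= d / 2 by move: c0 cd; clear_context; lra.
  have gR := KEg (p + c) p _ _; have gL := KEg (p - c) p _ _.
  rewrite (_ : p + c - p = c) ?subrr ?normr0 ?(ger0_norm (ltW c0)) in gR; last by ring.
  rewrite (_ : p - c - p = - c) ?subrr ?normr0 ?normrN ?(ger0_norm (ltW c0)) in gL;
    last by ring.
  have d20 : 0 <= d / 2 by rewrite divr_ge0// ltW.
  have {}gR := gR cd2 d20; have {}gL := gL cd2 d20.
  have [x xc gx] : exists2 x, x \in `[p - c, p + c] & g x = 0.
    apply: IVT => //; first by move: c0; clear_context; lra.
    move: gp gR gL; rewrite mulrN opprK.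
    set E := e * m'; rewrite ge_min le_max.
    have [E0|/ltW E0] := leP 0 E.
      rewrite (ger0_norm E0) !ler_norml => /andP[a1 a2] /andP[a3 a4] /andP[a5 a6].
      have Ec : 0 <= E * c by rewrite mulr_ge0// ltW.
      by move: a1 a2 a3 a4 a5 a6 E0 Ec c0; clear_context; move=> *; apply/andP; split; apply/orP; [left|right]; lra.
    rewrite (ler0_norm E0) !ler_norml => /andP[a1 a2] /andP[a3 a4] /andP[a5 a6].
    have Ec : E * c <= 0 by rewrite mulr_le0_ge0// ltW.
    by move: a1 a2 a3 a4 a5 a6 E0 Ec c0; clear_context; move=> *; apply/andP; split; apply/orP; [right|left]; lra.
  exists (S x); split; first exact: SF.
    by apply/eqP; rewrite -subr_eq0 S0 -/(g x) gx.
  by rewrite S0; move: xc; rewrite in_itv/= ler_norml => /andP[]; clear_context; lra.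
have [|e1 /andP[e1_gt0 e10] He1] := fix_exists (d / 4).
  by rewrite lexx divr_gt0.
have /choice[Xs HXs] : forall e, exists X : R -> R, `|e| < e1 ->
    [/\ flow F p d e X, X T = X 0 & `|X 0 - p| <= d / 4].
  move=> e; have [/He1[X HX]|ee1] := boolP (`|e| < e1); first by exists X.
  by exists (fun=> 0).
have d42 : d / 4 <= d / 2 by lra.
exists d, e1, Xs; split.
- by rewrite d0 d_lt e1_gt0 (le_trans e10).
- by move=> e s0 x0 ee1; apply: ex; exact: lt_le_trans e10.
- by move=> e X Y s0 ee1; apply: uniq; exact: lt_le_trans e10.
- move=> e /andP[en0 ee1]; have [XF XT X0] := HXs e ee1.
  have ee0 := lt_le_trans ee1 e10.
  split => // Y n n0 YF Yd YTn.
  have uniq0 Z W : flow F p d e Z -> flow F p d e W -> Z 0 = W 0 -> Z = W.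
    exact: uniq.
  apply: contrapT => YX.
  (* The difference from the periodic solution after [k] turns. Each turn strictly decreases its
     absolute value, or each turn strictly increases it, according to the sign of [e * m']; it
     cannot return to its initial value. *)
  pose D k := Y (T *+ k) - Xs e 0.
  have D0 k : 0 < `|D k|.
    rewrite normr_gt0 subr_eq0; apply/eqP => Dk; apply: YX.
    have YkF : flow F p d e (fun s => Y (s + T *+ k)).
      elim: k {Dk} => [|k IH]; first by under eq_fun do rewrite mulr0n addr0.
      have := flow_shift F_periodic IH.
      by under eq_fun do rewrite -addrA -mulrS.
    have := uniq0 _ _ YkF XF; rewrite add0r => /(_ Dk) E.
    apply/funext => s; have := congr1 (fun f => f (s - T *+ k)) E.
    by rewrite subrK => ->; exact: (flow_mul_period k XF uniq0 XT).2.
  have [_ [_ KE]] := H e ee0.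
  have DS k : `|D k.+1 - D k - e * m' * D k| <= `|e * m'| / 2 * `|D k|.
    have YkF : flow F p d e (fun s => Y (s + T *+ k)).
      elim: k => [|k IH]; first by under eq_fun do rewrite mulr0n addr0.
      have := flow_shift F_periodic IH.
      by under eq_fun do rewrite -addrA -mulrS.
    have := KE _ _ YkF XF; rewrite add0r -mulrS XT; apply; first exact: Yd.
    exact: le_trans d42.
  have em0 : e * m' != 0 by rewrite mulf_neq0// -normr_gt0.
  have em2 : `|e * m'| <= 2^-1 by have [_ []] := H e ee0.
  have Dn : D n = D 0 by rewrite /D YTn mulr0n.
  have [em|em|/eqP] := ltgtP (e * m') 0; last by rewrite (negbTE em0).
  + have DD k : `|D k.+1| < `|D k|.
      have := DS k; have := D0 k; rewrite (ltr0_norm em) in em2 *.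
      have := ler_normD (D k.+1 - D k - e * m' * D k) ((1 + e * m') * D k).
      rewrite (_ : D k.+1 - D k - e * m' * D k + (1 + e * m') * D k = D k.+1);
        last by ring.
      rewrite [X in _ + X]normrM (ger0_norm (_ : 0 <= 1 + e * m')); last by move: em em2; clear_context; lra.
      move: em em2; move: (e * m') (`|D k|) (`|D k.+1|) => E u v; clear_context; nra.
    have : `|D n| < `|D 0|.
      apply: (homo_ltn (r := fun x y : R => y < x) (f := fun i => `|D i|) _ DD n0).
      by move=> y x z h1 h2; exact: lt_trans h2 h1.
    by rewrite Dn ltxx.
  + have DD k : `|D k| < `|D k.+1|.
      have := DS k; have := D0 k; rewrite (gtr0_norm em) in em2 *.
      have := ler_normB (D k.+1) (D k.+1 - D k - e * m' * D k).
      rewrite (_ : D k.+1 - (D k.+1 - D k - e * m' * D k) = (1 + e * m') * D k);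
        last by ring.
      rewrite normrM (ger0_norm (_ : 0 <= 1 + e * m')); last by move: em em2; clear_context; lra.
      move: em em2; move: (e * m') (`|D k|) (`|D k.+1|) => E u v; clear_context; nra.
    have : `|D 0| < `|D n|.
      apply: (homo_ltn (r := fun x y : R => x < y) (f := fun i => `|D i|) _ DD n0).
      by move=> y x z; exact: lt_trans.
    by rewrite Dn ltxx.
- move=> c c0; pose q := Num.min (d / 4) (c / 2).
  have q0 : 0 < q by rewrite lt_min !divr_gt0.
  have [|e2 /andP[e2_gt0 e20] He2] := fix_exists q; first by rewrite q0 ge_min lexx.
  pose A := 16 * (B + 1).
  have A0 : 0 < A by rewrite mulr_gt0// ltr_wpDl.
  pose e3 := Num.min e1 (Num.min e2 (c / A)).
  exists e3; first by rewrite !lt_min e1_gt0 e2_gt0 divr_gt0.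
  move=> e s /andP[en0]; rewrite !lt_min => /and3P[ee1 ee2 eeA].
  have [XF XT X0] := HXs e ee1; have [Z [ZF ZT Z0]] := He2 e ee2.
  have ee0 := lt_le_trans ee1 e10.
  have uniq0 V W : flow F p d e V -> flow F p d e W -> V 0 = W 0 -> V = W.
    exact: uniq.
  have [[h1 h2 h3 h4 h5] [_ KE]] := H e ee0.
  (* Two fixed points of the return map coincide by the displacement estimate, so the one known
     within [d / 4] of [p] is the one found within [q]. *)
  have XZ : Xs e 0 = Z 0.
    have := KE _ _ XF ZF (le_trans X0 d42).
    have qd : q <= d / 2 by rewrite (le_trans _ d42)// ge_min lexx.
    move=> /(_ (le_trans Z0 qd)); rewrite XT ZT subrr sub0r normrN normrM.
    apply: contraTeq; rewrite -subr_eq0 -normr_gt0 => XZ.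
    rewrite -ltNge ltr_pM2r// ltr_pdivrMr// ltr_pMr ?ltr1n//.
    by rewrite normr_gt0 mulf_neq0// -normr_gt0.
  have [n [t /andP[t0 t8] st]] := period_reduce s.
  have -> : Xs e s = Xs e t.
    by case: st => ->; [exact: (flow_mul_period n XF uniq0 XT).1|
      exact: (flow_mul_period n XF uniq0 XT).2].
  have := lipschitz_increment 0 t XF
    (fun s => _ : `|e * F e (clamp p d (Xs e s)) s| <= `|e| * B).
  move=> /(_ _) I; have {}I := I (fun t => _ : `|e * F e (clamp p d (Xs e t)) t| <= `|e| * B).
  have := ler_normD (Xs e t - Xs e 0) (Xs e 0 - p).
  rewrite addrA subrK => /le_trans; apply.
  have qc : q <= c / 2 by rewrite ge_min lexx orbT.
  rewrite [leRHS]splitr lerD//; last by rewrite XZ (le_trans Z0).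
  rewrite (le_trans (I _))//.
    by move=> u; rewrite normrM ler_wpM2l// h3// clamp_le// ltW.
  rewrite subr0 (ger0_norm t0).
  have : `|e| * A < c by rewrite -ltr_pdivlMr.
  have : `|e| * B * t <= `|e| * B * 8 by rewrite ler_wpM2l// mulr_ge0.
  have : 0 <= `|e| by [].
  have : 0 <= `|e| * B by rewrite mulr_ge0.
  rewrite /A; move: (`|e|) (`|e| * B * t) => u v; clear_context; nra.
Unshelve. all: by end_near. Qed.

End AveragingTheorem.

#[local] Opaque sin cos.

(** * Coordinates of the annulus and regularity of the scalar field *)

Section AnnulusCoordinates.
Context {R : realType}.
Variables a c0 c2 c3 c4 : R.
Implicit Types e x s c u v : R.

(* P1 + i P2 = c0 + c2 w^2 + c3 w^3 + c4 w^4 for w = u + i v. *)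
Definition P1 u v := c0 + c2 * (u ^+ 2 - v ^+ 2) + c3 * (u ^+ 3 - 3 * u * v ^+ 2) +
  c4 * (u ^+ 4 - 6 * u ^+ 2 * v ^+ 2 + v ^+ 4).
Definition P2 u v := c2 * (2 * u * v) + c3 * (3 * u ^+ 2 * v - v ^+ 3) +
  c4 * (4 * u ^+ 3 * v - 4 * u * v ^+ 3).

(** Components of [- i w + e (a w + P(w))] inside the disc and of [- i w + e a w] outside. *)
Definition in1 e u v := v + e * (a * u + P1 u v).
Definition in2 e u v := - u + e * (a * v + P2 u v).
Definition out1 e u v := v + e * (a * u).
Definition out2 e u v := - u + e * (a * v).

(* The annulus 0 < |w| < 2 in coordinates (x, s): |w| = 2 cos x, and s is an
   angle; the disc |w + 1| < 1 is sin s > 0 and its exterior is sin s < 0. *)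
Definition inx x s := - (2 * cos x * cos (x * cos s)).
Definition iny x s := - (2 * cos x * sin (x * cos s)).
Definition outx x s := 2 * cos x * cos ((pi - x) * cos s).
Definition outy x s := - (2 * cos x * sin ((pi - x) * cos s)).
(** As [s] runs from 0 to [2 pi] the circle is traversed clockwise: the polar angle is
    [pi + x cos s] on the arc in the disc, whose half-angle is [x], and then [- (pi - x) cos s]. *)
Definition wx x s := if 0 <= sin s then inx x s else outx x s.
Definition wy x s := if 0 <= sin s then iny x s else outy x s.

(* gr + i gi is the perturbation divided by w. *)
Definition gr x s := a + (inx x s * P1 (inx x s) (iny x s) +
  iny x s * P2 (inx x s) (iny x s)) * (4 * cos x ^+ 2)^-1.
Definition gi x s := (inx x s * P2 (inx x s) (iny x s) -
  iny x s * P1 (inx x s) (iny x s)) * (4 * cos x ^+ 2)^-1.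

Definition cot x := cos x * (sin x)^-1.
(** In the disc [log |w|] grows at the rate [e gr], so dx/dt is [- e cot x gr], and the angle
    [x cos s] changes at the rate [- (1 - e gi)]; together [x sin s ds/dt = din]. Outside, likewise,
    [- (pi - x) sin s ds/dt = dout]. *)
Definition din e x s := 1 - e * (gi x s + cos s * cot x * gr x s).
Definition dout e x s := 1 - e * (a * cos s * cot x).
Definition thin e x s := x * (din e x s)^-1.
Definition thout e x s := (pi - x) * (dout e x s)^-1.
(** The two parts of [sin s] select the side and vanish at the crossings, which makes the glued
    field continuous there. *)
Definition sinp s : R := Num.max (sin s) 0.
Definition sinm s : R := Num.max (- sin s) 0.

(* Derivative of the time and of x with respect to s along a solution. *)
Definition theta e x s := sinp s * thin e x s + sinm s * thout e x s.
Definition field_x e x s :=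
  - cot x * (sinp s * (thin e x s * gr x s) + sinm s * (thout e x s * a)).

(** A primitive of [gr - a] along the arc in the disc, as a function of [u = x cos s]. *)
Definition gr_primitive x u :=
  - (c0 * (2 * cos x)^-1 + c2 * (2 * cos x)) * sin u +
  (c3 * (2 * cos x) ^+ 2 * (sin u * cos u) -
   c4 * (2 * cos x) ^+ 3 * (sin u - 4 / 3 * (sin u * sin u * sin u))).

(** Up to the factor [- cot x], the arc in the disc gives [2 a x + 2 gr_primitive x x] and the other
    arc [2 a (pi - x)]. *)
Definition melnikov x := - cot x * (2 * (a * pi) + 2 * gr_primitive x x).

Lemma sinp_le1 s : `|sinp s| <= 1.
Proof.
rewrite /sinp; have [_|_] := leP (sin s) 0; first by rewrite normr0.
by rewrite ler_norml sin_geN1 sin_le1.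
Qed.

Lemma sinm_le1 s : `|sinm s| <= 1.
Proof.
rewrite /sinm; have [_|_] := leP (- sin s) 0; first by rewrite normr0.
by rewrite normrN ler_norml sin_geN1 sin_le1.
Qed.

Lemma sinp_sinm s : sinp s + sinm s = `|sin s|.
Proof.
rewrite /sinp /sinm; have [h|h] := leP (sin s) 0.
  by rewrite add0r max_l ?oppr_ge0// ler0_norm.
by rewrite max_r ?oppr_le0 ?ltW// addr0 gtr0_norm.
Qed.

Lemma cos_le1_norm (x : R) : `|cos x| <= 1.
Proof. by rewrite ler_norml cos_geN1 cos_le1. Qed.

Lemma sin_le1_norm (x : R) : `|sin x| <= 1.
Proof. by rewrite ler_norml sin_geN1 sin_le1. Qed.

Section StrictDiff.
Variable p : R.
Hypothesis p_itv : 0 < p < pi / 2.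

Let cos_p : 0 < cos p.
Proof. by apply: cos_gt0_pihalf; case/andP: p_itv => *; rewrite (lt_trans _ (_ : 0 < p))// oppr_lt0 divr_gt0// pi_gt0. Qed.
Let sin_p : 0 < sin p. Proof. exact: sin_gt0_pihalf. Qed.

Lemma strict_diff_cos h : strict_diff p h -> strict_diff p (fun e x s => cos (h e x s)).
Proof.
move=> hp; apply: (@strict_diff_comp R p h cos (fun x => - sin x) 1) => //.
- by move=> x; rewrite normrN sin_le1_norm.
- move=> x y; rewrite (_ : - sin x - - sin y = - (sin x - sin y)); last by ring.
  by rewrite normrN; exact: (lipschitz_increment y x (@is_derive_sin R) cos_le1_norm).
- exact: cos_le1_norm.
Qed.

Lemma strict_diff_sin h : strict_diff p h -> strict_diff p (fun e x s => sin (h e x s)).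
Proof.
move=> hp; apply: (@strict_diff_comp R p h sin cos 1) => //.
- exact: cos_le1_norm.
- move=> x y; apply: (lipschitz_increment y x (@is_derive_cos R)) => z.
  by rewrite normrN sin_le1_norm.
- exact: sin_le1_norm.
Qed.

Lemma strict_diff_const (k : R) : strict_diff p (fun _ _ _ => k).
Proof. exact: (@strict_diff_cst R p (fun=> k) `|k|). Qed.

Lemma strict_diff_eq h k : (forall e x s, h e x s = k e x s) ->
  strict_diff p h -> strict_diff p k.
Proof.
move=> hk; suff -> : h = k by [].
by apply/funext => e; apply/funext => x; apply/funext => s.
Qed.

Lemma strict_diffX h n : strict_diff p h -> strict_diff p (fun e x s => h e x s ^+ n).
Proof.
move=> hp; elim: n => [|n IH]; first exact: (@strict_diff_const 1).
apply: strict_diff_eq (strict_diffM hp IH) => e x s; by rewrite exprS.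
Qed.

Lemma strict_diff_cos_s : strict_diff p (fun _ _ s => cos s).
Proof. exact: (@strict_diff_cst R p (fun s => cos s) 1 cos_le1_norm). Qed.

Lemma strict_diff_sinp_s : strict_diff p (fun _ _ s => sinp s).
Proof. exact: (@strict_diff_cst R p (fun s => sinp s) 1 sinp_le1). Qed.

Lemma strict_diff_sinm_s : strict_diff p (fun _ _ s => sinm s).
Proof. exact: (@strict_diff_cst R p (fun s => sinm s) 1 sinm_le1). Qed.

Ltac strict_diff_tac := lazymatch goal with
  | |- strict_diff _ (fun e x s => x) => exact: strict_diff_id
  | |- strict_diff _ (fun e x s => e) => exact: strict_diff_param
  | |- strict_diff _ (fun e x s => cos s) =>
    exact: strict_diff_cos_s
  | |- strict_diff _ (fun e x s => sinp s) =>
    exact: strict_diff_sinp_s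
  | |- strict_diff _ (fun e x s => sinm s) =>
    exact: strict_diff_sinm_s
  | |- strict_diff _ (fun e x s => - (@?f e x s)) =>
    apply: (@strict_diffN R p f); strict_diff_tac
  | |- strict_diff _ (fun e x s => @?f e x s + @?g e x s) =>
    apply: (@strict_diffD R p f g); strict_diff_tac
  | |- strict_diff _ (fun e x s => @?f e x s * @?g e x s) =>
    apply: (@strict_diffM R p f g); strict_diff_tac
  | |- strict_diff _ (fun e x s => @?f e x s ^+ ?n) =>
    apply: (@strict_diffX f n); strict_diff_tac
  | |- strict_diff _ (fun e x s => cos (@?f e x s)) =>
    apply: (@strict_diff_cos f); strict_diff_tac
  | |- strict_diff _ (fun e x s => sin (@?f e x s)) =>
    apply: (@strict_diff_sin f); strict_diff_tac
  | _ => exact: strict_diff_const end.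

Lemma strict_diff_invsin : strict_diff p (fun _ x _ => (sin x)^-1).
Proof.
apply: (@strict_diffV R p (fun _ x _ => sin x) (sin p)) => //.
- by strict_diff_tac.
- by move=> _; rewrite gtr0_norm.
Qed.

Lemma strict_diff_cot : strict_diff p (fun _ x _ => cot x).
Proof.
rewrite /cot; apply: strict_diffM; last exact: strict_diff_invsin.
by strict_diff_tac.
Qed.

Lemma strict_diff_invcos2 : strict_diff p (fun _ x _ => (4 * cos x ^+ 2)^-1).
Proof.
apply: (@strict_diffV R p (fun _ x _ => 4 * cos x ^+ 2) (4 * cos p ^+ 2)).
- by strict_diff_tac.
- by rewrite mulr_gt0// exprn_gt0.
- by move=> _; rewrite gtr0_norm// mulr_gt0// exprn_gt0.
Qed.

Lemma strict_diff_gr : strict_diff p (fun _ x s => gr x s).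
Proof.
rewrite /gr /P1 /P2 /inx /iny; apply: strict_diffD; first by strict_diff_tac.
apply: strict_diffM; last exact: strict_diff_invcos2.
by strict_diff_tac.
Qed.

Lemma strict_diff_gi : strict_diff p (fun _ x s => gi x s).
Proof.
rewrite /gi /P1 /P2 /inx /iny; apply: strict_diffM; last exact: strict_diff_invcos2.
by strict_diff_tac.
Qed.

Lemma strict_diff_din : strict_diff p din.
Proof.
rewrite /din; apply: strict_diffD; first by strict_diff_tac.
apply/strict_diffN/strict_diffM; first by strict_diff_tac.
apply: strict_diffD; first exact: strict_diff_gi.
apply: strict_diffM; last exact: strict_diff_gr.
by apply: strict_diffM; [strict_diff_tac|exact: strict_diff_cot].
Qed.

Lemma strict_diff_dout : strict_diff p dout.
Proof.
rewrite /dout; apply: strict_diffD; first by strict_diff_tac.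
apply/strict_diffN/strict_diffM; first by strict_diff_tac.
by apply: strict_diffM; [strict_diff_tac|exact: strict_diff_cot].
Qed.

Lemma strict_diff_thin : strict_diff p thin.
Proof.
rewrite /thin; apply: strict_diffM; first by strict_diff_tac.
apply: (@strict_diffV R p din 1) => //; first exact: strict_diff_din.
by move=> s; rewrite /din mul0r subr0 normr1.
Qed.

Lemma strict_diff_thout : strict_diff p thout.
Proof.
rewrite /thout; apply: strict_diffM; first by strict_diff_tac.
apply: (@strict_diffV R p dout 1) => //; first exact: strict_diff_dout.
by move=> s; rewrite /dout mul0r subr0 normr1.
Qed.

Lemma strict_diff_field : strict_diff p field_x.
Proof.
rewrite /field_x; apply: strict_diffM; first exact/strict_diffN/strict_diff_cot.
apply: strict_diffD; (apply: strict_diffM; first by strict_diff_tac).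
  by apply: strict_diffM; [exact: strict_diff_thin|exact: strict_diff_gr].
by apply: strict_diffM; [exact: strict_diff_thout|strict_diff_tac].
Qed.

Lemma strict_diff_melnikov : strict_diff p (fun _ x _ => melnikov x).
Proof.
rewrite /melnikov /gr_primitive; apply: strict_diffM.
  exact/strict_diffN/strict_diff_cot.
apply: strict_diffD; first exact: strict_diff_const.
apply: strict_diffM; first exact: strict_diff_const.
apply: strict_diffD; last by strict_diff_tac.
apply: strict_diffM; last by strict_diff_tac.
apply: strict_diffN; apply: strict_diffD; last by strict_diff_tac.
apply: strict_diffM; first exact: strict_diff_const.
apply: (@strict_diffV R p (fun _ x _ => 2 * cos x) (2 * cos p)).
- by strict_diff_tac.
- by rewrite mulr_gt0.
- by move=> _; rewrite gtr0_norm// mulr_gt0.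
Qed.

Lemma half_to_two (r : R) : `|r - 1| <= 2^-1 -> 2^-1 <= r <= 2.
Proof. by rewrite ler_distl => /andP[h1 h2]; apply/andP; split; lra. Qed.

(** Both denominators equal 1 at [e = 0], and strict differentiability is uniform in [s]. *)
Lemma good_nbhs : exists2 d : R, 0 < d & forall e x s, `|e| < d -> `|x - p| < d ->
  [/\ 0 < x < pi / 2, 2^-1 <= din e x s <= 2 & 2^-1 <= dout e x s <= 2].
Proof.
have [n1 [K1 [_ _ _ H1]]] := strict_diff_din.
have [n2 [K2 [_ _ _ H2]]] := strict_diff_dout.
have [|d1 d1_gt0 Hd1] := H1 2^-1; first by rewrite invr_gt0.
have [|d2 d2_gt0 Hd2] := H2 2^-1; first by rewrite invr_gt0.
have /andP[p0 p1] := p_itv.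
exists (Num.min (Num.min d1 d2) (Num.min p (pi / 2 - p))).
  by rewrite !lt_min d1_gt0 d2_gt0 p0 subr_gt0.
move=> e x s; rewrite !lt_min => /andP[/andP[e1 e2] _] /andP[/andP[x1 x2] /andP[x3 x4]].
have [h1 _] := Hd1 e x x s e1 x1 x1; have [h2 _] := Hd2 e x x s e2 x2 x2.
have E1 : din 0 p s = 1 by rewrite /din mul0r subr0.
have E2 : dout 0 p s = 1 by rewrite /dout mul0r subr0.
rewrite E1 in h1; rewrite E2 in h2.
move: x3 x4; rewrite !ltr_distl subrr (addrC p (pi / 2 - p)) subrK => /andP[x3 _] /andP[_ x4].
by split; [rewrite x3 x4|exact: half_to_two|exact: half_to_two].
Qed.

End StrictDiff.

Lemma sinp_periodic s : sinp (s + pi *+ 2) = sinp s.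
Proof. by rewrite /sinp sinD2pi. Qed.

Lemma sinm_periodic s : sinm (s + pi *+ 2) = sinm s.
Proof. by rewrite /sinm sinD2pi. Qed.

Lemma field_periodic e x s : field_x e x (s + pi *+ 2) = field_x e x s.
Proof.
by rewrite /field_x /thin /thout /din /dout /gr /gi /inx /iny !cosD2pi
  sinp_periodic sinm_periodic.
Qed.

Lemma continuousD1 (f g : R -> R) : continuous f -> continuous g ->
  continuous (fun x => f x + g x).
Proof. by move=> cf cg x; apply: cvgD; [exact: cf|exact: cg]. Qed.

Lemma continuousM1 (f g : R -> R) : continuous f -> continuous g ->
  continuous (fun x => f x * g x).
Proof. by move=> cf cg x; apply: cvgM; [exact: cf|exact: cg]. Qed.

Lemma continuousN1 (f : R -> R) : continuous f -> continuous (fun x => - f x).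
Proof. by move=> cf x; apply: cvgN; exact: cf. Qed.

Lemma continuousV1 (f : R -> R) : continuous f -> (forall x, f x != 0) ->
  continuous (fun x => (f x)^-1).
Proof. by move=> cf f0 x; apply: cvgV; [exact: f0|exact: cf]. Qed.

Lemma continuous_comp1 (f g : R -> R) : continuous f -> continuous g ->
  continuous (fun x => f (g x)).
Proof. by move=> cf cg x; apply: (@continuous_comp _ _ _ g f); [exact: cg|exact: cf]. Qed.

Lemma continuousX1 (f : R -> R) n : continuous f -> continuous (fun x => f x ^+ n).
Proof. exact: (@continuous_comp1 (fun y => y ^+ n) f (@exprn_continuous R n)). Qed.

Lemma continuous_id1 : continuous (fun x : R => x).
Proof. by move=> x; exact: cvg_id. Qed.

Lemma continuous_cst1 (k : R) : continuous (fun _ : R => k).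
Proof. by move=> x; exact: cvg_cst. Qed.

Lemma continuous_max0 (f : R -> R) : continuous f -> continuous (fun x => Num.max (f x) 0).
Proof.
move=> cf x; apply/cvgrPdist_lt => t t0.
apply: filterS (continuous_dist_lt (cf x) t0) => y; apply: le_lt_trans.
have := ler_norm (f x - f y); have := ler_norm (f y - f x).
rewrite (distrC (f y)) ler_norml; move: (`|f x - f y|) (f x) (f y) => D u v.
by have [?|?] := leP u 0; have [?|?] := leP v 0 => *; apply/andP; split; lra.
Qed.

Ltac continuous_tac := lazymatch goal with
  | H : continuous ?f |- continuous ?f => exact: H
  | |- continuous (fun x => x) => exact: continuous_id1
  | |- continuous (fun x => - (@?f x)) => apply: (@continuousN1 f); continuous_tac
  | |- continuous (fun x => @?f x + @?g x) =>
    apply: (@continuousD1 f g); continuous_tac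
  | |- continuous (fun x => @?f x * @?g x) =>
    apply: (@continuousM1 f g); continuous_tac
  | |- continuous (fun x => @?f x ^+ ?n) => apply: (@continuousX1 f n); continuous_tac
  | |- continuous (fun x => cos (@?f x)) =>
    apply: (@continuous_comp1 cos f (@continuous_cos R)); continuous_tac
  | |- continuous (fun x => sin (@?f x)) =>
    apply: (@continuous_comp1 sin f (@continuous_sin R)); continuous_tac
  | _ => exact: continuous_cst1 end.

Lemma continuous_sinp : continuous sinp.
Proof. by apply: continuous_max0; exact: continuous_sin. Qed.

Lemma continuous_sinm : continuous sinm.
Proof. by apply: continuous_max0; apply: continuousN1; exact: continuous_sin. Qed.

Lemma continuous_P1 (f g : R -> R) : continuous f -> continuous g ->
  continuous (fun s => P1 (f s) (g s)).
Proof. by move=> cf cg; rewrite /P1; continuous_tac. Qed.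

Lemma continuous_P2 (f g : R -> R) : continuous f -> continuous g ->
  continuous (fun s => P2 (f s) (g s)).
Proof. by move=> cf cg; rewrite /P2; continuous_tac. Qed.

(* Continuity along an arbitrary path s |-> x s, which covers both the field at a
   fixed x and the field along a solution. *)
Lemma continuous_path (e : R) (x : R -> R) : continuous x ->
  (forall s, 0 < cos (x s)) -> (forall s, 0 < sin (x s)) ->
  (forall s, din e (x s) s != 0) -> (forall s, dout e (x s) s != 0) ->
  continuous (fun s => field_x e (x s) s) /\ continuous (fun s => theta e (x s) s).
Proof.
move=> cx cos0 sin0 din0 dout0.
have cinx : continuous (fun s => inx (x s) s) by rewrite /inx; continuous_tac.
have ciny : continuous (fun s => iny (x s) s) by rewrite /iny; continuous_tac.
have cP1 : continuous (fun s => P1 (inx (x s) s) (iny (x s) s)).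
  exact: continuous_P1.
have cP2 : continuous (fun s => P2 (inx (x s) s) (iny (x s) s)).
  exact: continuous_P2.
have cinv : continuous (fun s => (4 * cos (x s) ^+ 2)^-1).
  apply: continuousV1; first by continuous_tac.
  by move=> s; rewrite mulf_neq0// expf_neq0// gt_eqF.
have cgr : continuous (fun s => gr (x s) s).
  by rewrite /gr; apply: continuousD1; [continuous_tac|apply: continuousM1 => //;
    apply: continuousD1; apply: continuousM1].
have cgi : continuous (fun s => gi (x s) s).
  by rewrite /gi; apply: continuousM1 => //; apply: continuousD1;
    [|apply: continuousN1]; apply: continuousM1.
have ccot : continuous (fun s => cot (x s)).
  rewrite /cot; apply: continuousM1; first by continuous_tac.
  apply: continuousV1; first by continuous_tac.
  by move=> s; rewrite gt_eqF.
have cthin : continuous (fun s => thin e (x s) s).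
  rewrite /thin; apply: continuousM1 => //; apply: continuousV1 => //.
  rewrite /din; apply: continuousD1; first by continuous_tac.
  apply: continuousN1; apply: continuousM1; first by continuous_tac.
  apply: continuousD1 => //; apply: continuousM1 => //; apply: continuousM1 => //.
  exact: continuous_cos.
have cthout : continuous (fun s => thout e (x s) s).
  rewrite /thout; apply: continuousM1; first by continuous_tac.
  apply: continuousV1 => //.
  rewrite /dout; apply: continuousD1; first by continuous_tac.
  apply: continuousN1; apply: continuousM1; first by continuous_tac.
  by apply: continuousM1 => //; continuous_tac.
have cp := continuous_sinp; have cm := continuous_sinm.
split.
  rewrite /field_x; apply: continuousM1; first exact: continuousN1.
  apply: continuousD1; apply: continuousM1 => //; apply: continuousM1 => //.
  exact: continuous_cst1.
by rewrite /theta; apply: continuousD1; apply: continuousM1.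
Qed.

End AnnulusCoordinates.

(** * Derivatives of multiples and constants *)

Section Scaling.
Context {R : realType}.

Lemma deriveZ1 (c : R) (f : R -> R) (x a : R) : is_derive x 1 f a ->
  is_derive x 1 (fun t => c * f t) (c * a).
Proof.
move=> fa; apply: (is_derive_eq (deriveM1 (is_derive_cst c x 1) fa)).
by rewrite mul0r add0r.
Qed.

Lemma derive_cst1 (c x : R) : is_derive x 1 (fun=> c) 0.
Proof. exact: is_derive_cst. Qed.

End Scaling.

(** * The scalar equation against the planar field, and its mean *)

Section SolutionCurves.
Context {R : realType}.
Variables a c0 c2 c3 c4 : R.
Implicit Types e x s u v : R.
Local Notation P1 := (P1 c0 c2 c3 c4).
Local Notation P2 := (P2 c2 c3 c4).
Local Notation gr := (gr a c0 c2 c3 c4).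
Local Notation gi := (gi c0 c2 c3 c4).
Local Notation din := (din a c0 c2 c3 c4).
Local Notation dout := (dout a).
Local Notation thin := (thin a c0 c2 c3 c4).
Local Notation thout := (thout a).
Local Notation theta := (theta a c0 c2 c3 c4).
Local Notation field_x := (field_x a c0 c2 c3 c4).
Local Notation in1 := (in1 a c0 c2 c3 c4).
Local Notation in2 := (in2 a c2 c3 c4).
Local Notation out1 := (out1 a).
Local Notation out2 := (out2 a).

Local Notation gr_primitive := (gr_primitive c0 c2 c3 c4).
Local Notation melnikov := (melnikov a c0 c2 c3 c4).

Lemma in_norm x s : inx x s ^+ 2 + iny x s ^+ 2 = 4 * cos x ^+ 2.
Proof.
rewrite /inx /iny !sqrrN !exprMn -mulrDr cos2Dsin2; ring.
Qed.

Lemma out_norm x s : outx x s ^+ 2 + outy x s ^+ 2 = 4 * cos x ^+ 2.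
Proof. by rewrite /outx /outy sqrrN !exprMn -mulrDr cos2Dsin2; ring. Qed.

Lemma derive_gr_primitive x u : is_derive u 1 (gr_primitive x)
  (- (c0 * (2 * cos x)^-1 + c2 * (2 * cos x)) * cos u +
   (c3 * (2 * cos x) ^+ 2 * (cos u ^+ 2 - sin u ^+ 2) -
    c4 * (2 * cos x) ^+ 3 * (cos u - 4 * (sin u ^+ 2 * cos u)))).
Proof.
rewrite /gr_primitive.
pose ds := is_derive_sin u; pose dc := is_derive_cos u.
apply: (is_derive_eq (deriveD1 (deriveZ1 _ ds) (deriveB1 (deriveZ1 _ (deriveM1 ds dc))
  (deriveZ1 _ (deriveB1 ds (deriveZ1 _ (deriveM1 (deriveM1 ds ds) ds))))))).
by move: ((2 * cos x)^-1) => D; field.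
Qed.

(** The added term is the real part of [c0 / w + c2 w + c3 w^2 + c4 w^3] at [w = - 2 cos x e^(i u)]
    with [u = x cos s]. *)
Lemma gr_alt x s : cos x != 0 -> gr x s = a +
  (- (c0 * (2 * cos x)^-1 + c2 * (2 * cos x)) * cos (x * cos s) +
   (c3 * (2 * cos x) ^+ 2 * (cos (x * cos s) ^+ 2 - sin (x * cos s) ^+ 2) -
    c4 * (2 * cos x) ^+ 3 *
      (cos (x * cos s) - 4 * (sin (x * cos s) ^+ 2 * cos (x * cos s))))).
Proof.
move=> C0; rewrite /gr; congr (_ + _).
have N := in_norm x s; set X := inx x s in N *; set Y := iny x s in N *.
have -> : X * P1 X Y + Y * P2 X Y = c0 * X + (X ^+ 2 + Y ^+ 2) *
    (c2 * X + c3 * (X ^+ 2 - Y ^+ 2) + c4 * X * (X ^+ 2 - 3 * Y ^+ 2)).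
  by rewrite /P1 /P2; ring.
have -> : X ^+ 2 - 3 * Y ^+ 2 = 4 * cos x ^+ 2 * (1 - 4 * sin (x * cos s) ^+ 2).
  rewrite /X /Y /inx /iny !sqrrN !exprMn.
  have -> : sin (x * cos s) ^+ 2 = 1 - cos (x * cos s) ^+ 2.
    by rewrite -(cos2Dsin2 (x * cos s)); ring.
  by ring.
by rewrite N /X /Y /inx /iny; field.
Qed.

(** At [e = 0] the factor [sin s] is the derivative of [- cos s], so each half period is an integral
    over the angle of an arc, with an explicit primitive; [gr_primitive] is odd in the angle. *)
Lemma field_mean x (Q : R -> R) : 0 < x < pi / 2 ->
  (forall s, is_derive s 1 Q (field_x 0 x s)) ->
  Q (pi *+ 2) - Q 0 = melnikov x.
Proof.
move=> /andP[x0 xpi] dQ.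
have C0 : 0 < cos x by apply: cos_gt0_pihalf; rewrite xpi (lt_trans _ x0)// oppr_lt0 divr_gt0 ?pi_gt0.
have in0 s : thin 0 x s = x by rewrite /thin /din mul0r subr0 invr1 mulr1.
have out0 s : thout 0 x s = pi - x by rewrite /thout /dout mul0r subr0 invr1 mulr1.
pose du s : is_derive s 1 (fun s => x * cos s) (x * - sin s) :=
  deriveZ1 x (is_derive_cos s).
pose q1 s := cot x * (a * (x * cos s) + gr_primitive x (x * cos s)).
have E1 : Q pi - Q 0 = q1 pi - q1 0.
  apply: (eq_increment (pi_ge0 R) dQ (fun s => deriveZ1 (cot x) (deriveD1
    (deriveZ1 a (du s)) (derive_comp1 (derive_gr_primitive x _) (du s))))).
  move=> s s_itv; rewrite /field_x in0 /sinp /sinm.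
  have ss : 0 < sin s by exact: sin_gt0_pi.
  rewrite max_l ?(ltW ss)// max_r ?oppr_le0 ?(ltW ss)// gr_alt ?gt_eqF//.
  by ring.
pose q2 s := - (cot x * (pi - x) * a) * cos s.
have E2 : Q (pi *+ 2) - Q pi = q2 (pi *+ 2) - q2 pi.
  have le2 : (pi : R) <= pi *+ 2 by rewrite mulr2n lerDl pi_ge0.
  apply: (eq_increment le2 dQ (fun s => deriveZ1 _ (is_derive_cos s))).
  move=> s /andP[s1 s2]; rewrite /field_x out0 /sinp /sinm.
  have ss : sin s < 0.
    have : 0 < sin (s - pi).
      by apply: sin_gt0_pi; rewrite subr_gt0 s1 ltrBlDr -mulr2n.
    by rewrite -[in X in _ -> X](subrK pi s) sinDpi oppr_lt0.
  by rewrite max_r ?(ltW ss)// max_l ?oppr_ge0 ?(ltW ss)//; ring.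
have -> : Q (pi *+ 2) - Q 0 = (Q (pi *+ 2) - Q pi) + (Q pi - Q 0) by ring.
rewrite E1 E2 /q1 /q2 cos2pi cospi cos0 !mulrN1 !mulr1.
have -> : gr_primitive x (- x) = - gr_primitive x x.
  by rewrite /gr_primitive sinN cosN; ring.
by rewrite /melnikov; ring.
Qed.

Section CurveDerivative.
Variables (e s : R) (x : R -> R).
Hypotheses (x_itv : 0 < x s < pi / 2) (dx : is_derive s 1 x (e * field_x e (x s) s)).

Let cos0 : cos (x s) != 0.
Proof.
have /andP[? ?] := x_itv; rewrite gt_eqF// cos_gt0_pihalf// (lt_trans _ (_ : 0 < x s))//.
by rewrite oppr_lt0 divr_gt0 ?pi_gt0.
Qed.

Let sin0 : sin (x s) != 0. Proof. by rewrite gt_eqF// sin_gt0_pihalf. Qed.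

Lemma derive_in : 0 < sin s -> din e (x s) s != 0 ->
  is_derive s 1 (fun t => inx (x t) t)
    (theta e (x s) s * in1 e (inx (x s) s) (iny (x s) s)) /\
  is_derive s 1 (fun t => iny (x t) t)
    (theta e (x s) s * in2 e (inx (x s) s) (iny (x s) s)).
Proof.
move=> ss d0.
have sp : sinp s = sin s by rewrite /sinp max_l// ltW.
have sm : sinm s = 0 by rewrite /sinm max_r// oppr_le0 ltW.
pose th := theta e (x s) s.
have thE : th = sin s * (x s * (din e (x s) s)^-1).
  by rewrite /th /theta sp sm mul0r addr0.
have xE : e * field_x e (x s) s = - (th * e * cot (x s) * gr (x s) s).
  by rewrite /field_x sp sm thE /thin; ring.
have dx' := dx; rewrite xE in dx'.
have N := in_norm (x s) s.
set X := inx (x s) s in N *; set Y := iny (x s) s in N *.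
have Np : 4 * cos (x s) ^+ 2 != 0 by rewrite mulf_neq0// expf_neq0.
(* With [r2], the components of [w (gr + i gi) = a w + P(w)]. *)
have r1 : X * gr (x s) s - Y * gi (x s) s = a * X + P1 X Y.
  rewrite /gr /gi -/X -/Y -N; field.
  by rewrite N.
have r2 : Y * gr (x s) s + X * gi (x s) s = a * Y + P2 X Y.
  rewrite /gr /gi -/X -/Y -N; field.
  by rewrite N.
(* The term [cos s * cot x * gr] of [din] cancels the contribution of x' to the derivative of the
   angle. *)
have uE : - (th * e * cot (x s) * gr (x s) s) * cos s + x s * - sin s =
    - (th * (1 - e * gi (x s) s)).
  rewrite (_ : x s * - sin s = - (th * din e (x s) s)); last first.
    by rewrite thE; field.
  by rewrite /din; ring.
have du : is_derive s 1 (fun t => x t * cos t) (- (th * (1 - e * gi (x s) s))).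
  by apply: (is_derive_eq (deriveM1 dx' (is_derive_cos s))).
have dcos : is_derive s 1 (fun t => 2 * cos (x t))
    (2 * (th * e * cos (x s) * gr (x s) s)).
  apply: (is_derive_eq (deriveZ1 2 (derive_comp1 (is_derive_cos (x s)) dx'))).
  by rewrite /cot; field.
split.
  apply: (is_derive_eq (deriveN1 (deriveM1 dcos (derive_comp1 (is_derive_cos _) du)))).
  rewrite /in1 -/th -r1 /X /Y /inx /iny; ring.
apply: (is_derive_eq (deriveN1 (deriveM1 dcos (derive_comp1 (is_derive_sin _) du)))).
by rewrite /in2 -/th -r2 /X /Y /inx /iny; ring.
Qed.

Lemma derive_out : sin s < 0 -> dout e (x s) s != 0 ->
  is_derive s 1 (fun t => outx (x t) t)
    (theta e (x s) s * out1 e (outx (x s) s) (outy (x s) s)) /\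
  is_derive s 1 (fun t => outy (x t) t)
    (theta e (x s) s * out2 e (outx (x s) s) (outy (x s) s)).
Proof.
move=> ss d0.
have sp : sinp s = 0 by rewrite /sinp max_r// ltW.
have sm : sinm s = - sin s by rewrite /sinm max_l// oppr_ge0 ltW.
pose th := theta e (x s) s.
have thE : th = - sin s * ((pi - x s) * (dout e (x s) s)^-1).
  by rewrite /th /theta sp sm mul0r add0r.
have xE : e * field_x e (x s) s = - (th * e * cot (x s) * a).
  by rewrite /field_x sp sm thE /thout; ring.
have dx' := dx; rewrite xE in dx'.
have dv : is_derive s 1 (fun t => (pi - x t) * cos t) th.
  apply: (is_derive_eq (deriveM1 (deriveB1 (derive_cst1 pi s) dx') (is_derive_cos s))).
  rewrite (_ : (pi - x s) * - sin s = th * dout e (x s) s); last first.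
    by rewrite thE; field.
  by rewrite /dout; ring.
have dcos : is_derive s 1 (fun t => 2 * cos (x t)) (2 * (th * e * cos (x s) * a)).
  apply: (is_derive_eq (deriveZ1 2 (derive_comp1 (is_derive_cos (x s)) dx'))).
  by rewrite /cot; field.
split.
  apply: (is_derive_eq (deriveM1 dcos (derive_comp1 (is_derive_cos _) dv))).
  by rewrite /out1 -/th /outx /outy; ring.
apply: (is_derive_eq (deriveN1 (deriveM1 dcos (derive_comp1 (is_derive_sin _) dv)))).
by rewrite /out2 -/th /outx /outy; ring.
Qed.

End CurveDerivative.

End SolutionCurves.

(** * Coefficients with five simple zeros *)

Section SimpleZeros.
Context {R : realType}.
Implicit Types x p A B : R.

(** [K0] and [cc0] come from the extreme coefficients of the factored polynomial in [tan x]: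
    [1 * 7 * 2 * 17 * 11 * 261] and [5 * 4 * 1 * 6 * 3 * 209]. The division by [2 pi] in [ca]
    removes [pi] from the Melnikov function; the other constants match the remaining odd powers. *)
Let K0 : R := 14 * 187 * 261.
Definition ca : R := K0 / (2 * pi).
Definition cc0 : R := 360 * 209.
Definition cc2 : R := 325 * 41 * 137 / 4.
Definition cc3 : R := 75 * 169 * 173 / 8.
Definition cc4 : R := 1875 * 13 ^+ 3 / 16.

Local Notation m := (melnikov ca cc0 cc2 cc3 cc4).

(** Vanishes where [tan x = B / A]. The remaining factor [quad] has positive coefficients, hence no
    zero on (0, pi/2). *)
Let lin A B x := A * sin x - B * cos x.
Let quad x := 209 * (sin x * sin x) + 286 * (sin x * cos x) + 261 * (cos x * cos x).

(* With t = tan x, the numerator of the Melnikov function is the polynomial of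
   degree 7 in t whose even part is a multiple of (1 + t^2)^3 and whose odd part is
   arbitrary; the coefficients were chosen so that it has five rational roots. *)
Lemma melnikovE x : 0 < x < pi / 2 ->
  m x = lin 5 1 x * lin 4 7 x * lin 1 2 x * lin 6 17 x * lin 3 11 x * quad x * (sin x)^-1.
Proof.
move=> x_itv; have /andP[x0 xpi] := x_itv.
have C0 : cos x != 0.
  rewrite gt_eqF// cos_gt0_pihalf// xpi (lt_trans _ x0)//.
  by rewrite oppr_lt0 divr_gt0 ?pi_gt0.
have S0 : sin x != 0 by rewrite gt_eqF// sin_gt0_pihalf.
have P0 : pi != 0 :> R by rewrite gt_eqF// pi_gt0.
have E : cos x ^+ 2 + sin x ^+ 2 = 1 := cos2Dsin2 x.
rewrite /melnikov /gr_primitive /cot /ca /lin /quad.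
set S := sin x in E S0 *; set C := cos x in E C0 *.
set k := C ^+ 2 + S ^+ 2 in E.
(* Powers of [k = 1] make every term homogeneous of degree 7, so that the factorization becomes a
   polynomial identity in [S] and [C]. *)
transitivity ((- (K0 * C * k ^+ 3) + cc0 * S * k ^+ 3 + 4 * cc2 * C ^+ 2 * S * k ^+ 2
  - 8 * cc3 * C ^+ 4 * S * k + 16 * cc4 * C ^+ 4 * (S * k - 4 / 3 * S ^+ 3)) * S^-1).
  have -> : 2 * (K0 / (2 * pi) * pi) = K0.
    by move: (pi : R) P0 K0 => q q0 k0; field; rewrite q0.
  rewrite E; move: K0 cc0 cc2 cc3 cc4 => k0 k1 k2 k3 k4.
  by field; rewrite C0 S0.
congr (_ * _); rewrite /k /K0 /cc0 /cc2 /cc3 /cc4; by field.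
Qed.

(** With the vanishing factor split off, the derivative at the zero is that of this factor times the
    value of the rest, and both are nonzero. *)
Lemma simple_zero A B A1 B1 A2 B2 A3 B3 A4 B4 (t : R) :
  0 < A -> 0 < t -> A * t = B ->
  A1 * t != B1 -> A2 * t != B2 -> A3 * t != B3 -> A4 * t != B4 ->
  (forall x, 0 < x < pi / 2 -> m x = lin A B x *
    (lin A1 B1 x * lin A2 B2 x * lin A3 B3 x * lin A4 B4 x * quad x * (sin x)^-1)) ->
  let p := atan t in [/\ 0 < p < pi / 2, m p = 0 &
    exists2 m' : R, m' != 0 & is_derive p 1 m m'].
Proof.
move=> A0 t0 AtB n1 n2 n3 n4 mE p.
have p_itv : 0 < p < pi / 2.
  by rewrite atan_ltpi2 andbT -atan0; apply: lt_atan.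
have C0 : 0 < cos p.
  have /andP[p0 ppi] := p_itv.
  by rewrite cos_gt0_pihalf// ppi (lt_trans _ p0)// oppr_lt0 divr_gt0 ?pi_gt0.
have S0 : 0 < sin p by exact: sin_gt0_pihalf.
have St : sin p = t * cos p.
  have : tan p = t by exact: atanK.
  by rewrite /tan => <-; rewrite divfK// gt_eqF.
have linp A' B' : lin A' B' p = (A' * t - B') * cos p by rewrite /lin St; ring.
pose W x := lin A1 B1 x * lin A2 B2 x * lin A3 B3 x * lin A4 B4 x * quad x * (sin x)^-1.
have Wp : W p != 0.
  have f A' B' : A' * t != B' -> (A' * t - B') * cos p != 0.
    by move=> h; rewrite mulf_neq0 ?subr_eq0// (gt_eqF C0).
  have q0 : quad p != 0.
    have n k : 0 < k.+1%:R :> R := ltr0Sn _ _.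
    rewrite gt_eqF//; exact: (addr_gt0 (addr_gt0 (mulr_gt0 (n _) (mulr_gt0 S0 S0))
      (mulr_gt0 (n _) (mulr_gt0 S0 C0))) (mulr_gt0 (n _) (mulr_gt0 C0 C0))).
  rewrite /W !linp mulf_neq0 ?invr_eq0 ?(gt_eqF S0)//.
  exact: (mulf_neq0 (mulf_neq0 (mulf_neq0 (mulf_neq0 (f _ _ n1) (f _ _ n2))
    (f _ _ n3)) (f _ _ n4)) q0).
have dl A' B' : is_derive p 1 (lin A' B') (A' * cos p - B' * - sin p).
  exact: (deriveB1 (deriveZ1 _ (is_derive_sin p)) (deriveZ1 _ (is_derive_cos p))).
have [w0 dquad] : exists w0 : R, is_derive p 1 quad w0.
  by eexists; exact: (deriveD1 (deriveD1
    (deriveZ1 209 (deriveM1 (is_derive_sin p) (is_derive_sin p)))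
    (deriveZ1 286 (deriveM1 (is_derive_sin p) (is_derive_cos p))))
    (deriveZ1 261 (deriveM1 (is_derive_cos p) (is_derive_cos p)))).
have dV : is_derive p 1 (fun x => (sin x)^-1) (- cos p / sin p ^+ 2).
  by apply: deriveV1; rewrite gt_eqF.
have dW := deriveM1 (deriveM1 (deriveM1 (deriveM1 (deriveM1 (dl A1 B1) (dl A2 B2))
  (dl A3 B3)) (dl A4 B4)) dquad) dV.
have lp : lin A B p = 0 by rewrite linp AtB subrr mul0r.
split => //; first by rewrite mE// lp mul0r.
exists ((A * cos p - B * - sin p) * W p).
  rewrite mulf_neq0// gt_eqF// mulrN opprK addr_gt0 ?mulr_gt0//.
  by rewrite -AtB mulr_gt0.
apply: (@derivable_eq_near _ (fun x => lin A B x * W x)); last first.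
  by apply: (is_derive_eq (deriveM1 (dl A B) dW)); rewrite lp mul0r addr0.
have := @near_in_itvoo R 0 (pi / 2) p; rewrite in_itv/= => /(_ p_itv).
by apply: filterS => y; rewrite in_itv/= => y_itv; rewrite mE.
Qed.

Definition root (k : 'I_5) : R := nth 0 [:: 1 / 5; 7 / 4; 2; 17 / 6; 11 / 3] k.

Lemma melnikov_simple_zero (k : 'I_5) : let p := atan (root k) in
  [/\ 0 < p < pi / 2, m p = 0 & exists2 m' : R, m' != 0 & is_derive p 1 m m'].
Proof.
case: k => -[|[|[|[|[|//]]]]] ?; rewrite /root /=.
- apply: (@simple_zero 5 1 4 7 1 2 6 17 3 11); rewrite ?neq_lt; try lra.
  by move=> x /melnikovE ->; ring.
- apply: (@simple_zero 4 7 5 1 1 2 6 17 3 11); rewrite ?neq_lt; try lra.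
  by move=> x /melnikovE ->; ring.
- apply: (@simple_zero 1 2 5 1 4 7 6 17 3 11); rewrite ?neq_lt; try lra.
  by move=> x /melnikovE ->; ring.
- apply: (@simple_zero 6 17 5 1 4 7 1 2 3 11); rewrite ?neq_lt; try lra.
  by move=> x /melnikovE ->; ring.
- apply: (@simple_zero 3 11 5 1 4 7 1 2 6 17); rewrite ?neq_lt; try lra.
  by move=> x /melnikovE ->; ring.
Qed.

End SimpleZeros.

(** * The coordinates and the sides of the circle *)

Section Regions.
Context {R : realType}.
Implicit Types x y s t u v c : R.

(* |w + 1|^2 - 1 for w = u + i v. *)
Definition rho u v : R := u ^+ 2 + v ^+ 2 + 2 * u.

Lemma cos_norm_le x y : `|x| <= `|y| -> `|y| <= pi -> cos y <= cos x.
Proof.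
have cosn z : cos `|z| = cos z :> R.
  by have [/ger0_norm->|/ltr0_norm->] := leP 0 z; rewrite ?cosN.
rewrite -(cosn x) -(cosn y); move: `|x| `|y| (normr_ge0 x) (normr_ge0 y).
move=> a b a0 b0; rewrite le_eqVlt => /predU1P[->//|ab] bpi; apply: ltW.
by rewrite ltr_cos// in_itv/= ?a0 ?b0//= (le_trans (ltW ab)).
Qed.

Lemma cos_norm_lt x y : `|x| < `|y| -> `|y| <= pi -> cos y < cos x.
Proof.
have cosn z : cos `|z| = cos z :> R.
  by have [/ger0_norm->|/ltr0_norm->] := leP 0 z; rewrite ?cosN.
rewrite -(cosn x) -(cosn y); move: `|x| `|y| (normr_ge0 x) (normr_ge0 y).
move=> a b a0 b0 ab bpi.
by rewrite ltr_cos// in_itv/= ?a0 ?b0//= (le_trans (ltW ab)).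
Qed.

Lemma cos_scale_lt y c : 0 < y <= pi -> `|c| < 1 -> cos y < cos (y * c).
Proof.
move=> /andP[y0 ypi] c1; apply: cos_norm_lt; rewrite ?(gtr0_norm y0)//.
by rewrite normrM gtr0_norm// gtr_pMr.
Qed.

Lemma cos_lt1_norm s : sin s != 0 -> `|cos s| < 1.
Proof.
move=> s0; rewrite -(ltr_sqr _ _)// ?nnegrE// real_normK ?num_real// expr1n.
by rewrite -(cos2Dsin2 s) ltrDl exprn_even_gt0.
Qed.

Lemma cos_gt0_itv x : 0 < x < pi / 2 -> 0 < cos x :> R.
Proof.
move=> /andP[x0 xpi]; rewrite cos_gt0_pihalf// xpi (lt_trans _ x0)//.
by rewrite oppr_lt0 divr_gt0 ?pi_gt0.
Qed.

Lemma sin_gt0_itv x : 0 < x < pi / 2 -> 0 < sin x :> R.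
Proof. exact: sin_gt0_pihalf. Qed.

Lemma itv_lt_pi x : 0 < x < pi / 2 -> x < pi.
Proof.
by move=> /andP[_ /lt_trans]; apply; rewrite ltr_pdivrMr// ltr_pMr ?pi_gt0// ltr1n.
Qed.

(** On [|w| = 2 cos x] the value is [4 cos x (cos x - cos (x cos s))], and [|cos s| < 1] off the
    crossings. *)
Lemma rho_in x s : 0 < x < pi / 2 -> 0 < sin s -> rho (inx x s) (iny x s) < 0.
Proof.
move=> x_itv s0; have C0 := cos_gt0_itv x_itv; have /andP[x0 _] := x_itv.
have := @cos_scale_lt x (cos s).
rewrite x0 (ltW (itv_lt_pi x_itv)) cos_lt1_norm ?gt_eqF// => /(_ isT isT) h.
rewrite /rho in_norm /inx.
rewrite (_ : _ + _ = 4 * cos x * (cos x - cos (x * cos s))); last by ring.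
by rewrite pmulr_rlt0 ?subr_lt0// mulr_gt0.
Qed.

Lemma rho_out x s : 0 < x < pi / 2 -> sin s < 0 -> 0 < rho (outx x s) (outy x s).
Proof.
move=> x_itv s0; have C0 := cos_gt0_itv x_itv; have /andP[x0 _] := x_itv.
have := @cos_scale_lt (pi - x) (cos s).
rewrite subr_gt0 (itv_lt_pi x_itv) gerBl (ltW x0) cos_lt1_norm ?lt_eqF// => /(_ isT isT) h.
have cpi : cos (pi - x) = - cos x by rewrite addrC cosDpi cosN.
rewrite cpi in h.
rewrite /rho out_norm /outx.
rewrite (_ : _ + _ = 4 * cos x * (cos x + cos ((pi - x) * cos s))); last by ring.
by rewrite pmulr_rgt0 ?mulr_gt0// addrC -ltrBlDr sub0r.
Qed.

Lemma cos_pm1 s : sin s = 0 -> cos s = 1 \/ cos s = -1.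
Proof.
move=> s0; have := cos2Dsin2 s; rewrite s0 expr0n addr0 => /eqP.
by rewrite sqrf_eq1 => /orP[] /eqP; [left|right].
Qed.

(** At [cos s = 1] and [cos s = -1] the angles of the two arcs agree modulo [2 pi]: the arcs
    join. *)
Lemma out_in_boundary x s : sin s = 0 -> outx x s = inx x s /\ outy x s = iny x s.
Proof.
move=> /cos_pm1[] E; rewrite /outx /outy /inx /iny E ?mulr1 ?mulrN1.
  rewrite (addrC pi) cosDpi sinDpi cosN sinN; split; ring.
by rewrite !cosN !sinN (addrC pi) cosDpi sinDpi cosN sinN; split; ring.
Qed.

Lemma rho_boundary x s : sin s = 0 -> rho (inx x s) (iny x s) = 0.
Proof.
move=> /cos_pm1[] E; rewrite /rho in_norm /inx E ?mulr1 ?mulrN1 ?cosN; ring.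
Qed.

Lemma w_norm x s : wx x s ^+ 2 + wy x s ^+ 2 = 4 * cos x ^+ 2.
Proof. by rewrite /wx /wy; case: ifP; rewrite ?in_norm ?out_norm. Qed.

Lemma w_annulus x s : 0 < x < pi / 2 -> 0 < wx x s ^+ 2 + wy x s ^+ 2 < 4.
Proof.
move=> xi; rewrite w_norm; have C0 := cos_gt0_itv xi; have S0 := sin_gt0_itv xi.
rewrite mulr_gt0 ?exprn_gt0//=.
have := cos2Dsin2 x; have : 0 < sin x ^+ 2 by rewrite exprn_gt0.
by lra.
Qed.

Lemma wx_in x s : 0 <= sin s -> wx x s = inx x s /\ wy x s = iny x s.
Proof. by rewrite /wx /wy => ->. Qed.

Lemma wx_out x s : sin s <= 0 -> wx x s = outx x s /\ wy x s = outy x s.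
Proof.
rewrite le_eqVlt => /predU1P[s0|s0]; last by rewrite /wx /wy leNgt s0.
have [-> ->] := out_in_boundary x s0; by rewrite /wx /wy s0 lexx.
Qed.

Lemma rho_lt0 x s : 0 < x < pi / 2 -> rho (wx x s) (wy x s) < 0 -> 0 < sin s.
Proof.
move=> x_itv; rewrite ltNge => h; rewrite ltNge; apply: contraNN h => s0.
have [-> ->] := wx_out x s0; move: s0; rewrite le_eqVlt => /predU1P[s0|s0].
  by have [-> ->] := out_in_boundary x s0; rewrite rho_boundary.
exact/ltW/rho_out.
Qed.

Lemma rho_gt0 x s : 0 < x < pi / 2 -> 0 < rho (wx x s) (wy x s) -> sin s < 0.
Proof.
move=> x_itv; rewrite ltNge => h; rewrite ltNge; apply: contraNN h => s0.
have [-> ->] := wx_in x s0; move: s0; rewrite le_eqVlt => /predU1P[/esym s0|s0].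
  by rewrite rho_boundary.
exact/ltW/rho_in.
Qed.

Lemma rho_eq0 x s : 0 < x < pi / 2 -> rho (wx x s) (wy x s) = 0 -> sin s = 0.
Proof.
move=> x_itv h; apply/eqP; rewrite eq_le; apply/andP; split.
  rewrite leNgt; apply/negP => s0; have [E1 E2] := wx_in x (ltW s0).
  by have := rho_in x_itv s0; rewrite -E1 -E2 h ltxx.
rewrite leNgt; apply/negP => s0; have [E1 E2] := wx_out x (ltW s0).
by have := rho_out x_itv s0; rewrite -E1 -E2 h ltxx.
Qed.

(** The clockwise motion leaves the disc at the upper crossing, where [cos s = -1], and enters it at
    the lower one. *)
Lemma wy_boundary x s : 0 < x < pi / 2 -> sin s = 0 ->
  (0 < wy x s -> cos s = -1) /\ (wy x s < 0 -> cos s = 1).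
Proof.
move=> x_itv s0; have C0 := cos_gt0_itv x_itv; have S0 := sin_gt0_itv x_itv.
have [_ ->] : wx x s = inx x s /\ wy x s = iny x s by apply: wx_in; rewrite s0.
have P : 0 < 2 * cos x * sin x by rewrite !mulr_gt0.
rewrite /iny; have [E|E] := cos_pm1 s0; rewrite E ?mulr1 ?mulrN1 ?sinN ?mulrN ?opprK.
  by split=> //; rewrite oppr_gt0 ltNge ltW.
by split=> //; rewrite ltNge ltW.
Qed.

End Regions.

(** * Surjectivity and injectivity of the coordinates *)

Section PolarCoordinates.
Context {R : realType}.
Implicit Types x y s t u v r A B : R.

(** The last hypothesis bounds the angle of [u + i v] by [y] in absolute value, so it is [y * cos s]
    for some [s] in [0, pi]. *)
Lemma polar_exists r y u v : 0 < r -> 0 < y <= pi -> u ^+ 2 + v ^+ 2 = r ^+ 2 ->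
  r * cos y <= u ->
  exists s, [/\ 0 <= sin s, r * cos (y * cos s) = u & r * sin (y * cos s) = v].
Proof.
move=> r0 /andP[y0 ypi] uv ur.
have r0' : r != 0 by rewrite gt_eqF.
have u1 : -1 <= u / r <= 1.
  rewrite -ler_norml -(ler_pXn2r (n := 2))// ?nnegrE// real_normK ?num_real//.
  rewrite expr1n expr_div_n ler_pdivrMr ?exprn_gt0// mul1r -uv lerDl.
  exact: sqr_ge0.
pose f := acos (u / r).
have f_itv : f \in `[0, pi] by rewrite in_itv/= acos_ge0//= acos_lepi.
have cf : cos f = u / r by rewrite acosK.
have f0 : 0 <= f by rewrite acos_ge0.
have fy : f <= y.
  rewrite leNgt; apply/negP => yf.
  have : cos f < cos y.
    by rewrite ltr_cos// in_itv/= ?(ltW y0)//= ?acos_lepi// (le_trans (ltW y0))// ltW.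
  by rewrite cf ltNge ler_pdivlMr// mulrC ur.
have sf : r * sin f = `|v|.
  rewrite /f sin_acos// -[LHS]ger0_norm ?mulr_ge0 ?sqrtr_ge0 ?(ltW r0)//.
  apply/eqP; rewrite -(eqrXn2 (n := 2))// ?mulr_ge0 ?sqrtr_ge0 ?(ltW r0)//.
  rewrite !real_normK ?num_real// exprMn sqr_sqrtr.
    by rewrite expr_div_n mulrBr mulr1 mulrC divfK ?sqrf_eq0// -uv addrAC subrr add0r.
  by have /andP[h1 h2] := u1; nra.
pose c := (if 0 <= v then f else - f) / y.
have yc : y * c = (if 0 <= v then f else - f) by rewrite /c mulrC divfK// gt_eqF.
have c1 : -1 <= c <= 1.
  by rewrite -ler_norml /c normrM (gtr0_norm (_ : 0 < y^-1)) ?invr_gt0// ler_pdivrMr// mul1r;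
   case: ifP; rewrite ?normrN ger0_norm.
exists (acos c); rewrite acosK// yc; split.
- by rewrite sin_acos// sqrtr_ge0.
- by case: ifP; rewrite ?cosN cf mulrC divfK.
- by case: ifPn => [/ger0_norm <-//|]; rewrite -ltNge => /ltr0_norm v0; rewrite sinN mulrN sf v0 opprK.
Qed.

Lemma cos_sin_inj A B : `|A| < pi -> `|B| < pi -> cos A = cos B -> sin A = sin B -> A = B.
Proof.
move=> A1 B1 cAB sAB.
have AB : `|A| = `|B|.
  have [h|h|//] := ltgtP `|A| `|B|.
    by have := cos_norm_lt h (ltW B1); rewrite cAB ltxx.
  by have := cos_norm_lt h (ltW A1); rewrite cAB ltxx.
have [//|AN] : A = B \/ A = - B.
  by move/eqP: AB; rewrite eqr_norm2 => /orP[]/eqP; tauto.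
move: sAB; rewrite AN sinN => /eqP; rewrite -subr_eq0 -opprD oppr_eq0 -mulr2n.
rewrite mulrn_eq0/= => /eqP s0.
have [->|B0] := eqVneq B 0; first by rewrite oppr0.
have Bpi : 0 < `|B| < pi by rewrite normr_gt0 B0.
have := sin_gt0_pi Bpi.
by have [/ger0_norm->|/ltr0_norm->] := leP 0 B; rewrite ?sinN s0 ?oppr0 ltxx.
Qed.

Lemma w_surj u v : 0 < u ^+ 2 + v ^+ 2 < 4 ->
  exists x s, [/\ 0 < x < pi / 2, wx x s = u & wy x s = v].
Proof.
move=> /andP[r0 r4]; set q := u ^+ 2 + v ^+ 2 in r0 r4 *; pose r : R := Num.sqrt q.
have rr : r ^+ 2 = q by rewrite sqr_sqrtr// ltW.
have rp : 0 < r by rewrite sqrtr_gt0.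
have r2 : r < 2 by rewrite -(ltr_pXn2r (n := 2)) ?nnegrE ?ltW// rr; apply: (lt_le_trans r4); lra.
have cx : cos (acos (r / 2)) = r / 2 by rewrite acosK// in_itv/=; apply/andP; split; lra.
pose x := acos (r / 2); have x0 : 0 < x by apply: acos_gt0; apply/andP; split; lra.
have xpi : x < pi / 2.
  have xle : x <= pi by apply: acos_lepi; apply/andP; split; lra.
  rewrite ltNge; apply/negP => h.
  have : cos x <= cos (pi / 2).
    apply: cos_norm_le; rewrite !ger0_norm ?divr_ge0 ?pi_ge0//; exact: ltW.
  rewrite cx cos_pihalf; lra.
exists x; have x_itv : 0 < x < pi / 2 by rewrite x0.
have xpi' := itv_lt_pi x_itv.
have [h|h] := leP (rho u v) 0.
  have [s [s0 E1 E2]] : exists s, [/\ 0 <= sin s, r * cos (x * cos s) = - u & r * sin (x * cos s) = - v].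
    apply: polar_exists; rewrite ?x0 ?(ltW xpi')//; first by rewrite !sqrrN rr.
    rewrite cx; move: h; rewrite /rho -/q -rr; lra.
  exists s; have [Ex Ey] := wx_in x s0.
  by split=> //; rewrite ?Ex ?Ey ?/inx ?/iny cx (mulrC 2) divfK// ?E1 ?E2 opprK.
have [s [s0 E1 E2]] : exists s, [/\ 0 <= sin s, r * cos ((pi - x) * cos s) = u & r * sin ((pi - x) * cos s) = - v].
  apply: polar_exists; rewrite ?subr_gt0 ?gerBl ?xpi' ?(ltW x0)//; first by rewrite sqrrN rr.
  rewrite addrC cosDpi cosN cx; move: h; rewrite /rho -/q -rr; lra.
exists (- s); have [Ex Ey] : wx x (- s) = outx x (- s) /\ wy x (- s) = outy x (- s).
  by apply: wx_out; rewrite sinN oppr_le0.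
split=> //; rewrite ?Ex ?Ey /outx /outy cosN cx (mulrC 2) divfK// ?E1//.
by rewrite E2 opprK.
Qed.

Lemma w_modulus_inj x y s t : 0 < x < pi / 2 -> 0 < y < pi / 2 ->
  wx x s = wx y t -> wy x s = wy y t -> x = y.
Proof.
move=> xi yi Ex Ey; have := w_norm x s; rewrite Ex Ey w_norm => /eqP.
have Cx := cos_gt0_itv xi; have Cy := cos_gt0_itv yi.
rewrite (inj_eq (mulfI _))// eqrXn2 ?ltW// => /eqP E.
have /andP[x0 _] := xi; have /andP[y0 _] := yi.
have [h|h|//] := ltgtP x y.
  have := @cos_norm_lt R x y; rewrite !gtr0_norm// h ltW ?itv_lt_pi// => /(_ isT isT).
  by rewrite E ltxx.
have := @cos_norm_lt R y x; rewrite !gtr0_norm// h ltW ?itv_lt_pi// => /(_ isT isT).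
by rewrite E ltxx.
Qed.

Lemma w_inj x y s t : 0 < x < pi / 2 -> 0 < y < pi / 2 ->
  wx x s = wx y t -> wy x s = wy y t -> [/\ x = y, cos s = cos t & sin s = sin t].
Proof.
move=> xi yi Ex Ey; have E := w_modulus_inj xi yi Ex Ey; rewrite -{}E in yi Ex Ey *.
have C0 := cos_gt0_itv xi; have xpi := itv_lt_pi xi; have /andP[x0 _] := xi.
have C2 : 2 * cos x != 0 by rewrite gt_eqF// mulr_gt0.
have small (z c : R) : 0 < z -> z < pi -> `|z * cos c| < pi.
  by move=> z0 zpi; rewrite normrM gtr0_norm// (le_lt_trans _ zpi)// ler_piMr ?(ltW z0) ?cos_le1_norm.
have cosE (z : R) : 0 < z -> z * cos s = z * cos t -> cos s = cos t.
  by move=> z0; apply: mulfI; rewrite gt_eqF.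
have sqE : cos s = cos t -> `|sin s| = `|sin t|.
  move=> e; apply/eqP; rewrite -(eqrXn2 (n := 2))// !real_normK ?num_real//.
  by rewrite !sin2cos2 e.
have [h|h] := leP (rho (wx x s) (wy x s)) 0.
  have s0 : 0 <= sin s by rewrite leNgt; apply/negP => s0; have := rho_out xi s0; have [<- <-] := wx_out x (ltW s0); rewrite ltNge h.
  have t0 : 0 <= sin t by rewrite leNgt; apply/negP => t0; have := rho_out xi t0; have [<- <-] := wx_out x (ltW t0); rewrite -Ex -Ey ltNge h.
  move: Ex Ey; have [-> ->] := wx_in x s0; have [-> ->] := wx_in x t0.
  move=> /oppr_inj/(mulfI C2) e1 /oppr_inj/(mulfI C2) e2.
  have c := cosE _ x0 (cos_sin_inj (small _ _ x0 xpi) (small _ _ x0 xpi) e1 e2).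
  by split=> //; have := sqE c; rewrite !ger0_norm.
have s0 := rho_gt0 xi h; have t0 : sin t < 0 by apply: (@rho_gt0 R x); rewrite -?Ex -?Ey.
move: Ex Ey; have [-> ->] := wx_out x (ltW s0); have [-> ->] := wx_out x (ltW t0).
move=> /(mulfI C2) e1 /oppr_inj/(mulfI C2) e2.
have y0 : 0 < pi - x by rewrite subr_gt0.
have ypi : pi - x < pi by rewrite gtrBl.
have c := cosE _ y0 (cos_sin_inj (small _ _ y0 ypi) (small _ _ y0 ypi) e1 e2).
by split=> //; have := sqE c; rewrite !ltr0_norm// => /oppr_inj.
Qed.

End PolarCoordinates.

(** * Induction along a half-line *)

Section Continuation.
Context {R : realType}.
Implicit Types t s : R.

Lemma continuation (E : R -> Prop) : E 0 ->
  (forall t, 0 < t -> (forall s, 0 <= s < t -> E s) -> E t) ->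
  (forall t, 0 <= t -> E t -> exists2 d : R, 0 < d & forall s, t <= s < t + d -> E s) ->
  forall t, 0 <= t -> E t.
Proof.
move=> E0 El Er t t0; apply: contrapT => Et.
pose A := [set r : R | 0 <= r /\ forall s, 0 <= s <= r -> E s].
have A0 : A 0 by split=> // s /le_anti <-.
have At : ubound A t.
  move=> r [r0 rE]; rewrite leNgt; apply/negP => /ltW tr; apply: Et.
  by apply: rE; rewrite t0.
have supA : has_sup A by split; [exists 0|exists t].
have m0 : 0 <= sup A by apply: sup_upper_bound.
have below s : 0 <= s < sup A -> E s.
  move=> /andP[s0 sm]; have [r Ar sr] := sup_gt (ex_intro _ _ A0) sm.
  by apply: Ar.2; rewrite s0 ltW.
have Em : E (sup A).
  by move: m0; rewrite le_eqVlt => /predU1P[<-//|m0]; exact: El.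
have [d d0 dE] := Er _ m0 Em.
have : A (sup A + d / 2).
  split; first by rewrite addr_ge0// divr_ge0// ltW.
  move=> s /andP[s0 sm]; have [h|h] := ltP s (sup A); first by apply: below; rewrite s0.
  by apply: dE; rewrite h (le_lt_trans sm)// ltrD2l ltr_pdivrMr// ltr_pMr// ltr1n.
move=> /(sup_upper_bound supA); rewrite leNgt => /negP; apply.
by rewrite ltrDl divr_gt0.
Qed.

End Continuation.

(** * Bounded Lipschitz functions on a box *)

Section BoxLipschitz.
Context {R : realType}.
Implicit Types (f g : R -> R -> R) (u v x y k : R).

(** The box contains the disc [|w| < 2]; closure under ring operations gives Lipschitz bounds for
    the polynomial fields without partial derivatives. *)
Definition box_lip f := exists2 K : R, 0 <= K & forall u v x y,
  [/\ `|u| <= 2, `|v| <= 2, `|x| <= 2 & `|y| <= 2] ->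
  `|f u v| <= K /\ `|f u v - f x y| <= K * (`|u - x| + `|v - y|).

Lemma box_lip_cst k : box_lip (fun _ _ => k).
Proof.
by exists `|k| => // u v x y _; rewrite subrr normr0; split=> //; rewrite mulr_ge0// addr_ge0.
Qed.

Lemma box_lip_fst : box_lip (fun u _ => u).
Proof.
exists 2 => // u v x y [? _ _ _]; split=> //.
by have := normr_ge0 (u - x); have := normr_ge0 (v - y); lra.
Qed.

Lemma box_lip_snd : box_lip (fun _ v => v).
Proof.
exists 2 => // u v x y [_ ? _ _]; split=> //.
by have := normr_ge0 (u - x); have := normr_ge0 (v - y); lra.
Qed.

Lemma box_lipN f : box_lip f -> box_lip (fun u v => - f u v).
Proof.
move=> [K K0 fK]; exists K => // u v x y /fK[h1 h2]; split; first by rewrite normrN.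
by rewrite -opprD normrN.
Qed.

Lemma box_lipD f g : box_lip f -> box_lip g -> box_lip (fun u v => f u v + g u v).
Proof.
move=> [K K0 fK] [L L0 gL]; exists (K + L); first exact: addr_ge0.
move=> u v x y uvxy; have [f1 f2] := fK _ _ _ _ uvxy; have [g1 g2] := gL _ _ _ _ uvxy.
split; first exact: le_trans (ler_normD _ _) (lerD f1 g1).
rewrite opprD addrACA mulrDl; exact: le_trans (ler_normD _ _) (lerD f2 g2).
Qed.

Lemma box_lipM f g : box_lip f -> box_lip g -> box_lip (fun u v => f u v * g u v).
Proof.
move=> [K K0 fK] [L L0 gL]; exists (K * L + K * L); first by rewrite addr_ge0// mulr_ge0.
move=> u v x y uvxy; have [f1 f2] := fK _ _ _ _ uvxy; have [g1 g2] := gL _ _ _ _ uvxy.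
have [g3 _] : `|g x y| <= L /\ True.
  by split=> //; case: (gL x y x y) => //; case: uvxy.
have P : `|f u v * g u v| <= K * L by rewrite normrM ler_pM.
split; first by rewrite (le_trans P)// lerDl mulr_ge0.
rewrite (_ : _ - _ = f u v * (g u v - g x y) + (f u v - f x y) * g x y); last by ring.
rewrite [leRHS]mulrDl (le_trans (ler_normD _ _))// lerD// normrM.
  by rewrite -mulrA ler_pM.
by rewrite (mulrC K) -mulrA [leRHS]mulrC ler_pM.
Qed.

Lemma box_lipX f n : box_lip f -> box_lip (fun u v => f u v ^+ n).
Proof.
move=> hf; elim: n => [|n IH]; first exact: (box_lip_cst 1).
have -> : (fun u v => f u v ^+ n.+1) = fun u v => f u v * f u v ^+ n.
  by apply/funext => u; apply/funext => v; rewrite exprS.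
exact: box_lipM.
Qed.

Lemma box_lip_bound f : box_lip f ->
  exists2 K : R, 0 <= K & forall u v, `|u| <= 2 -> `|v| <= 2 -> `|f u v| <= K.
Proof. by move=> [K K0 fK]; exists K => // u v hu hv; apply: (fK u v u v _).1. Qed.

Lemma box_lip_continuous f (g k : R -> R) t : box_lip f -> {for t, continuous g} ->
  {for t, continuous k} -> `|g t| < 2 -> `|k t| < 2 ->
  {for t, continuous (fun r => f (g r) (k r))}.
Proof.
move=> [K K0 fK] cg ck gt2 kt2; apply/cvgrPdist_lt => c c_gt0.
have near2 (l : R -> R) : {for t, continuous l} -> `|l t| < 2 -> \forall r \near t, `|l r| <= 2.
  move=> cl lt2; have l0 : 0 < 2 - `|l t| by rewrite subr_gt0.
  apply: filterS (continuous_dist_lt cl l0) => r; rewrite distrC => h.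
  by have := ler_distD (l t) (l r) 0; rewrite !subr0; move: h; lra.
pose d := c / (2 * (K + 1)); have K1 : 0 < 2 * (K + 1) by lra.
have d0 : 0 < d by rewrite divr_gt0.
have cE : c = 2 * (K * d) + 2 * d by rewrite -mulrDr -[in X in 2 * (_ + X)](mul1r d) -mulrDl mulrA mulrC /d divfK// gt_eqF.
near=> r.
have g1 : `|g t - g r| < d by near: r; exact: continuous_dist_lt.
have k1 : `|k t - k r| < d by near: r; exact: continuous_dist_lt.
have [|_] := fK (g t) (k t) (g r) (k r).
  by split; [exact: ltW|exact: ltW|near: r; exact: near2|near: r; exact: near2].
move=> /le_lt_trans; apply.
have : K * (`|g t - g r| + `|k t - k r|) <= K * (2 * d) by rewrite ler_wpM2l//; lra.
lra.
Unshelve. all: by end_near.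
Qed.

End BoxLipschitz.

Ltac box_lip_tac := lazymatch goal with
  | |- box_lip (fun u v => u) => exact: box_lip_fst
  | |- box_lip (fun u v => v) => exact: box_lip_snd
  | |- box_lip (fun u v => - (@?f u v)) => apply: (@box_lipN _ f); box_lip_tac
  | |- box_lip (fun u v => @?f u v + @?g u v) =>
    apply: (@box_lipD _ f g); box_lip_tac
  | |- box_lip (fun u v => @?f u v * @?g u v) =>
    apply: (@box_lipM _ f g); box_lip_tac
  | |- box_lip (fun u v => (@?f u v) ^+ ?n) =>
    apply: (@box_lipX _ f n); box_lip_tac
  | |- box_lip (fun u v => ?k) => exact: (@box_lip_cst _ k)
  end.

(** * Forward uniqueness for the discontinuous system *)

Section Trajectories.
Context {R : realType}.
Variables a c0 c2 c3 c4 : R.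
Implicit Types (e t s u v : R) (zx zy : R -> R).
Local Notation in1 := (in1 a c0 c2 c3 c4).
Local Notation in2 := (in2 a c2 c3 c4).
Local Notation out1 := (out1 a).
Local Notation out2 := (out2 a).

Lemma box_lip_in1 e : box_lip (in1 e).
Proof. rewrite /in1 /P1; box_lip_tac. Qed.
Lemma box_lip_in2 e : box_lip (in2 e).
Proof. rewrite /in2 /P2; box_lip_tac. Qed.
Lemma box_lip_out1 e : box_lip (out1 e).
Proof. rewrite /out1; box_lip_tac. Qed.
Lemma box_lip_out2 e : box_lip (out2 e).
Proof. rewrite /out2; box_lip_tac. Qed.

Lemma annulus_box u v : u ^+ 2 + v ^+ 2 < 4 -> `|u| < 2 /\ `|v| < 2.
Proof.
move=> h; have four : (4 : R) = 2 ^+ 2 by ring.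
by split; rewrite -(ltr_pXn2r (n := 2)) ?nnegrE// real_normK ?num_real// -four;
  apply: le_lt_trans h; rewrite ?lerDl ?lerDr sqr_ge0.
Qed.

(** Gronwall for the squared distance. The equations are required only inside the interval, so an
    arc may start on the switching circle. *)
Lemma ode_unique (f1 f2 : R -> R -> R) zx zy zx' zy' s t : s <= t ->
  box_lip f1 -> box_lip f2 ->
  (forall r, s <= r <= t -> [/\ {for r, continuous zx}, {for r, continuous zy},
     {for r, continuous zx'} & {for r, continuous zy'}]) ->
  (forall r, s < r < t -> [/\ `|zx r| <= 2, `|zy r| <= 2, `|zx' r| <= 2 & `|zy' r| <= 2]) ->
  (forall r, s < r < t -> [/\ is_derive r 1 zx (f1 (zx r) (zy r)),
     is_derive r 1 zy (f2 (zx r) (zy r)), is_derive r 1 zx' (f1 (zx' r) (zy' r)) &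
     is_derive r 1 zy' (f2 (zx' r) (zy' r))]) ->
  zx s = zx' s -> zy s = zy' s -> zx t = zx' t /\ zy t = zy' t.
Proof.
move=> st [K K0 fK] [L L0 fL] cz box dz Ex Ey.
pose V r := (zx r - zx' r) * (zx r - zx' r) + (zy r - zy' r) * (zy r - zy' r).
pose dV r := 2 * (zx r - zx' r) * (f1 (zx r) (zy r) - f1 (zx' r) (zy' r)) +
  2 * (zy r - zy' r) * (f2 (zx r) (zy r) - f2 (zx' r) (zy' r)).
have := @gronwall_within R V dV (4 * (K + L)) s t st.
have VV r : V r = `|zx r - zx' r| ^+ 2 + `|zy r - zy' r| ^+ 2.
  by rewrite /V !real_normK ?num_real.
have -> : V s = 0 by rewrite /V Ex Ey !subrr mulr0 addr0.
rewrite mul0r => H.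
have : V t <= 0.
  apply: H.
  - apply: continuous_in_subspaceT => r; rewrite inE/= in_itv/= => /cz[c1 c2' c3' c4'].
    have cx : {for r, continuous (fun r => zx r - zx' r)} by apply: cvgB.
    have cy : {for r, continuous (fun r => zy r - zy' r)} by apply: cvgB.
    by apply: cvgD; apply: cvgM.
  - move=> r /dz[d1 d2 d3 d4].
    have dx := deriveB1 d1 d3; have dy := deriveB1 d2 d4.
    apply: (is_derive_eq (deriveD1 (deriveM1 dx dx) (deriveM1 dy dy))); rewrite /dV; ring.
  - move=> r rst; have [b1 b2 b3 b4] := box r rst.
    have [_ k1] := fK _ _ _ _ (And4 b1 b2 b3 b4).
    have [_ k2] := fL _ _ _ _ (And4 b1 b2 b3 b4).
    rewrite VV /dV (le_trans (ler_norm _))// (le_trans (ler_normD _ _))//.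
    rewrite !normrM (ger0_norm (ler0n R 2)).
    move: k1 k2 (normr_ge0 (zx r - zx' r)) (normr_ge0 (zy r - zy' r)).
    move: `|f1 _ _ - _| `|f2 _ _ - _| `|zx r - zx' r| `|zy r - zy' r| => A B p q hA hB p0 q0.
    have h1 : p * A <= p * (K * (p + q)) by rewrite ler_wpM2l.
    have h2 : q * B <= q * (L * (p + q)) by rewrite ler_wpM2l.
    have h3 : p * (p + q) <= 2 * (p ^+ 2 + q ^+ 2).
      by have := sqr_ge0 (p - q); nra.
    have h4 : q * (p + q) <= 2 * (p ^+ 2 + q ^+ 2).
      by have := sqr_ge0 (p - q); nra.
    have h5 : K * (p * (p + q)) <= K * (2 * (p ^+ 2 + q ^+ 2)) by rewrite ler_wpM2l.
    have h6 : L * (q * (p + q)) <= L * (2 * (p ^+ 2 + q ^+ 2)) by rewrite ler_wpM2l.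
    rewrite -!mulrA; move: h1 h2 h5 h6; rewrite !mulrA !(mulrC p) !(mulrC q); lra.
rewrite VV => V0.
have : zx t - zx' t = 0 /\ zy t - zy' t = 0.
  split; apply/normr0_eq0/eqP; rewrite -sqrf_eq0 eq_le sqr_ge0 andbT (le_trans _ V0)//.
    by rewrite lerDl sqr_ge0.
  by rewrite lerDr sqr_ge0.
by move=> [/subr0_eq ? /subr0_eq ?].
Qed.

(* Solutions which are classical off the circle rho = 0 and cross it at once.  The
   circle |z - 2| = 1 plays no role: the fields on its two sides are equal. *)
Definition trajectory e zx zy t := [/\ 0 < zx t ^+ 2 + zy t ^+ 2 < 4,
  {for t, continuous zx} /\ {for t, continuous zy},
  rho (zx t) (zy t) < 0 -> is_derive t 1 zx (in1 e (zx t) (zy t)) /\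
    is_derive t 1 zy (in2 e (zx t) (zy t)),
  0 < rho (zx t) (zy t) -> is_derive t 1 zx (out1 e (zx t) (zy t)) /\
    is_derive t 1 zy (out2 e (zx t) (zy t)) &
  rho (zx t) (zy t) = 0 ->
    (0 < zy t -> exists2 d : R, 0 < d & forall s, t < s < t + d -> 0 < rho (zx s) (zy s)) /\
    (zy t < 0 -> exists2 d : R, 0 < d & forall s, t < s < t + d -> rho (zx s) (zy s) < 0)].

Lemma rho_continuous zx zy t : {for t, continuous zx} -> {for t, continuous zy} ->
  {for t, continuous (fun s => rho (zx s) (zy s))}.
Proof.
move=> cx cy; rewrite /rho; apply: cvgD; last by apply: cvgM => //; exact: cvg_cst.
by apply: cvgD; exact: (continuous_comp _ (@exprn_continuous R 2 _)).
Qed.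

Lemma rho_sign_near zx zy t : {for t, continuous zx} -> {for t, continuous zy} ->
  rho (zx t) (zy t) != 0 -> exists2 d : R, 0 < d & forall s, `|s - t| < d ->
    (rho (zx s) (zy s) < 0) = (rho (zx t) (zy t) < 0) /\ rho (zx s) (zy s) != 0.
Proof.
move=> cx cy r0; set r := rho (zx t) (zy t) in r0 *.
have n0 : 0 < `|r| by rewrite normr_gt0.
have /nbhs_ballP[d /= d0 dP] := continuous_dist_lt (rho_continuous cx cy) n0.
exists d => // s sd; have : `|r - rho (zx s) (zy s)| < `|r|.
  by apply: dP; rewrite /ball/= distrC.
rewrite ltr_norml => /andP[h1 h2].
have [h|h|/eqP] := ltgtP r 0; last by rewrite (negbTE r0).
  move: h1 h2; rewrite (ltr0_norm h) => h1 h2.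
  have h3 : rho (zx s) (zy s) < 0 by move: h1; rewrite opprK ltrDl oppr_gt0.
  by rewrite h3; split=> //; rewrite lt_eqF.
move: h1 h2; rewrite (gtr0_norm h) => h1 h2.
have h3 : 0 < rho (zx s) (zy s) by move: h2; rewrite gtrBl.
by split; [apply/negbTE; rewrite -leNgt ltW|rewrite gt_eqF].
Qed.

(* Forward uniqueness of trajectories: the switching circle is crossed at once,
   hence two trajectories through the same point use the same field just after. *)
Lemma trajectory_side e zx zy t : trajectory e zx zy t ->
  exists2 d : R, 0 < d & (forall s, t < s < t + d -> (rho (zx s) (zy s) < 0) =
      (rho (zx t) (zy t) < 0) || ((rho (zx t) (zy t) == 0) && (zy t < 0)) /\
      rho (zx s) (zy s) != 0).
Proof.
move=> [ann [cx cy] _ _ H].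
have [r0|r0] := eqVneq (rho (zx t) (zy t)) 0; last first.
  have [d d0 dP] := rho_sign_near cx cy r0; exists d => // s /andP[ts sd].
  by rewrite orbF; apply: dP; rewrite gtr0_norm ?subr_gt0// ltrBlDl.
have [y0|y0|y0] := ltgtP (zy t) 0.
- have [d d0 dP] := (H r0).2 y0; exists d => // s /dP h.
  by rewrite h r0 ltxx lt_eqF.
- have [d d0 dP] := (H r0).1 y0; exists d => // s /dP h.
  by rewrite r0 ltxx gt_eqF// ltNge ltW.
- exfalso; move: r0 ann; rewrite /rho y0 expr0n/= !addr0 => r0 /andP[h1 h2].
  have /eqP : zx t * (zx t + 2) = 0 by rewrite -r0; ring.
  by rewrite mulf_eq0 => /orP[/eqP h|/eqP h]; move: h1 h2; [rewrite h|rewrite (_ : zx t = -2); last lra]; lra.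
Qed.

Lemma trajectory_unique_local e zx zy zx' zy' t d : 0 < d ->
  (forall s, t <= s < t + d -> trajectory e zx zy s /\ trajectory e zx' zy' s) ->
  zx t = zx' t -> zy t = zy' t ->
  exists2 d' : R, 0 < d' & forall s, t <= s < t + d' -> zx s = zx' s /\ zy s = zy' s.
Proof.
move=> d0 H Ex Ey.
have [T1 T2] : trajectory e zx zy t /\ trajectory e zx' zy' t.
  by apply: H; rewrite lexx ltrDl.
have [d1 d10 P1] := trajectory_side T1; have [d2 d20 P2] := trajectory_side T2.
rewrite -Ex -Ey in P2.
(* [b] tells whether the disc is occupied just after [t]; it depends only on the common point, so
   both trajectories then obey the same field. *)
move: P1 P2; set b := (_ || _) => P1 P2.
exists (Num.min d (Num.min d1 d2)); first by rewrite !lt_min d0 d10.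
move=> s /andP[ts sd].
have Hs r : t <= r <= s -> trajectory e zx zy r /\ trajectory e zx' zy' r.
  move=> /andP[tr rs]; apply: H; rewrite tr (le_lt_trans rs)// (lt_le_trans sd)//.
  by rewrite lerD2l ge_min lexx.
have Hb r : t < r < s -> [/\ (rho (zx r) (zy r) < 0) = b, rho (zx r) (zy r) != 0,
    (rho (zx' r) (zy' r) < 0) = b & rho (zx' r) (zy' r) != 0].
  move=> /andP[tr rs]; have [|? ?] := P1 r.
    by rewrite tr (lt_trans rs)// (lt_le_trans sd)// lerD2l !ge_min lexx orbT.
  have [|? ?] := P2 r => //.
  by rewrite tr (lt_trans rs)// (lt_le_trans sd)// lerD2l !ge_min lexx !orbT.
have wk r : t < r < s -> t <= r <= s by move=> /andP[/ltW-> /ltW->].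
have Hc r : t <= r <= s -> [/\ {for r, continuous zx}, {for r, continuous zy},
    {for r, continuous zx'} & {for r, continuous zy'}].
  by move=> /Hs[[_ [? ?] _ _ _] [_ [? ?] _ _ _]].
have box r : t < r < s -> [/\ `|zx r| <= 2, `|zy r| <= 2, `|zx' r| <= 2 & `|zy' r| <= 2].
  move=> /wk/Hs[[/andP[_ /annulus_box[/ltW ? /ltW ?]] _ _ _ _]].
  by move=> [/andP[_ /annulus_box[/ltW ? /ltW ?]] _ _ _ _].
case: b P1 P2 Hb => P1 P2 Hb.
  apply: (ode_unique ts (box_lip_in1 e) (box_lip_in2 e) Hc box _ Ex Ey) => r tr.
  have [b1 _ b3 _] := Hb r tr.
  by have [[_ _ /(_ b1)[? ?] _ _] [_ _ /(_ b3)[? ?] _ _]] := Hs r (wk r tr).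
apply: (ode_unique ts (box_lip_out1 e) (box_lip_out2 e) Hc box _ Ex Ey) => r tr.
have [b1 b2 b3 b4] := Hb r tr.
have c1 : 0 < rho (zx r) (zy r) by rewrite lt_neqAle eq_sym b2 leNgt b1.
have q3 : 0 < rho (zx' r) (zy' r) by rewrite lt_neqAle eq_sym b4 leNgt b3.
by have [[_ _ _ /(_ c1)[? ?] _] [_ _ _ /(_ q3)[? ?] _]] := Hs r (wk r tr).
Qed.

Lemma continuous_lim_eq (f g : R -> R) t : 0 < t -> {for t, continuous f} ->
  {for t, continuous g} -> (forall s, 0 <= s < t -> f s <= g s) -> f t <= g t.
Proof.
move=> t0 cf cg fg; rewrite leNgt -subr_gt0; apply/negP => n0.
have cfg : {for t, continuous (fun s => f s - g s)} by apply: cvgB.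
have /nbhs_ballP[d /= d0 dP] := continuous_dist_lt cfg n0.
pose s := Num.max 0 (t - d / 2).
have st : 0 <= s < t by rewrite /s le_max lexx gt_max t0 gtrBl divr_gt0.
have : `|f t - g t - (f s - g s)| < f t - g t.
  apply: dP; rewrite /ball/= gtr0_norm ?subr_gt0; last by case/andP: st.
  by rewrite ltrBlDl -ltrBlDr /s lt_max; apply/orP; right; lra.
by rewrite ltr_norml => /andP[_]; have := fg s st; lra.
Qed.

(** The second curve is known to be a trajectory only as long as the invariant [Q] holds, so
    equality and [Q] are propagated together. *)
Lemma trajectory_unique (Q : R -> Prop) e zx zy zx' zy' :
  (forall t, 0 <= t -> trajectory e zx zy t) -> continuous zx' -> continuous zy' ->
  (forall t, 0 < t -> (forall s, 0 <= s < t -> Q s) -> Q t) ->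
  (forall t, 0 <= t -> Q t -> exists2 d : R, 0 < d & forall s, t <= s < t + d ->
    trajectory e zx' zy' s /\ (zx s = zx' s -> zy s = zy' s -> Q s)) ->
  zx 0 = zx' 0 -> zy 0 = zy' 0 -> Q 0 ->
  forall t, 0 <= t -> [/\ zx t = zx' t, zy t = zy' t & Q t].
Proof.
move=> H cx' cy' Qlim H' Ex Ey Q0.
apply: (@continuation R (fun t => [/\ zx t = zx' t, zy t = zy' t & Q t])) => //.
  move=> t t0 below.
  have [_ [cx cy] _ _ _] := H t (ltW t0).
  split; last by apply: Qlim => // s /below[].
    apply/le_anti/andP; split; apply: continuous_lim_eq => //; try exact: cx'.
      by move=> s /below[-> _ _].
    by move=> s /below[-> _ _].
  apply/le_anti/andP; split; apply: continuous_lim_eq => //; try exact: cy'.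
    by move=> s /below[_ -> _].
  by move=> s /below[_ -> _].
move=> t t0 [E1 E2 Qt]; have [d d0 dP] := H' t t0 Qt.
have [d' d'0 dP'] : exists2 d' : R, 0 < d' &
    forall s, t <= s < t + d' -> zx s = zx' s /\ zy s = zy' s.
  apply: (trajectory_unique_local d0 _ E1 E2) => s st; split; last exact: (dP s st).1.
  by apply: H; case/andP: st => /(le_trans t0).
exists (Num.min d d'); first by rewrite lt_min d0.
move=> s /andP[ts sd].
have [|F1 F2] := dP' s; first by rewrite ts (lt_le_trans sd)// lerD2l ge_min lexx orbT.
have [|_ F3] := dP s; first by rewrite ts (lt_le_trans sd)// lerD2l ge_min lexx.
by split=> //; exact: F3.
Qed.

End Trajectories.

(** * Time as a function of the angle, and its inverse *)

Section TimeMap.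
Context {R : realType}.
Implicit Types (s t h x y : R) (th : R -> R).

Lemma norm_sin_lt h : 0 < h -> `|sin h| < h.
Proof.
move=> h0; have -> : h = h / 2 + h / 2 by lra.
have h2 : 0 < h / 2 by rewrite divr_gt0.
have s2 : `|sin (h / 2)| <= h / 2.
  have := lipschitz_increment 0 (h / 2) (@is_derive_sin R) cos_le1_norm.
  by rewrite sin0 !subr0 mul1r (gtr0_norm h2).
have [s0|s0] := eqVneq (sin (h / 2)) 0.
  by rewrite sinD s0 mul0r mulr0 addr0 normr0 addr_gt0.
have c1 := cos_lt1_norm s0.
rewrite sinD (mulrC (cos _)) (le_lt_trans (ler_normD _ _))// !normrM.
have : `|sin (h / 2)| * `|cos (h / 2)| <= h / 2 * `|cos (h / 2)| by rewrite ler_wpM2r.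
have : h / 2 * `|cos (h / 2)| < h / 2 by rewrite gtr_pMr.
lra.
Qed.

Definition sin_sqr_primitive s : R := (s - sin s * cos s) / 2.

Lemma derive_sin_sqr_primitive s : is_derive s 1 sin_sqr_primitive (sin s ^+ 2).
Proof.
have d : is_derive s 1 (fun s => 2^-1 * (s - sin s * cos s)) _ :=
  deriveZ1 2^-1 (deriveB1 (is_derive_id s 1) (deriveM1 (is_derive_sin s) (is_derive_cos s))).
have -> : sin_sqr_primitive = fun s => 2^-1 * (s - sin s * cos s).
  by apply/funext => t; rewrite /sin_sqr_primitive mulrC.
apply: (is_derive_eq d); rewrite -[X in _ * (X - _)](cos2Dsin2 s); lra.
Qed.

Lemma sin_sqr_primitive_mono x y : x < y -> sin_sqr_primitive x < sin_sqr_primitive y.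
Proof.
move=> xy; rewrite -subr_gt0 /sin_sqr_primitive -mulrBl divr_gt0//.
have -> : y - sin y * cos y - (x - sin x * cos x) = (y - x) - sin (y - x) * cos (x + y).
  rewrite sinB cosD.
  rewrite (_ : (_ - _) * _ = sin y * cos y * (cos x ^+ 2 + sin x ^+ 2) - sin x * cos x * (cos y ^+ 2 + sin y ^+ 2)); last by ring.
  by rewrite !cos2Dsin2; ring.
rewrite subr_gt0 (le_lt_trans (ler_norm _))// normrM (le_lt_trans (ler_piMr _ (cos_le1_norm _)))//.
by rewrite norm_sin_lt// subr_gt0.
Qed.

(** The derivative [th] of time may vanish at crossings. Comparison with a primitive of [sin ^ 2]
    still makes time strictly increasing and onto, so the inverse is continuous everywhere, and
    differentiable where [th] is nonzero. *)
Lemma time_map th (k s0 : R) : continuous th -> 0 < k -> (forall s, k * sin s ^+ 2 <= th s) ->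
  exists tm tau : R -> R, [/\ tm s0 = 0 /\ tau 0 = s0,
    forall s, is_derive s 1 tm (th s), cancel tm tau /\ cancel tau tm,
    forall x y, x < y -> tm x < tm y &
    continuous tau /\ forall t, th (tau t) != 0 -> is_derive t 1 tau (th (tau t))^-1].
Proof.
move=> cth k0 kth; have [tm tm0 dtm] := primitive_exists s0 cth.
have cS : forall A, {within A, continuous sin_sqr_primitive}.
  by move=> A; exact: derive_continuous_within derive_sin_sqr_primitive.
have ctm := fun A => @derive_continuous_within _ _ _ A dtm.
have low x y : x <= y ->
    k * sin_sqr_primitive y - k * sin_sqr_primitive x <= tm y - tm x.
  move=> xy; have dk s := deriveZ1 k (derive_sin_sqr_primitive s).
  apply: (ler_increment xy _ (ctm _) (fun s _ => dk s) (fun s _ => dtm s)) => //.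
  exact: (derive_continuous_within dk).
have mono x y : x < y -> tm x < tm y.
  move=> xy; rewrite -subr_gt0; apply: lt_le_trans (low _ _ (ltW xy)).
  by rewrite -mulrBr mulr_gt0// subr_gt0 sin_sqr_primitive_mono.
have inj : injective tm.
  move=> x y E; have [h|h|//] := ltgtP x y; first by have := mono _ _ h; rewrite E ltxx.
  by have := mono _ _ h; rewrite E ltxx.
have surj t : exists s, tm s = t.
  (* The primitive of [sin ^ 2] differs from [s / 2] by at most 1/2, so on either side of [s0] time
     passes [t] before [b] or [- b]. *)
  pose b := 2 * `|t| / k + `|s0| + 4.
  have b0 : 0 <= b by rewrite !addr_ge0// divr_ge0 ?mulr_ge0// ltW.
  have kb : k * (2 * `|t| / k) = 2 * `|t| by rewrite mulrC divfK// gt_eqF.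
  have SB s : `|sin_sqr_primitive s - s / 2| <= 1 / 2.
    rewrite /sin_sqr_primitive (_ : _ - _ = - (sin s * cos s / 2)); last by lra.
    rewrite normrN normrM (ger0_norm (_ : 0 <= 2^-1)) ?invr_ge0// ler_wpM2r ?invr_ge0//.
    by rewrite normrM mulr_ile1// ?sin_le1_norm ?cos_le1_norm.
  have bs0 : - b <= s0 <= b.
    rewrite -ler_norml /b -addrA [leRHS]addrC -addrA lerDl addr_ge0//.
    by rewrite divr_ge0 ?mulr_ge0// ltW.
  have /andP[bs1 bs2] := bs0.
  have up : t <= tm b.
    have := low _ _ bs2; rewrite tm0 subr0 -mulrBr; apply: le_trans.
    have := SB b; have := SB s0; rewrite !ler_norml => /andP[h1 h2] /andP[h3 h4].
    have h : `|t| / k <= sin_sqr_primitive b - sin_sqr_primitive s0.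
      by have := ler_norm s0; rewrite /b in h3 *; lra.
    by rewrite (le_trans (ler_norm _))// -ler_pdivrMl// mulrC.
  have dn : tm (- b) <= t.
    have := low _ _ bs1; rewrite tm0 sub0r -mulrBr => h0.
    have := SB (- b); have := SB s0; rewrite !ler_norml => /andP[h1 h2] /andP[h3 h4].
    have h : `|t| / k <= sin_sqr_primitive s0 - sin_sqr_primitive (- b).
      have := ler_norm (- s0); rewrite normrN.
      rewrite /b in h4 *; lra.
    have : `|t| <= k * (sin_sqr_primitive s0 - sin_sqr_primitive (- b)).
      by rewrite -ler_pdivrMl// mulrC.
    by have := ler_norm (- t); rewrite normrN; move: h0; lra.
  have bb := le_trans bs1 bs2.
  have [|s _ <-] := @IVT R tm (- b) b t bb (ctm _); last by exists s.
  by rewrite min_l ?max_r ?dn ?up// (le_trans dn up).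
have /choice[tau tauK] := surj.
have tmK : cancel tm tau by move=> s; apply: inj; rewrite tauK.
have ctau : continuous tau.
  move=> t; have : {for tm (tau t), continuous tau}.
    have : {near tm (tau t), continuous tau}.
      apply: (@near_can_continuous R tm tau (tau t)); first by near=> z; exact: tmK.
      by near=> z; exact: derive_continuous (dtm z).
    exact: nbhs_singleton.
  by rewrite tauK.
exists tm, tau; split=> //; first by rewrite tm0 -[X in tau X]tm0 tmK.
split=> // t tht; have : is_derive (tm (tau t)) 1 tau (th (tau t))^-1.
  apply: (@is_derive_inverse R tm) => //; first by near=> z; exact: tmK.
  by near=> z; exact: derive_continuous (dtm z).
by rewrite tauK.
Unshelve. all: by end_near.
Qed.

End TimeMap.

(** * Lifting the scalar flow to the plane *)

Section Curves.
Context {R : realType}.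
Implicit Types (e x s t : R).

Lemma continuous_glue (f g c : R -> R) : continuous f -> continuous g -> continuous c ->
  (forall s, c s = 0 -> f s = g s) -> continuous (fun s => if 0 <= c s then f s else g s).
Proof.
move=> cf cg cc fg s; apply/cvgrPdist_lt => e e0.
have nf := continuous_dist_lt (cf s) e0; have ng := continuous_dist_lt (cg s) e0.
have [c0|c0|c0] := ltgtP (c s) 0.
- have n0 : 0 < - c s by rewrite oppr_gt0.
  have nc := continuous_dist_lt (cc s) n0.
  near=> t; have : `|c s - c t| < - c s by near: t.
  rewrite ltr_norml opprK ltrBlDl -ltrBlDr => /andP[h1 _].
  have -> : 0 <= c t = false by apply/negbTE; rewrite -ltNge; move: h1; lra.
  by near: t.
- have nc := continuous_dist_lt (cc s) c0.
  near=> t; have : `|c s - c t| < c s by near: t.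
  rewrite ltr_norml => /andP[_ h1].
  have -> : 0 <= c t by move: h1; lra.
  by near: t.
- by near=> t; case: ifP => _; [near: t|rewrite fg//; near: t].
Unshelve. all: by end_near.
Qed.

Lemma continuous_gt0_near (f : R -> R) s : {for s, continuous f} -> 0 < f s ->
  \forall t \near s, 0 < f t.
Proof.
move=> cf f0; apply: filterS (continuous_dist_lt cf f0) => t.
by rewrite ltr_norml => /andP[_]; lra.
Qed.

Lemma derivable_eq_nbhs (f g : R -> R) s l : (\forall t \near s, f t = g t) ->
  is_derive s 1 g l -> is_derive s 1 f l.
Proof.
by move=> fg; apply: derivable_eq_near; apply: filterS fg => t ->.
Qed.

Variables a c0 c2 c3 c4 : R.
Local Notation din := (din a c0 c2 c3 c4).
Local Notation dout := (dout a).
Local Notation theta := (theta a c0 c2 c3 c4).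
Local Notation field_x := (field_x a c0 c2 c3 c4).
Local Notation trajectory := (trajectory a c0 c2 c3 c4).

(** Both half-angles [x] and [pi - x] are at least [x0], the denominators are at most 2, and
    [|sin s|] dominates [sin s ^ 2]. *)
Lemma theta_lower e x s x0 : 0 < x0 <= x -> x < pi / 2 ->
  2^-1 <= din e x s <= 2 -> 2^-1 <= dout e x s <= 2 ->
  x0 / 2 * sin s ^+ 2 <= theta e x s.
Proof.
move=> /andP[x00 x0x] xpi /andP[i1 i2] /andP[j1 j2].
have x_0 := lt_le_trans x00 x0x.
have half (y z : R) : x0 <= y -> 2^-1 <= z -> z <= 2 -> x0 / 2 <= y * z^-1.
  move=> xy z1 z2; have z0 : 0 < z by lra.
  have y0 : 0 < y := lt_le_trans x00 xy.
  by rewrite ler_pM ?invr_ge0 ?(ltW x00)// lef_pV2 ?posrE.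
have hin : x0 / 2 <= thin a c0 c2 c3 c4 e x s by exact: half.
have hout : x0 / 2 <= thout a e x s by apply: half => //; move: x0x xpi; lra.
have sp : 0 <= sinp s by rewrite /sinp le_max lexx orbT.
have sm : 0 <= sinm s by rewrite /sinm le_max lexx orbT.
have s1 : sin s ^+ 2 <= sinp s + sinm s.
  rewrite sinp_sinm -[sin s ^+ 2]real_normK ?num_real// expr2.
  by rewrite ler_piMr ?sin_le1_norm.
have h1 : sinp s * (x0 / 2) <= sinp s * thin a c0 c2 c3 c4 e x s by rewrite ler_wpM2l.
have h2 : sinm s * (x0 / 2) <= sinm s * thout a e x s by rewrite ler_wpM2l.
have h3 : x0 / 2 * sin s ^+ 2 <= x0 / 2 * (sinp s + sinm s).
  by rewrite ler_wpM2l// divr_ge0// ltW.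
by rewrite /(theta _); move: h1 h2 h3; lra.
Qed.

Variables (e p d : R) (X : R -> R).
Hypothesis d_gt0 : 0 < d.
Hypothesis good : forall x s, `|x - p| <= d ->
  [/\ 0 < x < pi / 2, 2^-1 <= din e x s <= 2 & 2^-1 <= dout e x s <= 2].
Hypothesis X_flow : flow field_x p d e X.

Let xi s := clamp p d (X s).

Let xi_le s : `|xi s - p| <= d. Proof. exact/clamp_le/ltW. Qed.

Let xi_itv s : 0 < xi s < pi / 2. Proof. by have [] := good s (xi_le s). Qed.

Let cX : continuous X := flow_continuous X_flow.

Let cxi : continuous xi.
Proof.
move=> s; apply/cvgrPdist_lt => c c_gt0; have := continuous_dist_lt (@cX s) c_gt0.
by apply: filterS => t; apply: le_lt_trans; apply: clamp_lip; exact: ltW.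
Qed.

Lemma continuous_theta_clamp : continuous (fun s => theta e (clamp p d (X s)) s).
Proof.
apply: (continuous_path cxi _ _ _ _).2 => s.
- exact: cos_gt0_itv.
- exact: sin_gt0_itv.
- by have [_ /andP[h _] _] := good s (xi_le s); rewrite gt_eqF// (lt_le_trans _ h)// invr_gt0.
- by have [_ _ /andP[h _]] := good s (xi_le s); rewrite gt_eqF// (lt_le_trans _ h)// invr_gt0.
Qed.

Lemma theta_clamp_lower s : (p - d) / 2 * sin s ^+ 2 <= theta e (clamp p d (X s)) s.
Proof.
have [/andP[_ xpi] h1 h2] := good s (xi_le s).
have [/andP[x00 _] _ _] : [/\ 0 < p - d < pi / 2, 2^-1 <= din e (p - d) 0 <= 2 & 2^-1 <= dout e (p - d) 0 <= 2].
  by apply: good; rewrite addrAC subrr sub0r normrN gtr0_norm.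
apply: theta_lower => //; rewrite x00 /=.
by have := xi_le s; rewrite ler_norml => /andP[+ _]; rewrite /xi; lra.
Qed.

Lemma pd_gt0 : 0 < (p - d) / 2.
Proof.
have [/andP[x00 _] _ _] : [/\ 0 < p - d < pi / 2, 2^-1 <= din e (p - d) 0 <= 2 & 2^-1 <= dout e (p - d) 0 <= 2].
  by apply: good; rewrite addrAC subrr sub0r normrN gtr0_norm.
by rewrite divr_gt0.
Qed.

Lemma continuous_wxy : continuous (fun s => wx (X s) s) /\ continuous (fun s => wy (X s) s).
Proof.
have cc := @continuous_cos R; have cs := @continuous_sin R.
split; rewrite /wx /wy; apply: continuous_glue => //.
- rewrite /inx; apply: continuousN1; apply: continuousM1.
    by apply: continuousM1; [exact: continuous_cst1|exact: continuous_comp1].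
  by apply: continuous_comp1 => //; exact: continuousM1.
- rewrite /outx; apply: continuousM1.
    by apply: continuousM1; [exact: continuous_cst1|exact: continuous_comp1].
  apply: continuous_comp1 => //; apply: continuousM1 => //.
  by apply: continuousD1; [exact: continuous_cst1|exact: continuousN1].
- by move=> s /(out_in_boundary (X s))[].
- rewrite /iny; apply: continuousN1; apply: continuousM1.
    by apply: continuousM1; [exact: continuous_cst1|exact: continuous_comp1].
  by apply: continuous_comp1 => //; exact: continuousM1.
- rewrite /outy; apply: continuousN1; apply: continuousM1.
    by apply: continuousM1; [exact: continuous_cst1|exact: continuous_comp1].
  apply: continuous_comp1 => //; apply: continuousM1 => //.
  by apply: continuousD1; [exact: continuous_cst1|exact: continuousN1].
- by move=> s /(out_in_boundary (X s))[].
Qed.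

Section Lift.
Variable tau : R -> R.
Hypothesis ctau : continuous tau.
Hypothesis tau_mono : forall s t, s < t -> tau s < tau t.
Hypothesis dtau : forall t, theta e (clamp p d (X (tau t))) (tau t) != 0 ->
  is_derive t 1 tau (theta e (clamp p d (X (tau t))) (tau t))^-1.

Definition liftx t := wx (X (tau t)) (tau t).
Definition lifty t := wy (X (tau t)) (tau t).

Lemma continuous_lift : continuous liftx /\ continuous lifty.
Proof.
have [c1 c2'] := continuous_wxy.
by split; [exact: (continuous_comp1 c1 ctau)|exact: (continuous_comp1 c2' ctau)].
Qed.

Let dX t : `|X t - p| <= d -> is_derive t 1 X (e * field_x e (X t) t).
Proof. by move=> h; apply: (is_derive_eq (X_flow t)); rewrite clamp_id. Qed.

Let theta_neq0 t : `|X t - p| <= d -> sin t != 0 -> theta e (X t) t != 0.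
Proof.
move=> h s0; have := theta_clamp_lower t; rewrite clamp_id// => le.
rewrite gt_eqF// (lt_le_trans _ le)// mulr_gt0 ?pd_gt0//.
by rewrite lt_neqAle eq_sym sqr_ge0 expf_eq0 /= s0.
Qed.

(** Off the circle [theta] is nonzero, and the derivative of [tau] cancels the factor [theta] of the
    derivative in [s]. *)
Lemma lift_inside t : `|X (tau t) - p| <= d -> 0 < sin (tau t) ->
  is_derive t 1 liftx (in1 a c0 c2 c3 c4 e (liftx t) (lifty t)) /\
  is_derive t 1 lifty (in2 a c2 c3 c4 e (liftx t) (lifty t)).
Proof.
move=> h s0; have [xi_t /andP[i1 _] _] := good (tau t) h.
have i0 : din e (X (tau t)) (tau t) != 0 by rewrite gt_eqF// (lt_le_trans _ i1)// invr_gt0.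
have th0 := theta_neq0 h (lt0r_neq0 s0).
have dt : is_derive t 1 tau (theta e (X (tau t)) (tau t))^-1.
  by have := @dtau t; rewrite clamp_id// => /(_ th0).
have [d1 d2] := derive_in xi_t (dX h) s0 i0.
have nr : \forall r \near t, 0 < sin (tau r).
  by apply: continuous_gt0_near => //; exact: (continuous_comp1 (@continuous_sin R) ctau).
have [Ex Ey] := wx_in (X (tau t)) (ltW s0).
split; rewrite /(liftx t) /(lifty t) Ex Ey.
  apply: (@derivable_eq_nbhs _ (fun r => inx (X (tau r)) (tau r))).
    by apply: filterS nr => r /ltW /(wx_in (X (tau r)))[].
  by apply: (is_derive_eq (derive_comp1 d1 dt)); rewrite mulrAC divff// mul1r.
apply: (@derivable_eq_nbhs _ (fun r => iny (X (tau r)) (tau r))).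
  by apply: filterS nr => r /ltW /(wx_in (X (tau r)))[].
by apply: (is_derive_eq (derive_comp1 d2 dt)); rewrite mulrAC divff// mul1r.
Qed.

Lemma lift_outside t : `|X (tau t) - p| <= d -> sin (tau t) < 0 ->
  is_derive t 1 liftx (out1 a e (liftx t) (lifty t)) /\
  is_derive t 1 lifty (out2 a e (liftx t) (lifty t)).
Proof.
move=> h s0; have [xi_t _ /andP[i1 _]] := good (tau t) h.
have i0 : dout e (X (tau t)) (tau t) != 0 by rewrite gt_eqF// (lt_le_trans _ i1)// invr_gt0.
have th0 := theta_neq0 h (ltr0_neq0 s0).
have dt : is_derive t 1 tau (theta e (X (tau t)) (tau t))^-1.
  by have := @dtau t; rewrite clamp_id// => /(_ th0).
have [d1 d2] := derive_out xi_t (dX h) s0 i0.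
have nr : \forall r \near t, 0 < - sin (tau r).
  apply: (@continuous_gt0_near (fun r => - sin (tau r))); rewrite ?oppr_gt0//.
  by apply: continuousN1; exact: (continuous_comp1 (@continuous_sin R) ctau).
have [Ex Ey] := wx_out (X (tau t)) (ltW s0).
split; rewrite /(liftx t) /(lifty t) Ex Ey.
  apply: (@derivable_eq_nbhs _ (fun r => outx (X (tau r)) (tau r))).
    by apply: filterS nr => r; rewrite oppr_gt0 => /ltW /(wx_out (X (tau r)))[].
  by apply: (is_derive_eq (derive_comp1 d1 dt)); rewrite mulrAC divff// mul1r.
apply: (@derivable_eq_nbhs _ (fun r => outy (X (tau r)) (tau r))).
  by apply: filterS nr => r; rewrite oppr_gt0 => /ltW /(wx_out (X (tau r)))[].
by apply: (is_derive_eq (derive_comp1 d2 dt)); rewrite mulrAC divff// mul1r.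
Qed.

Lemma lift_trajectory t : `|X (tau t) - p| < d -> trajectory e liftx lifty t.
Proof.
move=> h; have h' := ltW h; have [xi_t _ _] := good (tau t) h'.
have [cx cy] := continuous_lift; have C0 := cos_gt0_itv xi_t.
have near_itv : \forall r \near t, 0 < X (tau r) < pi / 2.
  have h0 : 0 < d - `|X (tau t) - p| by rewrite subr_gt0.
  have := continuous_dist_lt (@continuous_comp1 R _ _ (@cX) ctau t) h0.
  apply: filterS => r hr; have [] // := @good (X (tau r)) 0.
  by have := ler_distD (X (tau t)) (X (tau r)) p; rewrite (distrC (X (tau r)) (X (tau t))); move: hr; lra.
split.
- exact: w_annulus.
- by split; [exact: cx|exact: cy].
- by move=> /(rho_lt0 xi_t); exact: lift_inside.
- by move=> /(rho_gt0 xi_t); exact: lift_outside.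
- move=> /(rho_eq0 xi_t) s0; have [cb1 cb2] := wy_boundary xi_t s0.
  (* The sign of sin just after a zero is the sign of cos. *)
  have after (c : R) : c = 1 \/ c = -1 -> cos (tau t) = c ->
      \forall r \near t, t < r -> 0 < c * sin (tau r).
    move=> c1 Ec.
    have n1 : 0 < pi / 2 :> R by rewrite divr_gt0 ?pi_gt0.
    apply: filterS (continuous_dist_lt (@ctau t) n1) => r hr /tau_mono tr.
    rewrite -(subrK (tau t) (tau r)) sinD s0 mulr0 addr0 Ec mulrCA.
    have -> : c * c = 1 by case: c1 => ->; rewrite ?mulrNN mulr1.
    rewrite mulr1 sin_gt0_itv// subr_gt0 tr /=.
    by move: hr; rewrite distrC gtr0_norm// subr_gt0.
  split=> [/cb1|/cb2] Ec.
    have N : \forall r \near t, 0 < X (tau r) < pi / 2 /\ (t < r -> 0 < -1 * sin (tau r)).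
      exact: (filterI near_itv (after _ (or_intror erefl) Ec)).
    have /nbhs_ballP[m /= m0 mP] := N.
    exists m => // r /andP[tr rm]; have [|hr /(_ tr)] := mP r.
      by rewrite /ball/= distrC gtr0_norm ?subr_gt0// ltrBlDl.
    rewrite mulN1r oppr_gt0 => sr; rewrite /liftx /lifty.
    by have [-> ->] := wx_out (X (tau r)) (ltW sr); exact: rho_out.
  have N : \forall r \near t, 0 < X (tau r) < pi / 2 /\ (t < r -> 0 < 1 * sin (tau r)).
    exact: (filterI near_itv (after _ (or_introl erefl) Ec)).
  have /nbhs_ballP[m /= m0 mP] := N.
  exists m => // r /andP[tr rm]; have [|hr /(_ tr)] := mP r.
    by rewrite /ball/= distrC gtr0_norm ?subr_gt0// ltrBlDl.
  rewrite mul1r => sr; rewrite /liftx /lifty.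
  by have [-> ->] := wx_in (X (tau r)) (ltW sr); exact: rho_in.
Qed.

End Lift.
End Curves.

(** * Lebesgue integrals of velocities *)

Section Integrals.
Context {R : realType}.
Implicit Types (f g v z : R -> R) (s t u c : R).
Local Notation mu := (@lebesgue_measure R).

Lemma locally_integrable_itv v s t : locally_integrable setT v ->
  mu.-integrable `[s, t] (EFin \o v).
Proof.
move=> [mv _ iv]; apply/integrableP; split.
  by apply/measurable_EFinP; exact: measurable_funS mv.
by apply: iv => //; exact: segment_compact.
Qed.

Lemma itv_integral_add v s t u : locally_integrable setT v -> s <= t -> t <= u ->
  \int[mu]_(x in `[s, u]) v x =
  \int[mu]_(x in `[s, t]) v x + \int[mu]_(x in `[t, u]) v x.
Proof.
move=> iv st tu; apply/eqP; rewrite addrC -subr_eq.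
rewrite (Rintegral_itvB (locally_integrable_itv s u iv)) ?bnd_simp//.
rewrite Rintegral_itv_obnd_cbnd//; apply: integrableS (locally_integrable_itv t u iv) => //.
exact: subset_itv_oc_cc.
Qed.

Lemma itv_integral_near v s t c (eta : R) : locally_integrable setT v -> s <= t -> 0 <= eta ->
  {ae mu, forall x, s <= x <= t -> `|v x - c| <= eta} ->
  `|\int[mu]_(x in `[s, t]) v x - c * (t - s)| <= eta * (t - s).
Proof.
move=> iv st eta0 ae.
have mI : measurable `[s, t]%classic by [].
have lE : mu `[s, t]%classic = (t - s)%:E.
  rewrite lebesgue_measure_itv/= lte_fin.
  by case: ltP => // ts; have -> : t = s by [apply/le_anti/andP]; rewrite subrr.
have ic k : mu.-integrable `[s, t] (EFin \o cst k).
  by apply: continuous_compact_integrable; [exact: segment_compact|apply: continuous_subspaceT => x; exact: cvg_cst].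
have cE k : \int[mu]_(x in `[s, t]) (cst k x) = k * (t - s).
  by rewrite Rintegral_cst//; congr (_ * _); exact: (congr1 fine lE).
have iv' := locally_integrable_itv s t iv.
have iB : mu.-integrable `[s, t] (EFin \o (fun x => v x - c)).
  have -> : EFin \o (fun x => v x - c) = ((EFin \o v) \- (EFin \o cst c))%E.
    by apply/funext => x; rewrite /= EFinB.
  by apply: integrableB.
have mB := (integrableP _ _ _ iB).1.
have iN : mu.-integrable `[s, t] (EFin \o (fun x => `|v x - c|)).
  exact: (integrable_norm iB).
rewrite -(cE c) -(cE eta) -RintegralB//.
apply: (le_trans (le_normr_Rintegral _ _)) => //.
rewrite /Rintegral fine_le//; [exact: integrable_fin_num|apply: integrable_fin_num => //; exact: (ic eta)|].
apply: ae_ge0_le_integral => //.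
- exact: (integrableP _ _ _ iN).1.
- exact: (integrableP _ _ _ (ic eta)).1.
Qed.

Lemma continuous_locally_integrable f : continuous f -> locally_integrable setT f.
Proof.
move=> cf; split => //.
- exact: continuous_measurable_fun.
- exact: openT.
- move=> K _ cK; have /integrableP[] // : mu.-integrable K (EFin \o f).
  by apply: continuous_compact_integrable => //; exact: continuous_subspaceT.
Qed.

Lemma glue_locally_integrable f g (c : R -> R) : continuous f -> continuous g -> continuous c ->
  locally_integrable setT (fun t => if 0 <= c t then f t else g t).
Proof.
move=> cf cg cc.
have mv : measurable_fun setT (fun t => if 0 <= c t then f t else g t).
  apply: measurable_fun_ifT; [|exact: continuous_measurable_fun|exact: continuous_measurable_fun].
  apply: measurable_fun_ler => //; exact: continuous_measurable_fun.
split=> //; first exact: openT.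
move=> K _ cK; have cfg : continuous (fun t => `|f t| + `|g t|).
  by move=> t; apply: cvgD; apply: cvg_norm; [exact: cf|exact: cg].
have [_ _ /(_ K (@subsetT _ _) cK)] := continuous_locally_integrable cfg.
apply: le_lt_trans; have mK : measurable K by exact: compact_measurable.
apply: ge0_le_integral => //.
- apply/measurable_EFinP; apply: measurableT_comp => //; exact: measurable_funS mv.
- apply/measurable_EFinP; apply: measurableT_comp => //.
  apply: measurable_funTS; exact: continuous_measurable_fun.
- move=> t _; rewrite lee_fin [leRHS]ger0_norm ?addr_ge0//.
  by case: ifP; rewrite ?lerDl ?lerDr.
Qed.

Lemma itv_integral_deriv f v z s t : s <= t -> continuous f -> continuous z ->
  locally_integrable setT v ->
  (forall x, s < x < t -> is_derive x 1 z (f x) /\ v x = f x) ->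
  z t - z s = \int[mu]_(x in `[s, t]) v x.
Proof.
rewrite le_eqVlt => /predU1P[->|st] cf cz [mv _ _] dz.
  by rewrite subrr set_itv1 Rintegral_set1.
rewrite /Rintegral.
have -> : (\int[mu]_(x in `[s, t]) (v x)%:E = \int[mu]_(x in `[s, t]) (f x)%:E)%E.
  have mf : measurable_fun `]s, t[ (fun x => (f x)%:E).
    by apply/measurable_EFinP; apply: measurable_funTS; exact: continuous_measurable_fun.
  have mv' : measurable_fun `]s, t[ (fun x => (v x)%:E).
    by apply/measurable_EFinP; exact: measurable_funS mv.
  rewrite (integral_itv_bndoo _ _ mv') (integral_itv_bndoo _ _ mf).
  by apply: eq_integral => x /set_mem/=; rewrite in_itv/= => /dz[_ ->].
rewrite (@continuous_FTC2 _ f z s t)//.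
- exact: continuous_subspaceT.
- split.
  + by move=> x; rewrite in_itv/= => /dz[[]].
  + by apply: cvg_at_right_filter; exact: cz.
  + by apply: cvg_at_left_filter; exact: cz.
- by move=> x; rewrite in_itv/= => /dz[d _]; rewrite derive1E; exact: (@derive_val _ _ _ _ _ _ _ d).
Qed.

(** Every time has a one-sided neighbourhood on each side where a single formula holds; the
    fundamental theorem is propagated by [continuation], without counting the switches. *)
Lemma itv_integral_piecewise f g v z : continuous f -> continuous g -> continuous z ->
  locally_integrable setT v ->
  (forall t, exists2 d : R, 0 < d &
    ((forall x, t < x < t + d -> is_derive x 1 z (f x) /\ v x = f x) \/
     (forall x, t < x < t + d -> is_derive x 1 z (g x) /\ v x = g x)) /\
    ((forall x, t - d < x < t -> is_derive x 1 z (f x) /\ v x = f x) \/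
     (forall x, t - d < x < t -> is_derive x 1 z (g x) /\ v x = g x))) ->
  forall s t, s <= t -> z t - z s = \int[mu]_(x in `[s, t]) v x.
Proof.
move=> cf cg cz iv side s t st.
pose E r := z (s + r) - z s = \int[mu]_(x in `[s, s + r]) v x.
suff : E (t - s) by rewrite /E subrKC.
apply: continuation; rewrite ?subr_ge0//.
- by rewrite /E addr0 subrr set_itv1 Rintegral_set1.
- move=> r r0 H; have [d d0 [_ side']] := side (s + r).
  pose q := Num.max 0 (r - d / 2).
  have q0 : 0 <= q by rewrite le_max lexx.
  have qr : q < r by rewrite gt_max r0 gtrBl divr_gt0.
  have qd : s + r - d < s + q by rewrite -addrA ltrD2l lt_max; apply/orP; right; lra.
  have Hq : E q by apply: H; rewrite q0.
  have qr' : s + q <= s + r by rewrite lerD2l ltW.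
  rewrite /E (@itv_integral_add _ _ (s + q))// ?lerDl// -Hq.
  have -> : z (s + r) - z s = z (s + q) - z s + (z (s + r) - z (s + q)) by ring.
  congr (_ + _); have wk x : s + q < x < s + r -> s + r - d < x < s + r.
    by move=> /andP[h ->]; rewrite (lt_trans qd h).
  by case: side' => side'; [apply: (@itv_integral_deriv f)|apply: (@itv_integral_deriv g)] => // x /wk/side'.
- move=> r r0 H; have [d d0 [side' _]] := side (s + r).
  exists d => // q /andP[rq qd]; have rq' : s + r <= s + q by rewrite lerD2l.
  rewrite /E (@itv_integral_add _ _ (s + r))// ?lerDl// -H.
  have -> : z (s + q) - z s = z (s + r) - z s + (z (s + q) - z (s + r)) by ring.
  congr (_ + _); have wk x : s + r < x < s + q -> s + r < x < s + r + d.
    by move=> /andP[-> h]; rewrite (lt_trans h)// -addrA ltrD2l.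
  by case: side' => side'; [apply: (@itv_integral_deriv f)|apply: (@itv_integral_deriv g)] => // x /wk/side'.
Qed.

End Integrals.

(** * The fields and zones in real coordinates *)

Section ComplexField.
Context {R : realType}.
Variables a c0 c2 c3 c4 : R.
Implicit Types (e u v t : R) (z w : R[i]).

(* Coefficients in powers of z of a w + c0 + c2 w^2 + c3 w^3 + c4 w^4, w = z - 1,
   in the disc Zplus, and of a w in the two other zones. *)
Definition coef_re (s : zone) (j : 'I_5) : R :=
  nth 0 (if s is Zplus then [:: c0 - a + c2 - c3 + c4; a - 2 * c2 + 3 * c3 - 4 * c4;
    c2 - 3 * c3 + 6 * c4; c3 - 4 * c4; c4] else [:: - a; a]) j.
Definition coef_im (s : zone) (j : 'I_5) : R := 0.

Local Notation F := (field coef_re coef_im).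

Lemma fieldE e s u v : F e s ((u + 1) +i* v) =
  if s is Zplus then in1 a c0 c2 c3 c4 e u v +i* in2 a c2 c3 c4 e u v
  else out1 a e u v +i* out2 a e u v.
Proof.
rewrite /field /h !big_ord_recl big_ord0 /coef_re /coef_im /= !exprS !expr0.
rewrite /bump /= /in1 /in2 /out1 /out2 /P1 /P2.
by case: s => /=; simpc; apply/eqP; rewrite eq_complex /=; apply/andP; split; apply/eqP; ring.
Qed.

Lemma complex_norm_lt u v (d : R) : 0 < d -> (`|u +i* v| < d%:C) = (u ^+ 2 + v ^+ 2 < d ^+ 2).
Proof.
move=> d0; rewrite normc_def ltcR -[X in _ < X](ger0_norm (ltW d0)) -sqrtr_sqr.
by rewrite ltr_sqrt ?exprn_gt0.
Qed.

Lemma complex_norm_gt u v (d : R) : 0 < d -> (d%:C < `|u +i* v|) = (d ^+ 2 < u ^+ 2 + v ^+ 2).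
Proof.
move=> d0; rewrite normc_def ltcR -[X in X < _](ger0_norm (ltW d0)) -sqrtr_sqr.
have [h|h] := ltP (d ^+ 2) (u ^+ 2 + v ^+ 2).
  by rewrite ltr_sqrt// (lt_trans _ h)// exprn_gt0.
by apply/negbTE; rewrite -leNgt ler_sqrt// exprn_ge0// ltW.
Qed.

Lemma Sigma_plus u v : Sigma Zplus ((u + 1) +i* v) <-> rho u v < 0.
Proof.
rewrite /= (_ : 1 = 1%:C)// complex_norm_lt// /rho expr1n.
rewrite (_ : (u + 1) ^+ 2 + v ^+ 2 = u ^+ 2 + v ^+ 2 + 2 * u + 1); last by ring.
by rewrite gtrDr.
Qed.

(** In the coordinate [w = z - 1] the reflection [u -> - u] exchanges the two discs. *)
Lemma Sigma_minus u v : Sigma Zminus ((u + 1) +i* v) <-> rho (- u) v < 0.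
Proof.
have -> : Sigma Zminus ((u + 1) +i* v) <-> `|(u - 1) +i* v| < 1%:C.
  rewrite /= (_ : _ - _ = (u - 1) +i* v)//.
  by apply/eqP; rewrite eq_complex /=; apply/andP; split; apply/eqP; ring.
rewrite complex_norm_lt// /rho expr1n.
rewrite (_ : (u - 1) ^+ 2 + v ^+ 2 = (- u) ^+ 2 + v ^+ 2 + 2 * - u + 1); last by ring.
by rewrite gtrDr.
Qed.

Lemma Sigma_c u v : Sigma Zc ((u + 1) +i* v) <-> 0 < rho u v /\ 0 < rho (- u) v.
Proof.
have E1 : `|(u + 1) +i* v| > 1%:C <-> 0 < rho u v.
  rewrite complex_norm_gt// /rho expr1n.
  rewrite (_ : (u + 1) ^+ 2 + v ^+ 2 = u ^+ 2 + v ^+ 2 + 2 * u + 1); last by ring.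
  by rewrite ltrDr.
have E2 : `|(u - 1) +i* v| > 1%:C <-> 0 < rho (- u) v.
  rewrite complex_norm_gt// /rho expr1n.
  rewrite (_ : (u - 1) ^+ 2 + v ^+ 2 = (- u) ^+ 2 + v ^+ 2 + 2 * - u + 1); last by ring.
  by rewrite ltrDr.
rewrite -E1 -E2 /= (_ : (u + 1) +i* v - 2%:R = (u - 1) +i* v)//.
by apply/eqP; rewrite eq_complex /=; apply/andP; split; apply/eqP; ring.
Qed.

Lemma closure_ball (A : set R[i]) z : closure (A : set (R[i])^o) z <->
  forall d : R, 0 < d -> exists2 w, A w & `|z - w| < d%:C.
Proof.
split=> [cA d d0|H B /nbhs_ballP[d d0 dB]].
  have [|w [Aw]] := cA (ball (z : R[i]^o) (d%:C : R[i])).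
    by apply: nbhsx_ballx; rewrite ltcR.
  by rewrite /ball/= => zw; exists w.
(* The radius of a ball in [R[i]] is a complex number; being positive, it is real. *)
have d0' : 0 < complex.Re d by move: d0; rewrite /= ltcE => /andP[].
have dE : d = (complex.Re d)%:C by move: d0; rewrite /= ltcE => /andP[/eqP + _]; case: d {dB d0'} => ? ? /= ->.
have [w Aw zw] := H _ d0'; exists w; split=> //; apply: dB.
by rewrite /ball/= dE.
Qed.

End ComplexField.

(** * The Filippov hull *)

Section Filippov.
Context {R : realType}.
Variables a c0 c2 c3 c4 : R.
Implicit Types (e u v t : R) (z w : R[i]).
Local Notation F := (field (coef_re a c0 c2 c3 c4) coef_im).
Local Notation in1 := (in1 a c0 c2 c3 c4).
Local Notation in2 := (in2 a c2 c3 c4).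
Local Notation out1 := (out1 a).
Local Notation out2 := (out2 a).

Lemma rho_near u v : rho u v != 0 -> exists2 d : R, 0 < d & forall x y,
  `|u - x| < d -> `|v - y| < d -> `|rho u v - rho x y| < `|rho u v|.
Proof.
(* One more than the sum of the bounds [2 |u| + 3] and [2 |v| + 1] of the cofactors of the two
   increments, to make the inequality strict. *)
set r := rho u v => r0; pose B : R := 2 * `|u| + 2 * `|v| + 5.
have B0 : 0 < B by rewrite ltr_wpDl// addr_ge0// mulr_ge0.
have n0 : 0 < `|r| by rewrite normr_gt0.
exists (Num.min 1 (`|r| / B)); first by rewrite lt_min ltr01 divr_gt0.
move=> x y; rewrite !lt_min => /andP[x1 xB] /andP[y1 yB].
rewrite (_ : r - rho x y = (u - x) * (2 * u - (u - x) + 2) + (v - y) * (2 * v - (v - y))); last by rewrite /r /rho; ring.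
apply: (le_lt_trans (ler_normD _ _)); rewrite !normrM.
have h1 : `|2 * u - (u - x) + 2| <= 2 * `|u| + 3.
  have := ler_normD (2 * u - (u - x)) 2; have := ler_normB (2 * u) (u - x).
  by rewrite normrM !(ger0_norm (_ : (0 : R) <= 2))//; lra.
have h2 : `|2 * v - (v - y)| <= 2 * `|v| + 1.
  have := ler_normB (2 * v) (v - y).
  by rewrite normrM !(ger0_norm (_ : (0 : R) <= 2))//; lra.
have h3 : `|u - x| * `|2 * u - (u - x) + 2| <= `|r| / B * (2 * `|u| + 3).
  by rewrite ler_pM// ltW.
have h4 : `|v - y| * `|2 * v - (v - y)| <= `|r| / B * (2 * `|v| + 1).
  by rewrite ler_pM// ltW.
have h5 : `|r| / B * (2 * `|u| + 3) + `|r| / B * (2 * `|v| + 1) + `|r| / B = `|r|.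
  have -> : `|r| / B * (2 * `|u| + 3) + `|r| / B * (2 * `|v| + 1) + `|r| / B = `|r| / B * B.
    by rewrite /B; ring.
  by rewrite divfK ?gt_eqF.
have h6 : 0 < `|r| / B by rewrite divr_gt0.
by move: h3 h4 h5 h6; lra.
Qed.

Lemma complex_norm_components x y u v (d : R) : 0 < d ->
  `|(x + 1) +i* y - ((u + 1) +i* v)| < d%:C -> `|x - u| < d /\ `|y - v| < d.
Proof.
move=> d0; rewrite (_ : _ - _ = (x - u) +i* (y - v)); last first.
  by apply/eqP; rewrite eq_complex /=; apply/andP; split; apply/eqP; ring.
rewrite complex_norm_lt// => h.
have h1 (r : R) : r ^+ 2 < d ^+ 2 -> `|r| < d.
  by rewrite -[r ^+ 2]real_normK ?num_real// ltr_pXn2r ?nnegrE// ltW.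
split; apply: h1; apply: le_lt_trans h; first by rewrite lerDl sqr_ge0.
by rewrite lerDr sqr_ge0.
Qed.

Lemma complexW w : exists x y : R, w = (x + 1) +i* y.
Proof. by case: w => x y; exists (x - 1), y; rewrite subrK. Qed.

Lemma closure_Sigma s u v : closure (Sigma s : set (R[i])^o) ((u + 1) +i* v) ->
  if s is Zplus then rho u v <= 0 else 0 <= rho u v.
Proof.
move=> /closure_ball H; have [r0|r0] := eqVneq (rho u v) 0; first by case: s {H}; rewrite r0.
have [d d0 dP] := rho_near r0; have [w sw] := H _ d0.
have [x [y wE]] := complexW w; rewrite wE in sw *.
move=> /complex_norm_components-/(_ d0)[/dP h /h]; rewrite ltr_norml => /andP[h1 h2].
case: s sw {H} => [/Sigma_plus sw|/Sigma_c[sw _]|/Sigma_minus sw].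
- by rewrite leNgt; apply/negP => r1; move: h2; rewrite gtr0_norm//; lra.
- by rewrite leNgt; apply/negP => r1; move: h1; rewrite ltr0_norm//; lra.
- rewrite leNgt; apply/negP => r1; move: h1 sw; rewrite ltr0_norm// /rho.
  have := sqr_ge0 x; have := sqr_ge0 y; rewrite sqrrN; lra.
Qed.

(** The centre of the disc is [w = - k]; contracting by [1 - m] towards it moves a point of the
    closed disc inside, by less than [d]. *)
Lemma disc_closure s (k u v : R) : `|k| = 1 ->
  (forall x y, rho (k * x) y < 0 -> Sigma s ((x + 1) +i* y)) ->
  rho (k * u) v <= 0 -> closure (Sigma s : set (R[i])^o) ((u + 1) +i* v).
Proof.
move=> k1 sub r0; apply/closure_ball => d d0.
have kk : k * k = 1 by rewrite -expr2 -[k ^+ 2]real_normK ?num_real// k1 expr1n.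
pose m := Num.min 2^-1 (d / 2).
have m0 : 0 < m by rewrite lt_min invr_gt0 divr_gt0 ?ltr0n.
have m1 : m <= 2^-1 by rewrite ge_min lexx.
have md : m < d by rewrite gt_min; apply/orP; right; lra.
have mk : (k * (u - m * (u + k))) ^+ 2 = (u - m * (u + k)) ^+ 2.
  by rewrite exprMn expr2 kk mul1r.
have nE : (u + k) ^+ 2 + v ^+ 2 = 1 + rho (k * u) v.
  rewrite /rho (_ : (k * u) ^+ 2 = u ^+ 2); last by rewrite exprMn expr2 kk mul1r.
  rewrite (_ : (u + k) ^+ 2 = u ^+ 2 + 2 * (k * u) + k * k); last by ring.
  by rewrite kk; ring.
exists (((u - m * (u + k)) + 1) +i* (v - m * v)).
  apply: sub; rewrite /rho mk.
  rewrite (_ : _ + _ = (1 - m) ^+ 2 * ((u + k) ^+ 2 + v ^+ 2) - k * k); last by ring.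
  rewrite nE kk; have : (1 - m) ^+ 2 * (1 + rho (k * u) v) <= (1 - m) ^+ 2.
    by rewrite ler_piMr ?sqr_ge0//; lra.
  have : (1 - m) ^+ 2 < 1 by rewrite expr_lt1//; lra.
  lra.
rewrite (_ : _ - _ = (m * (u + k)) +i* (m * v)); last first.
  by apply/eqP; rewrite eq_complex /=; apply/andP; split; apply/eqP; ring.
rewrite complex_norm_lt// !exprMn -mulrDr nE.
apply: (@le_lt_trans _ _ (m ^+ 2)); first by rewrite ler_piMr ?sqr_ge0//; lra.
by rewrite ltr_pXn2r ?nnegrE// ltW.
Qed.

Lemma filippov_zone (X : zone -> R[i] -> R[i]) s w :
  closure (Sigma s : set (R[i])^o) w -> filippov X w (X s w).
Proof.
move=> cl; exists (fun r => (r == s)%:R); split.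
- by move=> r; case: eqP.
- by rewrite (bigD1 s)//= eqxx big1 ?addr0// => r /negbTE->.
- by move=> r; have [->//|_] := eqVneq r s; rewrite eqxx.
- rewrite (bigD1 s)//= eqxx mul1r big1 ?addr0// => r /negbTE->; exact: mul0r.
Qed.

Lemma filippov_in e u v : rho u v <= 0 ->
  filippov (F e) ((u + 1) +i* v) (in1 e u v +i* in2 e u v).
Proof.
move=> r0; rewrite -(fieldE a c0 c2 c3 c4 e Zplus); apply: filippov_zone.
apply: (@disc_closure _ 1); rewrite ?normr1 ?mul1r// => x y.
by rewrite mul1r => /Sigma_plus.
Qed.

Lemma filippov_out e u v : 0 < rho u v ->
  filippov (F e) ((u + 1) +i* v) (out1 e u v +i* out2 e u v).
Proof.
move=> r0; have [r1|r1] := leP (rho (- u) v) 0.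
  rewrite -(fieldE a c0 c2 c3 c4 e Zminus); apply: filippov_zone.
  apply: (@disc_closure _ (-1)); rewrite ?normrN1 ?mulN1r// => x y.
  by rewrite mulN1r => /Sigma_minus.
rewrite -(fieldE a c0 c2 c3 c4 e Zc); apply: filippov_zone.
by apply: subset_closure; apply/Sigma_c.
Qed.

Lemma zone_sum (V : nmodType) (f : zone -> V) : \sum_s f s = f Zplus + f Zc + f Zminus.
Proof.
have n1 : Zc != Zplus by apply/eqP.
have n2 : Zminus != Zplus by apply/eqP.
have n3 : Zminus != Zc by apply/eqP.
rewrite (bigD1 Zplus)//= (bigD1 Zc)//= (bigD1 Zminus) ?n2//= big_pred0 ?addr0 ?addrA//.
by case; rewrite eqxx ?andbF.
Qed.

(** The fields of [Zc] and [Zminus] coincide, so the hull lies on the segment between the outer and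
    inner velocities; [l] is the weight of [Zplus]. *)
Lemma filippov_field e u v p q : filippov (F e) ((u + 1) +i* v) (p +i* q) ->
  exists l : R, [/\ 0 <= l <= 1, p = l * in1 e u v + (1 - l) * out1 e u v,
    q = l * in2 e u v + (1 - l) * out2 e u v,
    rho u v < 0 -> l = 1 & 0 < rho u v -> l = 0].
Proof.
move=> [lam [lam0 lam1 lamc]]; rewrite !zone_sum !fieldE in lam1 *.
have E : lam Zc + lam Zminus = 1 - lam Zplus by rewrite -lam1; ring.
simpc => -[-> ->]; exists (lam Zplus); split.
- by rewrite lam0 /= -subr_ge0 -E addr_ge0.
- by rewrite -E; ring.
- by rewrite -E; ring.
- move=> r0; suff /eqP : lam Zc + lam Zminus = 0 by rewrite E subr_eq0 => /eqP.
  have z s : (if s is Zplus then False else True) -> lam s = 0.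
    move=> sP; apply/eqP/negP => /negP/lamc/closure_Sigma.
    by case: s sP => //= _; rewrite leNgt r0.
  by rewrite !z// addr0.
- move=> r0; apply/eqP/negP => /negP/lamc/closure_Sigma /=.
  by rewrite leNgt r0.
Qed.

End Filippov.

(** * Filippov solutions are trajectories *)

Section SolutionTrajectory.
Context {R : realType}.
Implicit Types (e u v t s h : R).
Local Notation mu := (@lebesgue_measure R).

Lemma ae_impl (P Q : R -> Prop) : (forall x, P x -> Q x) ->
  {ae mu, forall x, P x} -> {ae mu, forall x, Q x}.
Proof.
by move=> PQ [N [mN N0 PN]]; exists N; split=> // x /= nQ; apply: PN => /= /PQ.
Qed.

Lemma primitive_increment_near (z v : R -> R) t c (d eta : R) : 0 <= eta ->
  locally_integrable setT v ->
  (forall s t, s <= t -> z t - z s = \int[mu]_(x in `[s, t]) v x) ->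
  {ae mu, forall x, `|x - t| < d -> `|v x - c| <= eta} ->
  forall s, `|s - t| < d -> `|z s - z t - c * (s - t)| <= eta * `|s - t|.
Proof.
move=> eta0 iv zE ae s sd; have [st|/ltW ts] := leP t s.
  rewrite zE// [`|s - t|]ger0_norm ?subr_ge0//; apply: itv_integral_near => //.
  apply: ae_impl ae => x H /andP[tx xs]; apply: H.
  by move: sd; rewrite !ger0_norm ?subr_ge0//; lra.
rewrite -normrN (_ : - (z s - z t - c * (s - t)) = z t - z s - c * (t - s)); last by ring.
rewrite zE// (distrC s t) [`|t - s|]ger0_norm ?subr_ge0//; apply: itv_integral_near => //.
apply: ae_impl ae => x H /andP[tx xs]; apply: H.
by move: sd; rewrite !ler0_norm ?subr_le0//; lra.
Qed.

Variables a c0 c2 c3 c4 : R.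
Local Notation F := (field (coef_re a c0 c2 c3 c4) coef_im).
Local Notation in1 := (in1 a c0 c2 c3 c4).
Local Notation in2 := (in2 a c2 c3 c4).
Local Notation out1 := (out1 a).
Local Notation out2 := (out2 a).
Local Notation trajectory := (trajectory a c0 c2 c3 c4).

Lemma perturbation_bound : exists2 K : R, 0 < K & forall e u v,
  `|u| <= 2 -> `|v| <= 2 ->
  [/\ `|in1 e u v - v| <= `|e| * K, `|in2 e u v + u| <= `|e| * K,
    `|out1 e u v - v| <= `|e| * K & `|out2 e u v + u| <= `|e| * K].
Proof.
have [K1 k1 H1] := box_lip_bound (box_lip_in1 a c0 c2 c3 c4 1).
have [K2 k2 H2] := box_lip_bound (box_lip_in2 a c2 c3 c4 1).
have [K3 k3 H3] := box_lip_bound (box_lip_out1 a 1).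
have [K4 k4 H4] := box_lip_bound (box_lip_out2 a 1).
pose K := K1 + K2 + K3 + K4 + 2; exists K; first by rewrite /K; lra.
move=> e u v hu hv; have {}H1 := H1 u v hu hv; have {}H2 := H2 u v hu hv.
have {}H3 := H3 u v hu hv; have {}H4 := H4 u v hu hv.
have E1 : in1 e u v - v = e * (in1 1 u v - v) by rewrite /in1; ring.
have E2 : in2 e u v + u = e * (in2 1 u v + u) by rewrite /in2; ring.
have E3 : out1 e u v - v = e * (out1 1 u v - v) by rewrite /out1; ring.
have E4 : out2 e u v + u = e * (out2 1 u v + u) by rewrite /out2; ring.
rewrite E1 E2 E3 E4 !normrM; split; rewrite ler_wpM2l//.
- by rewrite (le_trans (ler_normB _ _))// /K; lra.
- by rewrite (le_trans (ler_normD _ _))// /K; lra.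
- by rewrite (le_trans (ler_normB _ _))// /K; lra.
- by rewrite (le_trans (ler_normD _ _))// /K; lra.
Qed.

Lemma norm_convex (l x y c eta : R) : 0 <= l <= 1 -> `|x - c| <= eta -> `|y - c| <= eta ->
  `|l * x + (1 - l) * y - c| <= eta.
Proof.
move=> /andP[l0 l1]; rewrite !ler_norml => /andP[h1 h2] /andP[h3 h4]; nra.
Qed.

Section Solution.
Variables (e K eta : R) (z : R -> R[i]).
Hypothesis bound : forall e u v, `|u| <= 2 -> `|v| <= 2 ->
  [/\ `|in1 e u v - v| <= `|e| * K, `|in2 e u v + u| <= `|e| * K,
    `|out1 e u v - v| <= `|e| * K & `|out2 e u v + u| <= `|e| * K].
Hypothesis eta_itv : 0 < eta <= 1.
Hypothesis eK : `|e| * K <= eta.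
Hypothesis z_solution : solution (F e) z.
Let zx t := complex.Re (z t) - 1.
Let zy t := complex.Im (z t).
Hypothesis z_annulus : forall t, 0 < zx t ^+ 2 + zy t ^+ 2 < 4.
Hypothesis z_boundary : forall t, rho (zx t) (zy t) = 0 -> 16 * eta <= `|zy t|.

Let box t : `|zx t| < 2 /\ `|zy t| < 2.
Proof. by apply: annulus_box; case/andP: (z_annulus t). Qed.

Lemma solution_velocity : exists v1 v2 : R -> R,
  [/\ locally_integrable setT v1, locally_integrable setT v2,
    forall s t, s <= t -> zx t - zx s = \int[mu]_(x in `[s, t]) v1 x,
    forall s t, s <= t -> zy t - zy s = \int[mu]_(x in `[s, t]) v2 x &
    {ae mu, forall t, [/\ `|v1 t - zy t| <= eta, `|v2 t - - zx t| <= eta,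
      rho (zx t) (zy t) < 0 -> v1 t = in1 e (zx t) (zy t) /\ v2 t = in2 e (zx t) (zy t) &
      0 < rho (zx t) (zy t) -> v1 t = out1 e (zx t) (zy t) /\ v2 t = out2 e (zx t) (zy t)]}].
Proof.
have [v [i1 i2 ae vE]] := z_solution.
exists (fun t => complex.Re (v t)), (fun t => complex.Im (v t)); split=> //.
- by move=> s t st; have [<- _] := vE s t st; rewrite /zx; ring.
- by move=> s t st; have [_ <-] := vE s t st.
apply: ae_impl ae => t; have [b1 b2] := box t.
have zE : z t = (zx t + 1) +i* zy t by rewrite /zx /zy subrK; case: (z t).
rewrite zE; have -> : v t = complex.Re (v t) +i* complex.Im (v t) by case: (v t).
move=> /filippov_field[l [l01 -> -> r0 r1]].
have [k1 k2 k3 k4] := bound e (ltW b1) (ltW b2).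
split=> [|||].
- by rewrite /= norm_convex//; apply: le_trans eK.
- by rewrite /= norm_convex// opprK; apply: le_trans eK.
- by move=> /r0 ->; split=> /=; ring.
- by move=> /r1 ->; split=> /=; ring.
Qed.

(** On the circle the unperturbed motion changes [rho] at the rate [2 * zy]. All Filippov velocities
    are within [eta] of the unperturbed one, so a height of at least [16 * eta] rules out sliding
    and fixes the sign of [rho] just afterwards. *)
Lemma solution_trajectory t : trajectory e zx zy t.
Proof.
have [v1 [v2 [i1 i2 E1 E2 ae]]] := solution_velocity.
have /andP[eta0 eta1] := eta_itv.
(* The components of velocity are at most [2 + eta], hence at most 3. *)
have lip (v w : R -> R) : locally_integrable setT v ->
    (forall s t, s <= t -> w t - w s = \int[mu]_(x in `[s, t]) v x) ->
    {ae mu, forall t, `|v t| <= 3} -> forall s t, `|w s - w t| <= 3 * `|s - t|.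
  move=> iv wE aev r q.
  have := @primitive_increment_near w v q 0 (`|r - q| + 1) 3 _ iv wE _ r.
  rewrite mul0r subr0; apply; rewrite ?ltrDl//.
  by apply: ae_impl aev => x h _; rewrite subr0.
have lx : forall s t, `|zx s - zx t| <= 3 * `|s - t|.
  apply: (lip v1) => //; apply: ae_impl ae => r [h _ _ _].
  have [_ b2] := box r; have := ler_distD (zy r) (v1 r) 0; rewrite !subr0; move: h b2 eta1; lra.
have ly : forall s t, `|zy s - zy t| <= 3 * `|s - t|.
  apply: (lip v2) => //; apply: ae_impl ae => r [_ h _ _].
  have [b1 _] := box r; have := ler_distD (- zx r) (v2 r) 0; rewrite !subr0 normrN.
  move: h b1 eta1; lra.
have lcont (w : R -> R) : (forall s t, `|w s - w t| <= 3 * `|s - t|) -> continuous w.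
  move=> wl r; apply/cvgrPdist_lt => d d0; exists (d / 3) => /=; first by rewrite divr_gt0.
  move=> q /= rq; apply: le_lt_trans (wl r q) _; move: rq; lra.
have cx := lcont _ lx; have cy := lcont _ ly.
have [b1 b2] := box t.
have deriv (f : R -> R -> R) (v w : R -> R) d : box_lip f -> locally_integrable setT v ->
    (forall s t, s <= t -> w t - w s = \int[mu]_(x in `[s, t]) v x) -> 0 < d ->
    {ae mu, forall s, `|s - t| < d -> v s = f (zx s) (zy s)} ->
    is_derive t 1 w (f (zx t) (zy t)).
  move=> fl iv wE d0 aev; apply: is_derive_eps => eps eps0.
  have cf := box_lip_continuous fl (cx t) (cy t) b1 b2.
  have /nbhs_ballP[d1 /= d10 dP] := continuous_dist_lt cf eps0.
  exists (Num.min d d1); first by rewrite lt_min d0.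
  move=> h hd.
  have := @primitive_increment_near w v t (f (zx t) (zy t)) (Num.min d d1) eps (ltW eps0) iv wE _ (t + h).
  rewrite [t + h]addrC addrK; apply => //.
  apply: ae_impl aev => x H; rewrite lt_min => /andP[x1 x2]; rewrite H//.
  by rewrite distrC ltW//; apply: dP; rewrite /ball/= distrC.
split.
- exact: z_annulus.
- by split; [exact: cx|exact: cy].
- move=> r0; have [d d0 dP] := rho_sign_near (cx t) (cy t) (ltr0_neq0 r0).
  rewrite r0 in dP.
  split.
    apply: (deriv (in1 e) v1 zx d) => //; first exact: box_lip_in1.
    by apply: ae_impl ae => s [_ _ H _] /dP[/H[-> _] _].
  apply: (deriv (in2 e) v2 zy d) => //; first exact: box_lip_in2.
  by apply: ae_impl ae => s [_ _ H _] /dP[/H[_ ->] _].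
- move=> r0; have [d d0 dP] := rho_sign_near (cx t) (cy t) (lt0r_neq0 r0).
  have dP' s : `|s - t| < d -> 0 < rho (zx s) (zy s).
    move=> /dP[h1 h2]; rewrite lt_neqAle eq_sym h2 leNgt h1.
    by rewrite -leNgt ltW.
  split.
    apply: (deriv (out1 e) v1 zx d) => //; first exact: box_lip_out1.
    by apply: ae_impl ae => s [_ _ _ H] /dP'/H[-> _].
  apply: (deriv (out2 e) v2 zy d) => //; first exact: box_lip_out2.
  by apply: ae_impl ae => s [_ _ _ H] /dP'/H[_ ->].
- move=> r0; have yeta := z_boundary r0.
  (* For [h] below [eta / 9] the square of an increment is at most [(3 h)^2 <= eta h]. The tolerance
     [2 * eta] adds the motion of the point to the error of the velocity. *)
  pose d := eta / 9; have d0 : 0 < d by rewrite divr_gt0.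
  have inc_x := @primitive_increment_near zx v1 t (zy t) d (2 * eta).
  have inc_y := @primitive_increment_near zy v2 t (- zx t) d (2 * eta).
  have dist_t (w : R -> R) x : (forall s t, `|w s - w t| <= 3 * `|s - t|) -> `|x - t| < d ->
      `|w x - w t| <= eta.
    by move=> wl xd; apply: le_trans (wl x t) _; move: xd; rewrite /d; lra.
  have {}inc_x s : `|s - t| < d -> `|zx s - zx t - zy t * (s - t)| <= 2 * eta * `|s - t|.
    apply: inc_x => //; first by rewrite mulr_ge0 ?ltW.
    apply: ae_impl ae => x [h _ _ _] xd; have := dist_t zy x ly xd.
    by have := ler_distD (zy x) (v1 x) (zy t); move: h; lra.
  have {}inc_y s : `|s - t| < d -> `|zy s - zy t - - zx t * (s - t)| <= 2 * eta * `|s - t|.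
    apply: inc_y => //; first by rewrite mulr_ge0 ?ltW.
    apply: ae_impl ae => x [_ h _ _] xd; have := dist_t zx x lx xd.
    have := ler_distD (- zx x) (v2 x) (- zx t); rewrite -[- zx x - - zx t]opprD normrN.
    by move: h; lra.
  have circ : (zx t + 1) ^+ 2 + zy t ^+ 2 = 1.
    by move: r0; rewrite /rho => r0; rewrite -[RHS]addr0 -r0; ring.
  have bounded (w q : R) : w ^+ 2 + q ^+ 2 = 1 -> `|w| <= 1.
    move=> wq; rewrite -(ler_pXn2r (n := 2)) ?nnegrE// expr1n real_normK ?num_real//.
    by rewrite -wq lerDl sqr_ge0.
  have x1 := bounded _ _ circ; have y1 : `|zy t| <= 1.
    by apply: (bounded _ (zx t + 1)); rewrite addrC.
  (* The constant 10 is 4 from each of the two linear terms and 1 from each square. *)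
  have step s : t < s < t + d ->
      `|rho (zx s) (zy s) - 2 * zy t * (s - t)| <= 10 * eta * (s - t).
    move=> /andP[ts sd]; have h0 : 0 < s - t by rewrite subr_gt0.
    have hd : `|s - t| < d by rewrite gtr0_norm// ltrBlDl.
    have := inc_x s hd; have := inc_y s hd; have := lx s t; have := ly s t.
    rewrite gtr0_norm// in hd *.
    set h := s - t in h0 hd *; set p := zx s - zx t; set q := zy s - zy t.
    move=> q3 p3 hq hp.
    have -> : rho (zx s) (zy s) - 2 * zy t * h = 2 * ((zx t + 1) * (p - zy t * h)) +
        2 * (zy t * (q - - zx t * h)) + (p * p + q * q).
      by rewrite -[LHS]subr0 -r0 /rho /p /q; ring.
    have sq (w : R) : `|w| <= 3 * h -> `|w * w| <= eta * h.
      move=> wh; rewrite normrM; apply: (@le_trans _ _ ((3 * h) * (3 * h))).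
        by rewrite ler_pM.
      by rewrite (_ : _ * _ = 9 * h * h) ?ler_pM2r//; [move: hd; rewrite /d; lra|ring].
    have m1 (w k : R) : `|w| <= 1 -> `|k| <= 2 * eta * h -> `|2 * (w * k)| <= 4 * eta * h.
      move=> w1 kh; rewrite 2!normrM (ger0_norm (_ : (0 : R) <= 2))//.
      have : `|w| * `|k| <= 1 * (2 * eta * h) by rewrite ler_pM.
      by lra.
    have e1 := m1 _ _ x1 hp; have e2 := m1 _ _ y1 hq.
    have e3 := sq _ p3; have e4 := sq _ q3.
    have := ler_normD (2 * ((zx t + 1) * (p - zy t * h)) + 2 * (zy t * (q - - zx t * h))) (p * p + q * q).
    have := ler_normD (2 * ((zx t + 1) * (p - zy t * h))) (2 * (zy t * (q - - zx t * h))).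
    have := ler_normD (p * p) (q * q).
    by move: e1 e2 e3 e4; lra.
  split=> zy0; exists d => // s st; have := step s st.
    have h0 : 0 < s - t by case/andP: st; rewrite subr_gt0.
    rewrite ler_norml => /andP[h1 _].
    have : 16 * eta * (s - t) <= zy t * (s - t) by rewrite ler_pM2r//; move: yeta; rewrite gtr0_norm.
    have : 0 < eta * (s - t) by rewrite mulr_gt0.
    by move: h1; lra.
  have h0 : 0 < s - t by case/andP: st; rewrite subr_gt0.
  rewrite ler_norml => /andP[_ h1].
  have : 16 * eta * (s - t) <= - zy t * (s - t) by rewrite ler_pM2r//; move: yeta; rewrite ltr0_norm.
  have : 0 < eta * (s - t) by rewrite mulr_gt0.
  by move: h1; lra.
Qed.

End Solution.
End SolutionTrajectory.

(** * Periodic scalar solutions give periodic orbits *)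

Section PeriodicCurves.
Context {R : realType}.
Implicit Types (s t u v : R) (X : R -> R).
Variables a c0 c2 c3 c4 : R.
Local Notation F := (field (coef_re a c0 c2 c3 c4) coef_im).
Local Notation din := (din a c0 c2 c3 c4).
Local Notation dout := (dout a).
Local Notation theta := (theta a c0 c2 c3 c4).
Local Notation field_x := (field_x a c0 c2 c3 c4).
Local Notation trajectory := (trajectory a c0 c2 c3 c4).

Definition orbit_point x s : R[i] := (wx x s + 1) +i* wy x s.
Definition orbit X : set R[i] := range (fun s => orbit_point (X s) s).

(** Switching times are isolated: at a zero, [sin (tau r)] is [cos (tau t) * sin (tau r - tau t)],
    and [tau] is strictly increasing. *)
Lemma sin_sides (tau : R -> R) t : continuous tau -> (forall x y, x < y -> tau x < tau y) ->
  exists2 d : R, 0 < d &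
    ((forall r, t < r < t + d -> 0 < sin (tau r)) \/
     (forall r, t < r < t + d -> sin (tau r) < 0)) /\
    ((forall r, t - d < r < t -> 0 < sin (tau r)) \/
     (forall r, t - d < r < t -> sin (tau r) < 0)).
Proof.
move=> ctau mono.
have cs : {for t, continuous (fun r => sin (tau r))}.
  exact: (@continuous_comp1 R _ _ (@continuous_sin R) ctau t).
have dist (d r : R) : 0 < d -> t - d < r < t + d -> `|t - r| < d.
  by move=> d0 /andP[h1 h2]; rewrite ltr_norml; lra.
have [s0|s0|s0] := ltgtP (sin (tau t)) 0.
- have n0 : 0 < - sin (tau t) by rewrite oppr_gt0.
  have /nbhs_ballP[d /= d0 dP] := continuous_dist_lt cs n0.
  have H r : t - d < r < t + d -> sin (tau r) < 0.
    by move=> /(dist d r d0)/dP; rewrite ltr_norml => /andP[h1 h2]; lra.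
  exists d => //; split; right => r /andP[h1 h2]; apply: H; lra.
- have /nbhs_ballP[d /= d0 dP] := continuous_dist_lt cs s0.
  have H r : t - d < r < t + d -> 0 < sin (tau r).
    by move=> /(dist d r d0)/dP; rewrite ltr_norml => /andP[h1 h2]; lra.
  exists d => //; split; left => r /andP[h1 h2]; apply: H; lra.
have n1 : 0 < pi / 2 :> R by rewrite divr_gt0 ?pi_gt0.
have /nbhs_ballP[d /= d0 dP] := continuous_dist_lt (@ctau t) n1.
have sE r : sin (tau r) = cos (tau t) * sin (tau r - tau t).
  by rewrite -{1}(subrK (tau t) (tau r)) [LHS]sinD s0 mulr0 addr0 mulrC.
have up r : t < r < t + d -> 0 < sin (tau r - tau t).
  move=> /andP[h1 h2]; have m := mono _ _ h1; rewrite sin_gt0_itv// subr_gt0 m /=.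
  by have := dP r; rewrite distrC gtr0_norm ?subr_gt0//; apply; apply: dist => //; lra.
have dn r : t - d < r < t -> sin (tau r - tau t) < 0.
  move=> /andP[h1 h2]; have m := mono _ _ h2.
  rewrite -opprB sinN oppr_lt0 sin_gt0_itv// subr_gt0 m /=.
  by have := dP r; rewrite gtr0_norm ?subr_gt0//; apply; apply: dist => //; lra.
exists d => //; have [C|C] := cos_pm1 s0; split.
- by left=> r /up h; rewrite sE C mul1r.
- by right=> r /dn h; rewrite sE C mul1r.
- by right=> r /up h; rewrite sE C mulN1r oppr_lt0.
- by left=> r /dn h; rewrite sE C mulN1r oppr_gt0.
Qed.

Section Lift.
Variables (e p d : R) (X : R -> R).
Hypothesis d_gt0 : 0 < d.
Hypothesis good : forall x s, `|x - p| <= d ->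
  [/\ 0 < x < pi / 2, 2^-1 <= din e x s <= 2 & 2^-1 <= dout e x s <= 2].
Hypothesis X_flow : flow field_x p d e X.

Lemma flow_time_map s0 : exists tm tau : R -> R, [/\ tm s0 = 0 /\ tau 0 = s0,
    forall s, is_derive s 1 tm (theta e (clamp p d (X s)) s), cancel tm tau /\ cancel tau tm,
    (forall x y, x < y -> tm x < tm y) /\ (forall x y, x < y -> tau x < tau y) &
    continuous tau /\ forall t, theta e (clamp p d (X (tau t))) (tau t) != 0 ->
      is_derive t 1 tau (theta e (clamp p d (X (tau t))) (tau t))^-1].
Proof.
have [tm [tau [h1 h2 [tmK tauK] mono h5]]] := time_map s0
  (continuous_theta_clamp d_gt0 good X_flow) (pd_gt0 d_gt0 good)
  (theta_clamp_lower X d_gt0 good).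
exists tm, tau; split=> //; split=> // x y xy; rewrite ltNge; apply/negP => yx.
move: xy; rewrite -(tauK x) -(tauK y) ltNge => /negP; apply.
move: yx; rewrite le_eqVlt => /predU1P[->//|yx]; exact/ltW/mono.
Qed.

Lemma lift_solution (tau : R -> R) : continuous tau -> (forall x y, x < y -> tau x < tau y) ->
  (forall t, theta e (clamp p d (X (tau t))) (tau t) != 0 ->
    is_derive t 1 tau (theta e (clamp p d (X (tau t))) (tau t))^-1) ->
  (forall s, `|X s - p| <= d) ->
  solution (F e) (fun t => orbit_point (X (tau t)) (tau t)).
Proof.
move=> ctau mono dtau Xd.
have itv s : 0 < X s < pi / 2 by have [] := good s (Xd s).
have [cx cy] := continuous_lift X_flow ctau.
set zx := liftx X tau in cx; set zy := lifty X tau in cy.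
have cs : continuous (fun t => sin (tau t)) by exact: continuous_comp1 (@continuous_sin R) ctau.
have box t : `|zx t| < 2 /\ `|zy t| < 2.
  by have /andP[_ h] := w_annulus (tau t) (itv (tau t)); exact: annulus_box h.
have cbox (f : R -> R -> R) : box_lip f -> continuous (fun t => f (zx t) (zy t)).
  by move=> fl t; have [b1 b2] := box t; apply: box_lip_continuous => //; [exact: cx|exact: cy].
have ci1 := cbox _ (box_lip_in1 a c0 c2 c3 c4 e); have ci2 := cbox _ (box_lip_in2 a c2 c3 c4 e).
have co1 := cbox _ (box_lip_out1 a e); have co2 := cbox _ (box_lip_out2 a e).
(* At a crossing the velocity of the disc is taken; it belongs to the hull on the circle. *)
pose v1 t := if 0 <= sin (tau t) then in1 a c0 c2 c3 c4 e (zx t) (zy t) else out1 a e (zx t) (zy t).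
pose v2 t := if 0 <= sin (tau t) then in2 a c2 c3 c4 e (zx t) (zy t) else out2 a e (zx t) (zy t).
have l1 : locally_integrable setT v1 by exact: glue_locally_integrable.
have l2 : locally_integrable setT v2 by exact: glue_locally_integrable.
have ins t : 0 < sin (tau t) ->
    (is_derive t 1 zx (in1 a c0 c2 c3 c4 e (zx t) (zy t)) /\ v1 t = in1 a c0 c2 c3 c4 e (zx t) (zy t)) /\
    (is_derive t 1 zy (in2 a c2 c3 c4 e (zx t) (zy t)) /\ v2 t = in2 a c2 c3 c4 e (zx t) (zy t)).
  by move=> s0; have [d1 d2] := lift_inside d_gt0 good X_flow ctau dtau (Xd (tau t)) s0; rewrite /v1 /v2 ltW.
have outs t : sin (tau t) < 0 ->
    (is_derive t 1 zx (out1 a e (zx t) (zy t)) /\ v1 t = out1 a e (zx t) (zy t)) /\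
    (is_derive t 1 zy (out2 a e (zx t) (zy t)) /\ v2 t = out2 a e (zx t) (zy t)).
  by move=> s0; have [d1 d2] := lift_outside d_gt0 good X_flow ctau dtau (Xd (tau t)) s0; rewrite /v1 /v2 leNgt s0.
have I1 := @itv_integral_piecewise R _ _ v1 zx ci1 co1 cx l1.
have I2 := @itv_integral_piecewise R _ _ v2 zy ci2 co2 cy l2.
exists (fun t => v1 t +i* v2 t); split=> //.
- apply: aeW => t; rewrite /v1 /v2; case: ifPn => s0.
    apply: filippov_in; have [-> ->] := wx_in (X (tau t)) s0.
    move: s0; rewrite le_eqVlt => /predU1P[/esym s0|s0]; first by rewrite rho_boundary.
    exact/ltW/rho_in.
  move: s0; rewrite -ltNge => s0; apply: filippov_out.
  by have [-> ->] := wx_out (X (tau t)) (ltW s0); exact: rho_out.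
- move=> s t st; split.
    rewrite -I1//; first by rewrite /orbit_point /= /zx /liftx; ring.
    move=> r; have [q q0 [P1 P2]] := sin_sides r ctau mono; exists q => //.
    split; first by case: P1 => H; [left|right] => x /H/[dup]; [move=> _ /ins[]|move=> _ /outs[]].
    by case: P2 => H; [left|right] => x /H; [move=> /ins[]|move=> /outs[]].
  rewrite -I2//.
  move=> r; have [q q0 [P1 P2]] := sin_sides r ctau mono; exists q => //.
  split; first by case: P1 => H; [left|right] => x /H; [move=> /ins[]|move=> /outs[]].
  by case: P2 => H; [left|right] => x /H; [move=> /ins[]|move=> /outs[]].
Qed.

Lemma orbit_periodic : (forall s, `|X s - p| <= d) -> (forall s, X (s + pi *+ 2) = X s) ->
  periodic_orbit (F e) (orbit X).
Proof.
move=> Xd XT; have [tm [tau [[tm0 tau0] dtm [tmK tauK] [mono mono'] [ctau dtau]]]] := flow_time_map 0.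
have T0 : 0 < pi *+ 2 :> R by rewrite mulrn_wgt0// pi_gt0.
(* [theta] along a periodic [X] is periodic, so every turn takes the same time, which is the period
   of the orbit. *)
have tmT s : tm (s + pi *+ 2) = tm s + tm (pi *+ 2).
  have dsh (r : R) : is_derive r 1 (fun r : R => tm (r + pi *+ 2)) (theta e (clamp p d (X r)) r).
    have d1 : is_derive r 1 (fun r : R => r + pi *+ 2) 1.
      by apply: (is_derive_eq (deriveD1 (is_derive_id r 1) (derive_cst1 (pi *+ 2) r))); rewrite addr0.
    have d2 := @derive_comp1 R tm (fun r : R => r + pi *+ 2) r _ _ (dtm _) d1.
    apply: (is_derive_eq d2); rewrite mulr1 XT /theta /thin /thout /din /dout /gr /gi /inx /iny.
    by rewrite !cosD2pi sinp_periodic sinm_periodic.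
  have [h|/ltW h] := leP 0 s.
    by have := eq_increment h dsh dtm (fun _ _ => erefl); rewrite add0r tm0; lra.
  by have := eq_increment h dsh dtm (fun _ _ => erefl); rewrite add0r tm0; lra.
have tauT t : tau (t + tm (pi *+ 2)) = tau t + pi *+ 2.
  by rewrite -{1}(tauK t) -tmT tmK.
exists (fun t => orbit_point (X (tau t)) (tau t)), (tm (pi *+ 2)); split.
- exact: lift_solution.
- by rewrite -tm0; exact: mono.
- move=> t; rewrite tauT XT /orbit_point /wx /wy sinD cos2pi sin2pi mulr1 mulr0 addr0.
  by rewrite /inx /iny /outx /outy cosD2pi.
- apply: contrapT => /forallNP const.
  have cst s : orbit_point (X s) s = orbit_point (X (tau 0)) (tau 0).
    by have := const (tm s); rewrite tmK => /negP; rewrite negbK => /eqP.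
  have itv s : 0 < X s < pi / 2 by have [] := good s (Xd s).
  (* The points at [pi / 2] and [- (pi / 2)] lie on opposite sides of the circle, so the curve is
     not constant. *)
  have s1 : sin (pi / 2) = 1 :> R by rewrite sin_pihalf.
  have : orbit_point (X (pi / 2)) (pi / 2) = orbit_point (X (- (pi / 2))) (- (pi / 2)).
    by rewrite !cst.
  move=> [/addIr Ex Ey].
  have := @rho_in R _ (pi / 2) (itv (pi / 2)); have := @rho_out R _ (- (pi / 2)) (itv (- (pi / 2))).
  rewrite sinN s1 oppr_lt0 ltr01 => /(_ isT) h1 /(_ isT) h2.
  move: Ex Ey.
  have [-> ->] : wx (X (pi / 2)) (pi / 2) = inx (X (pi / 2)) (pi / 2) /\ wy (X (pi / 2)) (pi / 2) = iny (X (pi / 2)) (pi / 2).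
    by apply: wx_in; rewrite s1.
  have [-> ->] : wx (X (- (pi / 2))) (- (pi / 2)) = outx (X (- (pi / 2))) (- (pi / 2)) /\ wy (X (- (pi / 2))) (- (pi / 2)) = outy (X (- (pi / 2))) (- (pi / 2)).
    by apply: wx_out; rewrite sinN s1 lerN10.
  by move=> Ex Ey; move: h1 h2; rewrite Ex Ey => h1 /(lt_trans h1); rewrite ltxx.
- apply/seteqP; split=> w [s _ <-].
    by exists (tm s) => //; rewrite tmK.
  by exists (tau s).
Qed.

End Lift.
End PeriodicCurves.

(** * Neighbourhoods of an orbit in the coordinates *)

Section Isolation.
Context {R : realType}.
Implicit Types (s t u v x y : R) (X : R -> R).

Lemma cos_add_mul s n : cos (s + (pi *+ 2) *+ n) = cos s :> R.
Proof.
by elim: n => [|n IH]; rewrite ?mulr0n ?addr0// mulrSr addrA cosD2pi.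
Qed.

Lemma sin_add_mul s n : sin (s + (pi *+ 2) *+ n) = sin s :> R.
Proof.
elim: n => [|n IH]; rewrite ?mulr0n ?addr0// mulrSr addrA.
by rewrite sinD cos2pi sin2pi mulr1 mulr0 addr0.
Qed.

Lemma cos_eq1_mul t : 0 < t -> cos t = 1 -> exists2 n, (0 < n)%N & t = (pi *+ 2) *+ n.
Proof.
move=> t0 ct; pose T : R := pi *+ 2; have T0 : 0 < T by rewrite mulrn_wgt0// pi_gt0.
have tT : 0 <= t / T by rewrite divr_ge0// ltW.
have /truncn_itv := tT; set n := Num.truncn _ => /andP[h1 h2].
pose r := t - T *+ n.
have tE : t = r + T *+ n by rewrite subrK.
have r0 : 0 <= r by rewrite subr_ge0 -mulr_natl -ler_pdivlMr.
have rT : r < T.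
  rewrite ltrBlDr -mulr_natl -[X in X + _]mul1r -mulrDl -ltr_pdivrMr//.
  by rewrite addrC natr1.
have cr : cos r = 1 by rewrite -ct tE cos_add_mul.
have rE : r = 0.
  apply/eqP; rewrite eq_le r0 andbT leNgt; apply/negP => rp.
  have : 0 < sin (r / 2).
    by rewrite sin_gt0_pi// divr_gt0//= ltr_pdivrMr// mulr_natr.
  move=> s0; move: cr; have -> : r = r / 2 + r / 2 by lra.
  rewrite cosD -!expr2 => h; have := cos2Dsin2 (r / 2).
  have : 0 < sin (r / 2) ^+ 2 by rewrite exprn_gt0.
  by move: h; lra.
exists n; last by rewrite tE rE add0r.
by rewrite lt0n; apply/negP => /eqP n0; move: t0; rewrite tE rE n0 mulr0n addr0 ltxx.
Qed.

Lemma orbit_point_add_mul x s n :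
  orbit_point x (s + (pi *+ 2) *+ n) = orbit_point x s.
Proof.
by rewrite /orbit_point /wx /wy sin_add_mul /inx /iny /outx /outy cos_add_mul.
Qed.

Lemma add_mul_ge s t n : (0 < n)%N -> exists k, t <= s + ((pi *+ 2) *+ n) *+ k.
Proof.
move=> n0; have T1 : 1 <= (pi *+ 2) *+ n :> R.
  apply: (@le_trans _ _ (pi *+ 2)).
    by have := pi_ge2 R; rewrite mulr2n; lra.
  by rewrite -[leRHS]mulr_natl ler_peMl ?ler1n// mulrn_wge0// pi_ge0.
have h : 0 <= `|t| + `|s| by rewrite addr_ge0.
have := archi_boundP h; set k := Num.bound _ => hk; exists k.
have : k%:R <= ((pi *+ 2) *+ n) *+ k :> R by rewrite -[leRHS]mulr_natl ler_peMr.
have := ler_norm t; have := ler_norm (- s); rewrite normrN; move: hk; lra.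
Qed.

Lemma orbit_range X s0 n : (0 < n)%N -> (forall s, X (s + (pi *+ 2) *+ n) = X s) ->
  orbit X = [set orbit_point (X s) s | s in [set s | s0 <= s]].
Proof.
move=> n0 XT; apply/seteqP; split=> [w [s _ <-]|w [s _ <-]]; last by exists s.
have [k kP] := add_mul_ge s s0 n0; exists (s + ((pi *+ 2) *+ n) *+ k) => //.
have -> : X (s + ((pi *+ 2) *+ n) *+ k) = X s.
  by elim: k {kP} => [|k IH]; rewrite ?mulr0n ?addr0// mulrSr addrA XT.
by rewrite -mulrnA orbit_point_add_mul.
Qed.

(** Nearby points have nearby moduli, and the modulus determines [x]; [delta] is the smaller gap
    between the radii for [c] and those for [d]. *)
Lemma annulus_close (p d c : R) : 0 < c < d -> 0 < p - d -> p + d < pi / 2 ->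
  exists2 delta : R, 0 < delta & forall x s w, `|x - p| <= c ->
    `|w - orbit_point x s| < delta%:C -> exists y t, `|y - p| <= d /\ w = orbit_point y t.
Proof.
move=> /andP[c0 cd] pd0 pdpi.
have pihalf : pi / 2 <= pi :> R by rewrite ler_pdivrMr// ler_peMr ?pi_ge0// ler1n.
have dec x y : 0 < x -> x < y -> y < pi / 2 -> cos y < cos x.
  move=> x0 xy ypi; apply: cos_norm_lt; rewrite !gtr0_norm ?(lt_trans x0 xy)//.
  exact: le_trans (ltW ypi) pihalf.
have dec' x y : 0 < x -> x <= y -> y < pi / 2 -> cos y <= cos x.
  by rewrite [x <= y]le_eqVlt => x0 /predU1P[->//|xy] ypi; exact/ltW/dec.
have d1 : 0 < 2 * (cos (p + c) - cos (p + d)).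
  by rewrite mulr_gt0// subr_gt0 dec//; lra.
have d2 : 0 < 2 * (cos (p - d) - cos (p - c)).
  by rewrite mulr_gt0// subr_gt0 dec//; lra.
exists (Num.min (2 * (cos (p + c) - cos (p + d))) (2 * (cos (p - d) - cos (p - c)))).
  by rewrite lt_min d1.
set delta := Num.min _ _ => x s w; rewrite ler_distl => /andP[x1 x2].
have [pc0 pcpi pdp pd1] : [/\ 0 < p - c, p + c < pi / 2, p - d < pi / 2 & 0 < p + d].
  by move: c0 cd pd0 pdpi; clear; split; lra.
have x0 : 0 < x := lt_le_trans pc0 x1.
have xpi : x < pi / 2 := le_lt_trans x2 pcpi.
have del0 : 0 < delta by rewrite lt_min d1.
have [u [v ->]] := complexW w; move=> near.
have C0 : 0 < cos x by apply: cos_gt0_itv; rewrite x0.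
have rE : `|wx x s +i* wy x s| = (2 * cos x)%:C.
  rewrite normc_def /= w_norm (_ : 4 * _ = (2 * cos x) ^+ 2); last by ring.
  by rewrite sqrtr_sqr gtr0_norm// mulr_gt0.
pose r : R := Num.sqrt (u ^+ 2 + v ^+ 2).
have uvE : `|u +i* v| = r%:C by rewrite normc_def.
have near' : `|(u +i* v) - (wx x s +i* wy x s)| < delta%:C.
  rewrite (_ : _ - _ = (u + 1) +i* v - orbit_point x s)//.
  by rewrite /orbit_point; apply/eqP; rewrite eq_complex /=; apply/andP; split; apply/eqP; ring.
have r1 : r < 2 * cos x + delta.
  rewrite -ltcR -uvE rmorphD /= -rE -[u +i* v](subrK (wx x s +i* wy x s)).
  by rewrite addrC (le_lt_trans (ler_normD _ _))// ltrD2l.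
have r2 : 2 * cos x < r + delta.
  rewrite -ltcR -rE rmorphD /= -uvE -[wx x s +i* wy x s](subrK (u +i* v)).
  by rewrite addrC (le_lt_trans (ler_normD _ _))// ltrD2l distrC.
have D1 : delta <= 2 * (cos (p + c) - cos (p + d)) by rewrite ge_min lexx.
have D2 : delta <= 2 * (cos (p - d) - cos (p - c)) by rewrite ge_min lexx orbT.
have k1 : cos (p + c) <= cos x by exact: dec'.
have k2 : cos x <= cos (p - c) by exact: dec'.
have k3 : 0 < cos (p + d) by apply: cos_gt0_itv; rewrite pd1.
have k4 : cos (p - d) <= 1 by exact: cos_le1.
have rr : r ^+ 2 = u ^+ 2 + v ^+ 2 by rewrite sqr_sqrtr// addr_ge0// sqr_ge0.
have rp : 0 < r by move: r2 D1 k1 k3; clear; lra.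
have r4 : r < 2 by move: r1 D2 k2 k4 k3 D1 k1; clear; lra.
have [|y [t [yi E1 E2]]] := @w_surj R u v.
  rewrite -rr exprn_gt0//= (_ : (4 : R) = 2 ^+ 2); last by ring.
  by rewrite ltr_pXn2r ?nnegrE// ltW.
have yE : r = 2 * cos y.
  have C : 0 < cos y := cos_gt0_itv yi.
  apply/eqP; rewrite -(eqrXn2 (n := 2)) ?mulr_ge0 ?(ltW C) ?(ltW rp)// rr -E1 -E2 w_norm.
  by apply/eqP; ring.
exists y, t; split; last by rewrite /orbit_point E1 E2.
have /andP[y0 ypi] := yi.
rewrite ler_norml; apply/andP; split; rewrite leNgt; apply/negP => h.
  have yp : y < p - d by move: h; clear; lra.
  by have := dec _ _ y0 yp pdp; move: r1 D2 k2; rewrite yE; clear; lra.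
have yp : p + d < y by move: h; clear; lra.
by have := dec _ _ pd1 yp ypi; move: r2 D1 k1; rewrite yE; clear; lra.
Qed.

(** The crossing points have height [2 cos x sin x] up to sign; this is the transversality required
    of Filippov solutions. *)
Lemma boundary_height (p d x s : R) : 0 < p - d -> p + d < pi / 2 -> `|x - p| <= d ->
  rho (wx x s) (wy x s) = 0 -> 2 * (cos (p + d) * sin (p - d)) <= `|wy x s|.
Proof.
move=> pd0 pdpi; rewrite ler_norml => /andP[x1 x2].
have xi : 0 < x < pi / 2 by apply/andP; split; lra.
have C0 := cos_gt0_itv xi; have S0 := sin_gt0_itv xi.
move=> /(rho_eq0 xi) s0.
have [_ ->] : wx x s = inx x s /\ wy x s = iny x s by apply: wx_in; rewrite s0.
have -> : `|iny x s| = 2 * (cos x * sin x).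
  rewrite /iny normrN; have [->|->] := cos_pm1 s0; rewrite ?mulrN1 ?mulr1 ?sinN ?mulrN ?normrN.
    by rewrite gtr0_norm ?mulr_gt0 ?mulrA.
  by rewrite gtr0_norm ?mulr_gt0 ?mulrA.
have pihalf : pi / 2 <= pi :> R by rewrite ler_pdivrMr// ler_peMr ?pi_ge0// ler1n.
have k : 0 < cos (p + d) by apply: cos_gt0_itv; apply/andP; split; lra.
have k' : 0 < sin (p - d) by apply: sin_gt0_itv; apply/andP; split; lra.
rewrite ler_pM2l// ler_pM ?(ltW k) ?(ltW k')//.
  by apply: cos_norm_le; rewrite !gtr0_norm; lra.
have sC y : sin y = cos (pi / 2 - y) by rewrite cosB cos_pihalf sin_pihalf mul0r add0r mul1r.
rewrite (sC x) (sC (p - d)).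
by apply: cos_norm_le; rewrite !gtr0_norm; lra.
Qed.

End Isolation.

(** * Periodic trajectories come from the scalar flow *)

Section Follow.
Context {R : realType}.
Implicit Types (s t u v x y : R) (X : R -> R).
Variables a c0 c2 c3 c4 : R.
Local Notation F := (field (coef_re a c0 c2 c3 c4) coef_im).
Local Notation din := (din a c0 c2 c3 c4).
Local Notation dout := (dout a).
Local Notation field_x := (field_x a c0 c2 c3 c4).
Local Notation trajectory := (trajectory a c0 c2 c3 c4).

(** The flow through the coordinates of the initial point lifts to a curve that forward uniqueness
    identifies with the given one; injectivity of the coordinates then turns the period [T] into [n]
    full turns. *)
Lemma follow_orbit (e p d d' T : R) (zx zy : R -> R) : 0 < d' < d ->
  (forall x s, `|x - p| <= d ->
    [/\ 0 < x < pi / 2, 2^-1 <= din e x s <= 2 & 2^-1 <= dout e x s <= 2]) ->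
  (forall s0 x0, exists2 X, X s0 = x0 & flow field_x p d e X) ->
  (forall t, trajectory e zx zy t) ->
  (forall t, exists x s, [/\ `|x - p| <= d', zx t = wx x s & zy t = wy x s]) ->
  0 < T -> (forall t, zx (t + T) = zx t /\ zy (t + T) = zy t) ->
  exists X s0 n, [/\ flow field_x p d e X, (0 < n)%N,
    X (s0 + (pi *+ 2) *+ n) = X s0, forall s, s0 <= s -> `|X s - p| <= d' &
    (forall t, exists2 s, s0 <= s & zx t = wx (X s) s /\ zy t = wy (X s) s) /\
    (forall s, s0 <= s -> exists t, zx t = wx (X s) s /\ zy t = wy (X s) s)].
Proof.
move=> /andP[d'0 dd] good fex ztraj zin T0 zT; have d0 := lt_trans d'0 dd.
have [x0 [s0 [x0p Ex0 Ey0]]] := zin 0; have [X X0 Xf] := fex s0 x0.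
have [tm [tau [[tm0 tau0] _ [tmK tauK] [mono mono'] [ctau dtau]]]] :=
  flow_time_map d0 good Xf s0.
have [cx cy] := continuous_lift Xf ctau.
have cXt : continuous (fun t => `|X (tau t) - p|).
  move=> t; apply: cvg_norm; apply: cvgB; last exact: cvg_cst.
  exact: (@continuous_comp1 R _ _ (flow_continuous Xf) ctau t).
have good_itv x : `|x - p| <= d -> 0 < x < pi / 2 by move=> h; have [] := good x 0 h.
have H : forall t, 0 <= t -> [/\ zx t = liftx X tau t, zy t = lifty X tau t & `|X (tau t) - p| <= d'].
  apply: (@trajectory_unique _ a c0 c2 c3 c4 (fun t => `|X (tau t) - p| <= d') e) => //.
  - move=> t t0 below.
    by apply: (continuous_lim_eq t0 (@cXt t) (g := fun=> d')) => //; exact: cvg_cst.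
  - move=> t t0 Q; have n0 : 0 < d - `|X (tau t) - p| by rewrite subr_gt0 (le_lt_trans Q).
    have /nbhs_ballP[q /= q0 qP] := continuous_dist_lt (@cXt t) n0.
    exists q => // s /andP[ts sq].
    have sd : `|X (tau s) - p| < d.
      have : `| `|X (tau t) - p| - `|X (tau s) - p| | < d - `|X (tau t) - p|.
        by apply: qP; rewrite /ball/= distrC ger0_norm ?subr_ge0// ltrBlDl.
      by rewrite ltr_norml => /andP[h _]; lra.
    split; first exact: (lift_trajectory d0 good Xf ctau mono' dtau sd).
    (* Equal points have equal [x], so the bound [d'] passes to [X] and keeps clamping inactive. *)
    have [x [r [xp Ex Ey]]] := zin s; rewrite Ex Ey => E1 E2.
    suff <- : x = X (tau s) by [].
    apply: (w_modulus_inj _ _ E1 E2); apply: good_itv; last exact: ltW.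
    exact: le_trans xp (ltW dd).
  - by rewrite Ex0 /liftx tau0 X0.
  - by rewrite Ey0 /lifty tau0 X0.
  - by rewrite tau0 X0.
have [E1 E2 _] := H 0 (lexx 0); have [E3 E4 XT] := H T (ltW T0).
have [zT1 zT2] := zT 0; rewrite add0r in zT1 zT2.
have [XE cE sE] : [/\ X (tau T) = X (tau 0), cos (tau T) = cos (tau 0) & sin (tau T) = sin (tau 0)].
  apply: w_inj.
  - exact: good_itv (le_trans XT (ltW dd)).
  - by apply: good_itv; rewrite tau0 X0 (le_trans x0p)// ltW.
  - by rewrite -[LHS]/(liftx X tau T) -E3 zT1 E1.
  - by rewrite -[LHS]/(lifty X tau T) -E4 zT2 E2.
rewrite tau0 in XE cE sE.
have D0 : 0 < tau T - s0 by rewrite subr_gt0 -tau0 mono'.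
have [|n n0 nE] := cos_eq1_mul D0; first by rewrite cosB cE sE -!expr2 cos2Dsin2.
exists X, s0, n; split=> //.
- by rewrite -nE subrKC.
- move=> s ss0; have t0 : 0 <= tm s.
    by move: ss0; rewrite le_eqVlt => /predU1P[<-|/mono/ltW]; rewrite tm0.
  by have [_ _] := H _ t0; rewrite tmK.
have tau_ge t : 0 <= t -> s0 <= tau t.
  by rewrite le_eqVlt => /predU1P[<-|/mono'/ltW]; rewrite tau0.
split=> [t|s ss0].
  (* Uniqueness holds only forward; an earlier time is first moved by whole periods. *)
  have [k kP] : exists k, 0 <= t + T *+ k.
    have h : 0 <= `|t| / T by rewrite divr_ge0// ltW.
    have := archi_boundP h; set k := Num.bound _; rewrite ltr_pdivrMr// => hk; exists k.
    rewrite -mulr_natl; have := ler_norm (- t); rewrite normrN.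
    by move: hk; lra.
  have zk : zx (t + T *+ k) = zx t /\ zy (t + T *+ k) = zy t.
    elim: k {kP} => [|k [I1 I2]]; first by rewrite mulr0n addr0.
    by have [J1 J2] := zT (t + T *+ k); rewrite mulrSr addrA J1 J2.
  have [F1 F2 _] := H _ kP; rewrite zk.1 zk.2 in F1 F2.
  by exists (tau (t + T *+ k)); rewrite ?tau_ge.
have t0 : 0 <= tm s.
  by move: ss0; rewrite le_eqVlt => /predU1P[<-|/mono/ltW]; rewrite tm0.
exists (tm s); have [F1 F2 _] := H _ t0.
by rewrite F1 F2 /liftx /lifty tmK.
Qed.

Lemma wx_lip x y s : 0 < x < pi / 2 -> 0 < y < pi / 2 ->
  `|wx x s - wx y s| <= 4 * `|x - y| /\ `|wy x s - wy y s| <= 4 * `|x - y|.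
Proof.
move=> xi yi.
have cl (f : R -> R) (df : R -> R) (u v k : R) : (forall x, is_derive x 1 f (df x)) ->
    (forall x, `|df x| <= 1) -> `|k| <= 1 -> `|u - v| <= `|x - y| * `|k| -> `|f u - f v| <= `|x - y|.
  move=> fd df1 k1 uv; apply: le_trans (lipschitz_increment v u fd df1) _.
  by rewrite mul1r (le_trans uv)// ler_piMr.
have prod (A B A' B' : R) : `|A - A'| <= `|x - y| -> `|B - B'| <= `|x - y| ->
    `|A| <= 1 -> `|B'| <= 1 -> `|2 * A * B - 2 * A' * B'| <= 4 * `|x - y|.
  move=> h1 h2 h3 h4; rewrite (_ : _ - _ = 2 * (A * (B - B') + (A - A') * B')); last by ring.
  rewrite normrM (ger0_norm (_ : (0 : R) <= 2))//.
  have := ler_normD (A * (B - B')) ((A - A') * B'); rewrite !normrM.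
  have : `|A| * `|B - B'| <= 1 * `|x - y| by rewrite ler_pM.
  have : `|A - A'| * `|B'| <= `|x - y| * 1 by rewrite ler_pM.
  by lra.
have dcos (z : R) : is_derive z 1 (@cos R) (- sin z) := is_derive_cos z.
have dsin (z : R) : is_derive z 1 (@sin R) (cos z) := is_derive_sin z.
have nsin (z : R) : `|- sin z| <= 1 by rewrite normrN sin_le1_norm.
have c1 := cos_le1_norm s.
have hc : `|cos x - cos y| <= `|x - y|.
  by apply: (cl cos _ x y 1 dcos nsin); rewrite normr1 ?mulr1.
have i1 : `|x * cos s - y * cos s| <= `|x - y| * `|cos s| by rewrite -mulrBl normrM.
have i2 : `|(pi - x) * cos s - (pi - y) * cos s| <= `|x - y| * `|cos s|.
  by rewrite -mulrBl normrM (_ : pi - x - _ = - (x - y)) ?normrN//; ring.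
have [s0|/ltW s0] := leP 0 (sin s).
  have [-> ->] := wx_in x s0; have [-> ->] := wx_in y s0.
  rewrite /inx /iny; split; rewrite -opprD normrN; apply: prod; rewrite ?cos_le1_norm ?sin_le1_norm//.
    exact: (cl _ _ _ _ _ dcos nsin c1 i1).
  exact: (cl _ _ _ _ _ dsin (@cos_le1_norm R) c1 i1).
have [-> ->] := wx_out x s0; have [-> ->] := wx_out y s0.
rewrite /outx /outy; split.
  apply: prod; rewrite ?cos_le1_norm ?sin_le1_norm//.
  exact: (cl _ _ _ _ _ dcos nsin c1 i2).
rewrite -opprD normrN; apply: prod; rewrite ?cos_le1_norm ?sin_le1_norm//.
exact: (cl _ _ _ _ _ dsin (@cos_le1_norm R) c1 i2).
Qed.

Lemma orbit_tube X Y (c delta : R) : (forall s, 0 < X s < pi / 2) -> (forall s, 0 < Y s < pi / 2) ->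
  (forall s, `|X s - Y s| <= c) -> 8 * c < delta -> orbit X `<=` tube delta (orbit Y).
Proof.
move=> Xi Yi XY cdel w [s _ <-]; exists (orbit_point (Y s) s); first by exists s.
have c_ge0 : 0 <= c := le_trans (normr_ge0 _) (XY s).
have del0 : 0 < delta by move: cdel; lra.
have [l1 l2] := wx_lip s (Xi s) (Yi s).
rewrite (_ : _ - _ = (wx (X s) s - wx (Y s) s) +i* (wy (X s) s - wy (Y s) s)); last first.
  by rewrite /orbit_point; apply/eqP; rewrite eq_complex /=; apply/andP; split; apply/eqP; ring.
rewrite complex_norm_lt//.
have sq (q : R) : `|q| <= 4 * `|X s - Y s| -> q ^+ 2 <= (delta / 2) ^+ 2.
  move=> qh; rewrite -[q ^+ 2]real_normK ?num_real// ler_pXn2r ?nnegrE ?divr_ge0 ?(ltW del0)//.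
  by have := XY s; lra.
have := sq _ l1; have := sq _ l2; rewrite expr_div_n.
have : 0 < delta ^+ 2 by rewrite exprn_gt0.
by lra.
Qed.

End Follow.

(** * A limit cycle from each simple zero *)

Section Bifurcation.
Context {R : realType}.
Implicit Types (s t u v x y : R) (X : R -> R).
Variables a c0 c2 c3 c4 : R.
Local Notation F := (field (coef_re a c0 c2 c3 c4) coef_im).
Local Notation field_x := (field_x a c0 c2 c3 c4).
Local Notation melnikov := (melnikov a c0 c2 c3 c4).

Lemma cst_flow (p d x : R) : flow field_x p d 0 (fun=> x).
Proof. by move=> s; rewrite mul0r; exact: derive_cst1. Qed.

Lemma bifurcation (p : R) : 0 < p < pi / 2 -> melnikov p = 0 ->
  (exists2 m' : R, m' != 0 & is_derive p 1 melnikov m') ->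
  exists (e1 : R) (Xs : R -> R -> R), [/\ 0 < e1,
    periodic_orbit (F 0) (orbit (fun=> p)),
    forall e, 0 < `|e| < e1 -> limit_cycle (F e) (orbit (Xs e)) /\
      forall s, 0 < Xs e s < pi / 2 &
    forall c : R, 0 < c -> exists2 e2 : R, 0 < e2 & forall e s, 0 < `|e| < e2 ->
      `|Xs e s - p| <= c].
Proof.
move=> p_itv m_p [m' m'0 dm].
have [dg dg0 good] := good_nbhs a c0 c2 c3 c4 p_itv.
have ne0 (r : R) : 2^-1 <= r <= 2 -> r != 0.
  by move=> /andP[h _]; rewrite gt_eqF// (lt_le_trans _ h)// invr_gt0.
have F_cont e x : `|e| < dg -> `|x - p| < dg -> continuous (field_x e x).
  move=> he hx; apply: (continuous_path (@continuous_cst1 R x) _ _ _ _).1 => s;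
    have [xi /ne0 h1 /ne0 h2] := good e x s he hx => //; [exact: cos_gt0_itv|exact: sin_gt0_itv].
have F_mean : exists2 d : R, 0 < d & forall x, `|x - p| < d -> forall Q : R -> R,
    (forall s, is_derive s 1 Q (field_x 0 x s)) -> Q (pi *+ 2) - Q 0 = melnikov x.
  exists dg => // x hx Q dQ; apply: field_mean => //.
  by have [] := good 0 x 0 _ hx; rewrite ?normr0.
have [d [e0 [Xs [[/andP[d0 ddg] /andP[e0_gt0 e0dg]] fex funi per close]]]] :=
  averaging (strict_diff_field a c0 c2 c3 c4 p_itv) (strict_diff_melnikov a c0 c2 c3 c4 p_itv)
    m_p dm m'0 (@field_periodic R a c0 c2 c3 c4) dg0 F_cont F_mean.
have good' e : `|e| < e0 -> forall x s, `|x - p| <= d -> [/\ 0 < x < pi / 2,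
    2^-1 <= din a c0 c2 c3 c4 e x s <= 2 & 2^-1 <= dout a e x s <= 2].
  by move=> he x s hx; apply: good; [exact: lt_le_trans he e0dg|exact: le_lt_trans hx ddg].
have z0 : `|0 : R| < e0 by rewrite normr0.
have pd0 : 0 < p - d.
  have [|/andP[]//] := @good' 0 z0 (p - d) 0.
  by rewrite addrAC subrr sub0r normrN gtr0_norm.
have pdpi : p + d < pi / 2.
  have [|/andP[]//] := @good' 0 z0 (p + d) 0.
  by rewrite addrAC subrr add0r gtr0_norm.
(* Nested ranges for [x]: the cycle stays within [d / 4], a competing orbit in its tube within
   [d / 2], where averaging gives uniqueness, and the coordinates are controlled up to [d]. *)
have d2 : 0 < d / 2 < d by apply/andP; split; lra.
have d4 : 0 < d / 4 < d / 2 by apply/andP; split; lra.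
have d4d : d / 4 <= d by lra.
have pp2 : p < p + d / 2 by lra.
have pd2 : 0 < p - d / 2 by lra.
have pd2' : p + d / 2 < pi / 2 by lra.
have [ec ec0 ecP] := close (d / 4) (andP d4).1.
have [delta del0 delP] := annulus_close d4 pd2 pd2'.
have [K K0 bound] := perturbation_bound a c0 c2 c3 c4.
(* A lower bound for the height of the crossing points; [eta] is taken at most [q / 16] to meet the
   transversality condition. *)
pose q := 2 * (cos (p + d / 2) * sin (p - d / 2)).
have q0 : 0 < q.
  rewrite !mulr_gt0//.
    by rewrite cos_gt0_itv// pd2' andbT (lt_trans _ pp2)//; case/andP: p_itv.
  by rewrite sin_gt0_itv// pd2 (lt_trans _ pd2')// (lt_trans _ pp2)// gtrBl; case/andP: d2.
pose eta := Num.min 1 (q / 16); have eta0 : 0 < eta <= 1.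
  by rewrite lt_min ltr01 divr_gt0//= ge_min lexx.
have etaq : 16 * eta <= q.
  by rewrite -ler_pdivlMl// mulrC ge_min lexx orbT.
pose e1 := Num.min e0 (Num.min ec (eta / K)).
have e10 : 0 < e1 by rewrite !lt_min e0_gt0 ec0 divr_gt0//; case/andP: eta0.
exists e1, Xs; split=> //.
  (* At [e = 0] constants are flows: the circle of radius [2 cos p] is a periodic orbit of the
     centre. *)
  by apply: (@orbit_periodic R a c0 c2 c3 c4 0 p d (fun=> p) d0 (@good' 0 z0) (@cst_flow p d p)) => // s; rewrite subrr normr0 ltW.
move=> e /andP[e_gt0]; rewrite !lt_min => /and3P[ee0 eec eeK].
have eK : `|e| * K <= eta by rewrite -ler_pdivlMr// ltW.
have [Xf XT Xuni] := per e (introT andP (conj e_gt0 ee0)).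
have Xc s : `|Xs e s - p| <= d / 4 by apply: ecP; rewrite e_gt0.
have Xd s : `|Xs e s - p| <= d by exact: le_trans (Xc s) d4d.
have XT' s : Xs e (s + pi *+ 2) = Xs e s.
  have fp := flow_shift (@field_periodic R a c0 c2 c3 c4) Xf.
  by have := funi e _ _ 0 ee0 fp Xf; rewrite add0r => /(_ XT) /(congr1 (fun f => f s)).
split; last by move=> s; have [] := good' e ee0 _ 0 (Xd s).
split; first exact: (orbit_periodic d0 (good' e ee0) Xf Xd XT').
exists delta => // g [z [T [zsol T0 zT _ ->]]] sub.
pose zx t := complex.Re (z t) - 1; pose zy t := complex.Im (z t).
have zin t : exists x s, [/\ `|x - p| <= d / 2, zx t = wx x s & zy t = wy x s].
  have [|w [s _ <-] h] := sub (z t); first by exists t.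
  have [y [r [yp E]]] := delP _ _ _ (Xc s) h.
  by exists y, r; rewrite /zx /zy E /orbit_point /= addrK.
have itv x : `|x - p| <= d / 2 -> 0 < x < pi / 2.
  by rewrite ler_distl => /andP[h1 h2]; rewrite (lt_le_trans pd2 h1) (le_lt_trans h2 pd2').
have traj t : trajectory a c0 c2 c3 c4 e zx zy t.
  apply: (@solution_trajectory R a c0 c2 c3 c4 e K eta z) => // {}t.
    have [x [s [/itv xi]]] := zin t; rewrite /zx /zy => -> ->.
    exact: w_annulus.
  have [x [s [xp]]] := zin t; rewrite /zx /zy => -> -> r0.
  exact: le_trans etaq (boundary_height pd2 pd2' xp r0).
have zTxy t : zx (t + T) = zx t /\ zy (t + T) = zy t by rewrite /zx /zy zT.
have [Y [s0 [n [Yf n0 YT Yc [zY Yz]]]]] :=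
  follow_orbit d2 (good' e ee0) (fun s0 x0 => fex e s0 x0 ee0) traj zin T0 zTxy.
have YTn s : Y (s + (pi *+ 2) *+ n) = Y s.
  have per' e' x s' : field_x e' x (s' + (pi *+ 2) *+ n) = field_x e' x s'.
    by elim: (n) => [|k IH]; rewrite ?mulr0n ?addr0// mulrSr addrA field_periodic.
  have fp := flow_shift per' Yf.
  by have /(congr1 (fun f => f s)) := funi e _ _ s0 ee0 fp Yf YT.
have Yd s : `|Y s - p| <= d / 2.
  have [k kP] := add_mul_ge s s0 n0; rewrite -[Y s](_ : Y (s + ((pi *+ 2) *+ n) *+ k) = _); first exact: Yc.
  by elim: k {kP} => [|k IH]; rewrite ?mulr0n ?addr0// mulrSr addrA YTn.
(* A competing orbit might close only after [n] turns, hence uniqueness is needed for all multiples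
   of the period. *)
have YX : Y = Xs e by apply: (Xuni Y n) => //; rewrite -[in LHS](add0r (_ *+ n)) YTn.
have zE t : z t = (zx t + 1) +i* zy t by rewrite /zx /zy subrK; case: (z t).
rewrite -YX (orbit_range s0 n0 YTn); apply/seteqP; split=> [w [t _ <-]|w [s ss0 <-]].
  by have [s ss0 [E1 E2]] := zY t; exists s => //; rewrite zE E1 E2.
by have [t [E1 E2]] := Yz s ss0; exists t => //; rewrite zE E1 E2.
Qed.

End Bifurcation.

(** * Distinctness of the five cycles *)

Section Separation.
Context {R : realType}.
Implicit Types (X Y : R -> R).

(** A common point has a single modulus, hence a single [x], which would be within [c] of both [p]
    and [q]. *)
Lemma orbit_neq X Y (p q c : R) : (forall s : R, 0 < X s < pi / 2) ->
  (forall s : R, 0 < Y s < pi / 2) -> (forall s : R, `|X s - p| <= c) ->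
  (forall s : R, `|Y s - q| <= c) -> 2 * c < `|p - q| -> orbit X <> orbit Y.
Proof.
move=> Xi Yi Xp Yq pq XY.
have : orbit Y (orbit_point (X 0) 0) by rewrite -XY; exists 0.
move=> [s _ [/addIr Ex Ey]]; have E := w_modulus_inj (Yi s) (Xi 0) Ex Ey.
have h1 := Xp 0; have h2 := Yq s; rewrite E in h2.
by have := ler_distD (X 0) p q; rewrite (distrC p (X 0)); move: h1 h2 pq; lra.
Qed.

Lemma atan_root_inj : injective (fun k : 'I_5 => atan (root k : R)).
Proof.
move=> j k /(congr1 (@tan R)); rewrite !atanK => E; apply: val_inj; move: E.
by case: j k => -[|[|[|[|[|//]]]]] ? [[|[|[|[|[|//]]]]] ?]; rewrite /root /= => E;
  by [|exfalso; lra].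
Qed.

End Separation.

(** * Assembly of the five families of cycles *)

Theorem theoremB (R : realType) :
  exists (a b : zone -> 'I_5 -> R) (L : 'I_5 -> set R[i])
         (gam : R -> 'I_5 -> set R[i]),
    [/\ forall k, periodic_orbit (field a b 0) (L k),
        \forall eps \near (0 : R)^',
          injective (gam eps) /\
          forall k, limit_cycle (field a b eps) (gam eps k)
      & forall k, hausdorff_cvg (fun eps => gam eps k) (L k)].
Proof.
pose p (k : 'I_5) : R := atan (root k).
have p_itv k : 0 < p k < pi / 2 by have [] := @melnikov_simple_zero R k.
have /choice[e1 /choice[Xs H]] : forall k, exists e1, exists Xs : R -> R -> R, _ :=
  fun k => let: And3 h1 h2 h3 := @melnikov_simple_zero R k in bifurcation h1 h2 h3.
have punct (d : R) : 0 < d -> \forall e \near (0 : R)^', 0 < `|e| < d.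
  move=> d0; near=> e; rewrite normr_gt0; apply/andP; split.
    by near: e; exact: nbhs_dnbhs_neq.
  near: e; apply: nbhs_dnbhs; by exists d => //= y /=; rewrite distrC subr0.
have e1P k : \forall e \near (0 : R)^', 0 < `|e| < e1 k by apply: punct; have [] := H k.
have close (c : R) k : 0 < c -> \forall e \near (0 : R)^', forall s, `|Xs k e s - p k| <= c.
  move=> c0; have [_ _ _ /(_ c c0)[e2 e20 e2P]] := H k.
  by apply: filterS (punct _ e20) => e he s; exact: e2P.
exists (coef_re ca cc0 cc2 cc3 cc4), coef_im, (fun k => orbit (fun=> p k)),
  (fun e k => orbit (Xs k e)); split.
- by move=> k; have [] := H k.
- have sep : \forall e \near (0 : R)^', forall j k, j != k -> orbit (Xs j e) <> orbit (Xs k e).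
    apply: filter_forall => j; apply: filter_forall => k.
    have [->|jk] := eqVneq j k; first by near=> e => /eqP.
    have pjk : 0 < `|p j - p k|.
      rewrite normr_gt0 subr_eq0; apply: contra_neq jk; exact: atan_root_inj.
    (* Within a third of the distance of the zeros, the two ranges of [x] are disjoint. *)
    have c0 : 0 < `|p j - p k| / 3 by rewrite divr_gt0.
    near=> e => _.
    have [_ _ Hj _] := H j; have [_ _ Hk _] := H k.
    apply: (@orbit_neq _ _ _ (p j) (p k) (`|p j - p k| / 3)).
    + by apply: (Hj e _).2; near: e; exact: e1P.
    + by apply: (Hk e _).2; near: e; exact: e1P.
    + by near: e; exact: close.
    + by near: e; exact: close.
    + by rewrite mulrC -mulrA gtr_pMr//; lra.
  near=> e; split.
    move=> j k E; apply/eqP/negP => /negP jk.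
    by have : forall j k, j != k -> orbit (Xs j e) <> orbit (Xs k e); [near: e|move=> /(_ j k jk)].
  have : forall k, 0 < `|e| < e1 k by near: e; exact: filter_forall.
  by move=> he k; have [_ _ /(_ e (he k))[]] := H k.
- move=> k d d0; have [_ _ Hk _] := H k.
  (* [orbit_tube] loses a factor 8 from [x] to the plane, with strict inequality. *)
  have c0 : 0 < d / 16 by rewrite divr_gt0.
  have cd : 8 * (d / 16) < d by lra.
  near=> e.
  have he : 0 < `|e| < e1 k by near: e; exact: e1P.
  have hc : forall s, `|Xs k e s - p k| <= d / 16 by near: e; exact: close.
  have [_ Xi] := Hk e he.
  split; first exact: (orbit_tube Xi (fun=> p_itv k) hc cd).
  by apply: (orbit_tube (fun=> p_itv k) Xi _ cd) => s; rewrite distrC.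
Unshelve. all: by end_near.
Qed.
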